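(* Let $d\ge 1$, and consider the Poisson balloon process on $\mathbb{R}^d$ with the Euclidean metric $\rho$ and Lebesgue measure $\mu$. Then the process is recurrent: almost surely, for every $x\in\mathbb{R}^d$, the set of times $\{t\ge 0 : x\in S_t\}$ is unbounded. Moreover, for a fixed origin $o\in\mathbb{R}^d$, $$\liminf_{t\to\infty}\frac{R_t}{t}=0\quad\text{almost surely.}$$
   Context: Balloon process. Let $(\Omega,\rho)$ be a metric space and let $\Pi$ be a point process on $\Omega$, with $[\Pi]$ its set of points. Around each $x\in[\Pi]$ a ball (balloon) grows at rate 1, so that at time $t$ it has radius $t$; whenever two balloons touch, both immediately pop and are removed. Formally, each $x\in[\Pi]$ has a popping time $T_x\in(0,\infty]$ and is active at time $t$ iff $t<T_x$, where (i) any two distinct points $x,y$ active at time $t$ satisfy $\rho(x,y)>2t$; (ii) if $T_x<\infty$, then there is $y\in[\Pi]$, $y\ne x$, with $T_y=T_x$ and $\rho(x,y)=2T_x$. For the Poisson process considered here, almost surely there is exactly one such family of popping times, so the process is well defined. The Poisson balloon process on a metric measure space $(\Omega,\rho,\mu)$ is the balloon process started from a Poisson point process $\Pi$ with intensity measure $\mu$. Notation: $\Pi_t$ is the point process of centers of balloons active at time $t$, with $[\Pi_t]$ its set of points; $S_t=\{x\in\Omega:\rho(x,[\Pi_t])\le t\}$ is the set covered by balloons at time $t$; $R_t=\rho(o,[\Pi_t])$ is the distance from the origin $o$ to the nearest active center at time $t$ (where $\rho(x,S)=\inf_{y\in S}\rho(x,y)$). *)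

(* Defs.v *)
From HB Require Import structures.
From mathcomp Require Export all_boot all_order all_algebra.
From mathcomp Require Export all_classical all_reals all_analysis.
From mathcomp Require Export measurable_realfun.
Export Order.TTheory GRing.Theory Num.Theory.
Export numFieldNormedType.Exports.

Set Implicit Arguments.
Unset Strict Implicit.
Unset Printing Implicit Defensive.

Local Open Scope classical_set_scope.
Local Open Scope ring_scope.
Local Open Scope ereal_scope.

(* The tuple sigma-algebra is the one generated by the coordinates, i.e. the
   Borel sigma-algebra of R^d.  The matrix type 'rV[R]_d is avoided because its
   library norm is the sup norm and it has no measurable structure. *)
Notation Rspace R d := (d.-tuple (measurableTypeR R)).

Definition euclidean_dist {R : realType} {d : nat} (x y : Rspace R d) : R :=
  Num.sqrt (\sum_(i < d) ((tnth x i : R) - (tnth y i : R)) ^+ 2)%R.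

(* The d-fold product of the Lebesgue measure of the line. *)
Fixpoint lebesgue_space {R : realType} (d : nat) :
    set (Rspace R d) -> \bar R :=
  match d with
  | 0%N => \d_[tuple]
  | d'.+1 => pushforward (lebesgue_measure \x @lebesgue_space R d')
               (fun p : measurableTypeR R * Rspace R d' => [tuple of p.1 :: p.2])
  end.

Section point_process.
Context {R : realType} {S : choiceType}.

(* A configuration of points is a multiset: [xi x] is the multiplicity of x. *)
Definition points (xi : S -> nat) : set S := [set x | (0 < xi x)%N].

Definition npoints (xi : S -> nat) (A : set S) : \bar R :=
  \esum_(x in A) (xi x)%:R%:E.

End point_process.

(* The Poisson weights are written out because the library's [poisson_pmf] is
   constantly 1 at rate 0, which would be wrong for null sets. *)
Definition poisson_process {R : realType} {dT dS : measure_display}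
    {T : measurableType dT} {S : measurableType dS} (P : probability T R)
    (mu : set S -> \bar R) (Pi : T -> S -> nat) : Prop :=
  [/\ forall A, measurable A ->
        measurable_fun [set: T] (fun w => npoints (Pi w) A : \bar R),
      forall A, measurable A -> mu A < +oo -> forall k : nat,
        P [set w | npoints (Pi w) A = (k%:R : R)%:E] =
        (fine (mu A) ^+ k / k`!%:R * expR (- fine (mu A)))%R%:E
    & forall (n : nat) (A : 'I_n -> set S),
        (forall i, measurable (A i)) -> trivIset [set: 'I_n] A ->
        forall B : 'I_n -> set (\bar R), (forall i, measurable (B i)) ->
        P (\bigcap_(i in [set: 'I_n]) [set w | B i (npoints (Pi w) (A i))]) =
        \prod_(i < n) P [set w | B i (npoints (Pi w) (A i))]].

Section balloons.
Context {R : realType} {S : Type} (rho : S -> S -> R).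

Definition active (X : set S) (tau : S -> \bar R) (t : R) : set S :=
  [set x | X x /\ t%:E < tau x].

(* The values of [tau] outside X are irrelevant. *)
Definition popping_times (X : set S) (tau : S -> \bar R) : Prop :=
  [/\ forall x, X x -> 0 < tau x,
      forall t : R, (0 <= t)%R -> forall x y,
        active X tau t x -> active X tau t y -> x <> y ->
        (2 * t < rho x y)%R
    & forall x, X x -> tau x < +oo ->
        exists y, [/\ X y, y <> x, tau y = tau x
                    & (rho x y)%:E = 2%:E * tau x]].

Definition set_dist (x : S) (A : set S) : \bar R :=
  ereal_inf [set (rho x y)%:E | y in A].

Definition covered (X : set S) (tau : S -> \bar R) (t : R) : set S :=
  [set x | set_dist x (active X tau t) <= t%:E].

End balloons.

(* [Tau w x] is the popping time of x in the realization w.  The family is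
   almost surely determined by [Pi], so no measurability is required of it. *)
Definition balloon_process {R : realType} {dT : measure_display} {S : choiceType}
    {T : measurableType dT} (P : probability T R) (rho : S -> S -> R)
    (Pi : T -> S -> nat) (Tau : T -> S -> \bar R) : Prop :=
  {ae P, forall w, popping_times rho (points (Pi w)) (Tau w)}.

(* Main.v *)
(* Call x and y matched when they pop each other; T_x is half their distance, and
   balloons pop exactly in mutually nearest pairs, as in a stable matching.  It is
   enough to find, for all k > 0 and C, matched pairs with |x| < k |x - y| - C.

   Almost surely there are no isosceles triangles and no infinite chains of points
   with decreasing steps: the steps of a chain eventually lie in a thin annulus, and
   the expected number of such chains decays geometrically.  Jumping to the nearest
   unmatched point would produce such a chain from two unmatched points, so there is
   at most one unmatched point, and by translation invariance there is none.

   Next, for every L some pair with |x - y| > L has |x| < |x - y| + 2.  Otherwise a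
   finite union B of cells around the origin, crossed by no pair, can be emptied
   without changing the matching outside; with positive probability the process has
   a single point in B, near the origin, and no outer point prefers it to its
   partner, so it would be unmatched.

   Finally let E be the translation invariant event that |x| >= k |x - y| - C for
   some C and all pairs.  By a Vitali covering argument over a large lattice box, on
   E the density of lattice points u with |x - u| < 2 |x - y| for some pair with
   |x - y| > L is at most a constant times that of the points with
   |x - u| < (k / 2) |x - y|.  At u = 0 the first event is almost sure on E, while
   the probability of the second one tends to 0 as L grows; hence P(E) = 0. *)

Require Import Defs.
From mathcomp Require Import lra ring zify.
Set Implicit Arguments. Unset Strict Implicit. Unset Printing Implicit Defensive.
Local Open Scope ring_scope.

(** * Counting lattice points in thin annuli *)

(** The process is known only through its counts, so every event has to be reduced to the
    occupancies of finitely many dyadic cells. This works because being matched has a finite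
    certificate that survives small perturbations: events built from it are increasing limits of
    finite unions of occupancy patterns. Their probabilities are limits of sums of products of cell
    probabilities, which depend on volumes only. Invariance under integer translations and
    independence of disjoint regions follow, and conditioning on a single occupied cell replaces the
    insertion of a point. Transience is not stable in this sense; it is reached as a limit of
    differences of stable events.

    The final contradiction needs a Vitali constant that depends on k but not on L, so that L can
    tend to infinity with k fixed. Lengths are therefore truncated at some M only inside the
    counting argument, and the lattice box is taken large compared with M, so that M leaves no trace
    in the constant. *)

Lemma card_diam N (A : {set 'I_N}) L :
  (forall x y : 'I_N, x \in A -> y \in A -> (x <= y)%N -> (y - x < L)%N) -> (#|A| <= L)%N.
Proof.
move=> H; case: (set_0Vmem A) => [->|[a0 a0A]]; first by rewrite cards0.
case: (arg_minnP (fun x : 'I_N => val x) a0A) => a aA amin.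
rewrite cardE -(size_map (fun x : 'I_N => (x - a)%N)) -[leqRHS](size_iota 0).
apply: uniq_leq_size.
  rewrite map_inj_in_uniq ?enum_uniq// => x y; rewrite !mem_enum => xA yA e.
  by apply: val_inj; have := amin _ xA; have := amin _ yA; simpl; lia.
move=> _ /mapP[x + ->]; rewrite mem_enum mem_iota add0n => xA.
by rewrite leq0n/=; apply: H => //; exact: amin.
Qed.

(** Split at [M], the code of 0. On one side of 0, [y - x >= L] would give
    [|y^2 - x^2| >= (y - x)^2 >= L^2 > 2 H], while both squares lie within [H] of [t]. *)
Lemma card_sqr_window M (t : int) H L : (2 * H < L ^ 2)%N ->
  (#|[set z : 'I_(2 * M).+1 | (`| (z%:Z - M%:Z) ^+ 2 - t | <= H%:Z)%R]| <= 2 * L)%N.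
Proof.
move=> HL; set B := [set z | _].
have -> : B = [set z in B | (M <= z)%N] :|: [set z in B | (z <= M)%N].
  by apply/setP => z; rewrite !inE -andb_orr leq_total andbT.
apply: (leq_trans (leq_card_setU _ _)); rewrite [leqRHS]mul2n -addnn; apply: leq_add;
  apply: card_diam => x y; rewrite !inE => /andP[xB xM] /andP[yB yM] xy; nia.
Qed.

Section annulus.
Context {d : nat}.

(** Offsets in the cube [[-M, M]^d], stored shifted by [M] so that they form a finite type; [oint]
    decodes them. *)
Definition off (M : nat) : finType := {ffun 'I_d -> 'I_(2 * M).+1}.
Definition oint M (a : off M) : {ffun 'I_d -> int} := [ffun i => (a i)%:Z - M%:Z].
Definition sqn (k : {ffun 'I_d -> int}) : int := \sum_i (k i) ^+ 2.

Lemma card_slice (i0 : 'I_d) N :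
  #|[set g : {ffun 'I_d -> 'I_N.+1} | g i0 == ord0]| = (N.+1 ^ d.-1)%N.
Proof.
pose F i : {pred 'I_N.+1} := if i == i0 then pred1 ord0 else predT.
rewrite (_ : #|_| = #|family F|); last first.
  apply: eq_card => g; rewrite inE; apply/eqP/familyP => [g0 i|/(_ i0)]; rewrite /F.
    by case: eqP => [->|//]; rewrite inE g0.
  by rewrite eqxx inE => /eqP.
rewrite card_family foldrE big_map big_enum/= (bigD1 i0)//= {1}/F eqxx card1 mul1n.
rewrite (eq_bigr (fun=> N.+1)); last by move=> i /negPf ii; rewrite /F ii card_ord.
by rewrite prod_nat_const cardC1 card_ord.
Qed.

(** Once the other coordinates are fixed, the square of coordinate [i0] is confined to a window, so
    one of the [d] factors [2 M + 1] drops to [2 L]. The map [upd] erases coordinate [i0], and its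
    fibres are counted by [card_sqr_window]. *)
Lemma card_annulus (i0 : 'I_d) M (s : int) H L : (2 * H < L ^ 2)%N ->
  (#|[set a : off M | (`| sqn (oint a) - s | <= H%:Z)%R]| <=
    (2 * M).+1 ^ d.-1 * (2 * L))%N.
Proof.
move=> HL; set A := [set a | _].
pose upd (a : off M) : off M := [ffun i => if i == i0 then ord0 else a i].
rewrite -sum1_card (partition_big upd (fun g : off M => g i0 == ord0)); last first.
  by move=> a _; rewrite ffunE eqxx.
rewrite -(card_slice i0 (2 * M)) -sum_nat_const big_mkcond/= [leqRHS]big_mkcond/=.
apply: leq_sum => g _; rewrite inE; case: ifP => // g0.
pose t : int := s - \sum_(i < d | i != i0) ((g i)%:Z - M%:Z) ^+ 2.
apply: leq_trans (card_sqr_window M t HL).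
rewrite sum1_card -(card_in_imset (f := fun a : off M => a i0)).
  apply/subset_leq_card/fintype.subsetP => _ /imsetP[a + ->]; rewrite unfold_in => /andP[+ /eqP ag]; rewrite inE.
  rewrite /sqn (bigD1 i0)//= ffunE.
  rewrite (eq_bigr (fun i => ((g i)%:Z - M%:Z) ^+ 2)); last first.
    by move=> i ii; rewrite ffunE -ag ffunE (negPf ii).
  move=> h; rewrite -[X in is_true X]/(a i0 \in [set z : 'I_(2 * M).+1 | `| (z%:Z - M%:Z) ^+ 2 - t| <= H%:Z]) inE.
  by rewrite /t opprB addrA.
move=> a b; rewrite !unfold_in => /andP[_ /eqP ag] /andP[_ /eqP bg] e.
apply/ffunP => i; have [->//|ii] := eqVneq i i0.
have := congr1 (fun h : off M => h i) ag; have := congr1 (fun h : off M => h i) bg.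
by rewrite !ffunE (negPf ii) => -> ->.
Qed.

Definition flat n M H : pred {ffun 'I_n.+1 -> off M} := fun a =>
  [forall i, (`| sqn (oint (a i)) - sqn (oint (a ord0)) | <= H%:Z)%R].

(** The first offset is free; each of the other [n] lies in the annulus that the first one
    determines. *)
Lemma card_flat (i0 : 'I_d) n M H L : (2 * H < L ^ 2)%N ->
  (#|@flat n M H| <= (2 * M).+1 ^ d * ((2 * M).+1 ^ d.-1 * (2 * L)) ^ n)%N.
Proof.
move=> HL.
rewrite -sum1_card (partition_big (fun a : {ffun 'I_n.+1 -> off M} => a ord0) predT)//=.
rewrite -[X in (_ <= X ^ d * _)%N]card_ord -{1}[X in (_ <= _ ^ X * _)%N]card_ord.
rewrite -card_ffun -sum_nat_const; apply: leq_sum => c _.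
pose F (i : 'I_n.+1) : {pred off M} :=
  if i == ord0 then pred1 c else [pred e | (`| sqn (oint e) - sqn (oint c) | <= H%:Z)%R].
rewrite sum1_card; apply: (@leq_trans #|family F|).
  apply/subset_leq_card/fintype.subsetP => a; rewrite unfold_in => /andP[+ /eqP ac].
  move=> /forallP aH; apply/familyP => i; rewrite /F.
  by case: eqP => [->|_]; rewrite inE ?ac//; have := aH i; rewrite ac.
rewrite card_family foldrE big_map big_enum/= big_ord_recl {1}/F eqxx card1 mul1n.
rewrite -[X in (_ <= _ ^ X)%N](card_ord n) -prod_nat_const.
apply: leq_prod => i _; apply: leq_trans (card_annulus i0 M (sqn (oint c)) HL).
by apply: subset_leq_card; apply/fintype.subsetP => e; rewrite /F/= !inE.
Qed.

End annulus.

Local Open Scope classical_set_scope.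
Local Open Scope ring_scope.

(** * Matched pairs *)

Section matched.
Context {R : realType} {S : Type} (rho : S -> S -> R).
Hypothesis rhoC : forall x y, rho x y = rho y x.

(* [matched X x y] certifies by a well-founded tree that x and y pop each other:
   every other point of X that could touch one of them first is already matched
   elsewhere.  For locally finite X such a certificate only involves finitely many
   points, which makes it stable under small perturbations of X. *)
Inductive matched (X : set S) : S -> S -> Prop := Matched x y (f : S -> S) of
    X x & X y & x <> y
  & (forall c, X c -> c <> x -> c <> y ->
      rho c x <= rho x y \/ rho c y <= rho x y -> f c <> x /\ f c <> y)
  & (forall c, X c -> c <> x -> c <> y ->
      rho c x <= rho x y \/ rho c y <= rho x y -> matched X c (f c)) :
  matched X x y.

Lemma matched_sym X x y : matched X x y -> matched X y x.
Proof.
case=> {}x {}y f Xx Xy xy fne fm; apply: (@Matched X y x f) => //.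
- by move=> /esym.
- move=> c Xc cy cx cl.
  have [] : f c <> x /\ f c <> y; last by [].
  by apply: fne => //; rewrite (rhoC x y); tauto.
- by move=> c Xc cy cx cl; apply: fm => //; rewrite (rhoC x y); tauto.
Qed.

Lemma matched_in X x y : matched X x y -> [/\ X x, X y & x <> y].
Proof. by case. Qed.

(** Of two pairs sharing a point, the other end of the shorter one competes with the longer pair,
    whose certificate matches it elsewhere. Either certificate may have to be unfolded, so the
    induction is nested. *)
Lemma matched_uniq X x y z : matched X x y -> matched X x z -> y = z.
Proof.
move=> mxy.
(* A competitor can meet the pair at either end, so both ends are treated at once. *)
suff H : forall a z, matched X a z -> (a = x -> z = y) /\ (a = y -> z = x).
  by move=> /H [/(_ erefl)].
elim: mxy => {z} {}x {}y f Xx Xy xy fne fm IH a z; elim=> {}a {}z g Xa Xz az gne gm IHg.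
have mxy : matched X x y by apply: (@Matched X x y f).
have maz : matched X a z by apply: (@Matched X a z g).
split=> ea; subst a.
- apply: contrapT => zy.
  have [le|lt] := leP (rho x z) (rho x y).
    have zx : z <> x by apply/nesym.
    have cl : rho z x <= rho x y \/ rho z y <= rho x y by left; rewrite rhoC.
    have [fx _] := fne _ Xz zx zy cl.
    by apply: fx; have [+ _] := IH _ Xz zx zy cl _ _ (matched_sym maz); move=> /(_ erefl).
  have yx : y <> x by apply/nesym.
  have yz : y <> z by apply/nesym.
  have cl : rho y x <= rho x z \/ rho y z <= rho x z by left; rewrite rhoC ltW.
  have [gx _] := gne _ Xy yx yz cl.
  by apply: gx; have [_ h] := IHg _ Xy yx yz cl; exact: h.
- apply: contrapT => zx.
  have [le|lt] := leP (rho y z) (rho x y).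
    have zy : z <> y by apply/nesym.
    have cl : rho z x <= rho x y \/ rho z y <= rho x y by right; rewrite rhoC.
    have [_ fy] := fne _ Xz zx zy cl.
    by apply: fy; have [+ _] := IH _ Xz zx zy cl _ _ (matched_sym maz); move=> /(_ erefl).
  have xz : x <> z by apply/nesym.
  have cl : rho x y <= rho y z \/ rho x z <= rho y z by left; rewrite ltW.
  have [gy _] := gne _ Xx xy xz cl.
  by apply: gy; have [h _] := IHg _ Xx xy xz cl; exact: h.
Qed.

(** If [c] were at least as far from [e] as from [x], then [x] would compete with the pair [c], [e],
    and the induction hypothesis for that pair, read at [x], would give [rho x y < rho x c], against
    [rho c x <= rho x y]. *)
Lemma matched_lt X x y : matched X x y -> forall c e, matched X c e ->
  c <> x -> c <> y ->
  (rho c x <= rho x y -> rho c e < rho c x) /\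
  (rho c y <= rho x y -> rho c e < rho c y).
Proof.
elim=> {}x {}y f Xx Xy xy fne fm IH c e mce cx cy.
have mxy : matched X x y by apply: (@Matched X x y f).
have Xc : X c by case: (matched_in mce).
have xc : x <> c by apply/nesym.
have yc : y <> c by apply/nesym.
split=> cl.
- rewrite ltNge; apply/negP => le.
  have cl' : rho c x <= rho x y \/ rho c y <= rho x y by left.
  have [f1 f2] := fne _ Xc cx cy cl'.
  have ee := matched_uniq mce (fm _ Xc cx cy cl'); subst e.
  have xe : x <> f c by apply/nesym.
  have [/(_ _)] := IH _ Xc cx cy cl' _ _ mxy xc xe.
  by rewrite rhoC => /(_ le); rewrite ltNge cl.
- rewrite ltNge; apply/negP => le.
  have cl' : rho c x <= rho x y \/ rho c y <= rho x y by right.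
  have [f1 f2] := fne _ Xc cx cy cl'.
  have ee := matched_uniq mce (fm _ Xc cx cy cl'); subst e.
  have ye : y <> f c by apply/nesym.
  have [/(_ _)] := IH _ Xc cx cy cl' _ _ (matched_sym mxy) yc ye.
  by rewrite rhoC => /(_ le); rewrite (rhoC y x) ltNge cl.
Qed.

(** If [x] pops no later than time [rho x y / 2], it pops against some [z]. Were [z] not [y], it
    would compete with the pair; by induction and [matched_lt] it would then pop strictly before
    [x], which is absurd. *)
Lemma matched_popping X (tau : S -> \bar R) x y : (forall x y, 0 <= rho x y) ->
  popping_times rho X tau -> matched X x y -> tau x = (rho x y / 2)%:E.
Proof.
move=> rho0 [tau0 tau_far tau_fin].
move=> mxy; suff : tau x = (rho x y / 2)%:E /\ tau y = (rho x y / 2)%:E by case.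
elim: mxy => {}x {}y f Xx Xy xy fne fm IH.
have key : forall x y, (matched X x y) -> (forall c : S, X c -> c <> x -> c <> y ->
    rho c x <= rho x y \/ rho c y <= rho x y ->
    tau c = (rho c (f c) / 2)%:E /\ tau (f c) = (rho c (f c) / 2)%:E) ->
    (forall c : S, X c -> c <> x -> c <> y ->
    rho c x <= rho x y \/ rho c y <= rho x y -> matched X c (f c)) ->
    (tau x <= (rho x y / 2)%:E)%E -> tau x = (rho x y / 2)%:E /\ tau y = (rho x y / 2)%:E.
  move=> {Xx Xy xy fne IH fm} {}x {}y mxy IH fm tle.
  have [Xx Xy xy] := matched_in mxy.
  have tfin : (tau x < +oo)%E by rewrite (le_lt_trans tle) ?ltry.
  have [z [Xz zx tz xz]] := tau_fin x Xx tfin.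
  have tx0 := tau0 x Xx.
  move: tz xz tle tx0 tfin; case E : (tau x) => [s||] //= tz.
  move=> [xz] + + _; rewrite !lee_fin lte_fin => tle s0.
  have [zy|zy] := pselect (z = y).
    by subst z; have -> : rho x y / 2 = s by rewrite xz; field.
  have cl : rho z x <= rho x y \/ rho z y <= rho x y by left; rewrite rhoC xz; lra.
  have [h _] := IH _ Xz zx zy cl.
  have [lt _] := matched_lt mxy (fm _ Xz zx zy cl) zx zy.
  have {}lt : rho z (f z) < rho z x by apply: lt; rewrite rhoC xz; lra.
  have s1 : s = rho z (f z) / 2 by move: h; rewrite tz => -[].
  move: lt; rewrite (rhoC z x) xz => lt1; have : 2 * s < 2 * s by lra.
  by rewrite ltxx.
have mxy : matched X x y by apply: (@Matched X x y f).
have [tx|tx] := leP (tau x) (rho x y / 2)%:E; first exact: key.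
have [ty|ty] := leP (tau y) (rho x y / 2)%:E.
  have := key y x (matched_sym mxy); rewrite (rhoC y x) => h.
  have [] := h; [ | |by []|by split].
  - by move=> c Xc cy cx cl; apply: IH => //; tauto.
  - by move=> c Xc cy cx cl; apply: fm => //; tauto.
(* Otherwise both points are still active at time [rho x y / 2], when their distance is exactly
   twice the time: the balloons already touch. *)
have h1 := rho0 x y; have h2 := fun t0 => tau_far (rho x y / 2) t0 x y (conj Xx tx) (conj Xy ty) xy.
have : 0 <= rho x y / 2 by rewrite divr_ge0.
by move=> /h2; rewrite mulrC divfK ?pnatr_eq0// ltxx.
Qed.

End matched.

(** * Euclidean distance and dyadic cells *)

Section euclid.
Context {R : realType} {d : nat}.
Implicit Types (x y z : Rspace R d).

Lemma edistC x y : euclidean_dist x y = euclidean_dist y x.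
Proof.
by congr Num.sqrt; apply: eq_bigr => i _; rewrite -sqrrN opprB.
Qed.

Lemma edist_ge0 x y : 0 <= euclidean_dist x y.
Proof. exact: sqrtr_ge0. Qed.

Lemma edist_xx x : euclidean_dist x x = 0.
Proof. by rewrite /euclidean_dist big1 ?sqrtr0// => i _; rewrite subrr expr0n. Qed.

Lemma edist_sqr x y :
  euclidean_dist x y ^+ 2 = \sum_(i < d) ((tnth x i : R) - (tnth y i : R)) ^+ 2.
Proof. by rewrite sqr_sqrtr// sumr_ge0// => i _; rewrite sqr_ge0. Qed.

Lemma cauchy_schwarz (a b : 'I_d -> R) :
  (\sum_i a i * b i) ^+ 2 <= (\sum_i a i ^+ 2) * (\sum_i b i ^+ 2).
Proof.
set A := \sum_i a i ^+ 2; set B := \sum_i b i ^+ 2; set C := \sum_i a i * b i.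
have B0 : 0 <= B by rewrite sumr_ge0// => i _; rewrite sqr_ge0.
have [B1|B1] := eqVneq B 0.
  suff -> : C = 0 by rewrite expr0n B1 mulr0.
  rewrite /C big1// => i _.
  have : b i ^+ 2 = 0.
    apply/eqP; have := B1; move/eqP; rewrite psumr_eq0; last first.
      by move=> j _; rewrite sqr_ge0.
    by move/allP => /(_ i); rewrite mem_index_enum => /(_ isT).
  by move/eqP; rewrite sqrf_eq0 => /eqP ->; rewrite mulr0.
have Bp : 0 < B by rewrite lt_neqAle eq_sym B1.
have : 0 <= \sum_i (B * a i - C * b i) ^+ 2.
  by rewrite sumr_ge0// => i _; rewrite sqr_ge0.
have -> : \sum_i (B * a i - C * b i) ^+ 2 = B * (A * B - C ^+ 2).
  transitivity (B ^+ 2 * A - 2 * B * C * C + C ^+ 2 * B); last by ring.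
  rewrite [X in X - _]mulr_sumr [X in _ - X]mulr_sumr [X in _ + X]mulr_sumr.
  rewrite -sumrB -big_split/=; apply: eq_bigr => i _; ring.
by rewrite pmulr_rge0// subr_ge0.
Qed.

Lemma edist_triangle x y z :
  euclidean_dist x z <= euclidean_dist x y + euclidean_dist y z.
Proof.
rewrite -(@ler_pXn2r _ 2)// ?nnegrE ?addr_ge0 ?edist_ge0// sqrrD.
rewrite !edist_sqr.
set a := fun i : 'I_d => (tnth x i : R) - (tnth y i : R).
set b := fun i : 'I_d => (tnth y i : R) - (tnth z i : R).
have -> : \sum_(i < d) ((tnth x i : R) - (tnth z i : R)) ^+ 2 =
    \sum_i a i ^+ 2 + \sum_i a i * b i *+ 2 + \sum_i b i ^+ 2.
  rewrite -!big_split/=; apply: eq_bigr => i _; rewrite /a /b; ring.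
rewrite lerD2r lerD2l sumrMnl lerMn2r/=.
have [s0|s0] := leP (\sum_i a i * b i) 0.
  by rewrite (le_trans s0)// mulr_ge0// edist_ge0.
rewrite -(@ler_pXn2r _ 2)// ?nnegrE ?mulr_ge0 ?edist_ge0 ?(ltW s0)// exprMn !edist_sqr.
exact: cauchy_schwarz.
Qed.

Lemma edist_coord x y i : `|(tnth x i : R) - (tnth y i : R)| <= euclidean_dist x y.
Proof.
rewrite -sqrtr_sqr ler_sqrt; last by rewrite sumr_ge0// => j _; rewrite sqr_ge0.
by rewrite (bigD1 i)//= lerDl sumr_ge0// => j _; rewrite sqr_ge0.
Qed.

Lemma edist_le x y (a : R) : 0 <= a ->
  (forall i, `|(tnth x i : R) - (tnth y i : R)| <= a) ->
  euclidean_dist x y <= d%:R * a.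
Proof.
move=> a0 H.
rewrite -(@ler_pXn2r _ 2)// ?nnegrE ?mulr_ge0 ?edist_ge0// edist_sqr.
rewrite (@le_trans _ _ (\sum_(i < d) a ^+ 2))//.
  apply: ler_sum => i _; rewrite -real_normK ?num_real// ler_pXn2r ?nnegrE//.
rewrite sumr_const card_ord -[leLHS]mulr_natl exprMn ler_wpM2r ?sqr_ge0//.
by rewrite -natrX ler_nat; case: d => // n; rewrite -mulnn leq_pmulr.
Qed.

Definition cellof (n : nat) (x : Rspace R d) : {ffun 'I_d -> int} :=
  [ffun i => Num.floor (2 ^+ n * (tnth x i : R))].

Definition cell n k : set (Rspace R d) := [set x | cellof n x = k].

Lemma cellofP n x k : (cellof n x = k) <->
  (forall i, (k i)%:~R <= 2 ^+ n * (tnth x i : R) < (k i + 1)%:~R).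
Proof.
split=> [<- i|H]; first by rewrite ffunE floor_itv.
by apply/ffunP => i; rewrite ffunE; apply: floor_def.
Qed.

Lemma cellof_coarse m n x y : (m <= n)%N -> cellof n x = cellof n y ->
  cellof m x = cellof m y.
Proof.
move=> mn /ffunP H; apply/ffunP => i; move: (H i); rewrite !ffunE => {}H.
have key j (z : Rspace R d) :
    (j <= Num.floor (2 ^+ m * (tnth z i : R))) =
    ((2 ^ (n - m))%N%:Z * j <= Num.floor (2 ^+ n * (tnth z i : R))).
  rewrite !floor_ge_int intrM -(subnK mn) exprD addnK -mulrA -pmulrn natrX.
  by rewrite ler_pM2l// exprn_gt0.
apply: le_anti; apply/andP; split; [rewrite key -H -key|rewrite key H -key]; exact: lexx.
Qed.

Lemma cellof_dist n x y : cellof n x = cellof n y ->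
  euclidean_dist x y <= d%:R * 2 ^- n.
Proof.
move=> H; apply: edist_le => [|i]; first by rewrite invr_ge0 exprn_ge0.
have /cellofP/(_ i) := H; have /cellofP/(_ i) := erefl (cellof n y).
rewrite !intrD; set k := (cellof n y i)%:~R => /andP[y1 y2] /andP[x1 x2].
rewrite -[leLHS](@mulKf _ (2 ^+ n)) ?expf_neq0// -[leRHS]mulr1 ler_pM2l; last first.
  by rewrite invr_gt0 exprn_gt0.
rewrite -{1}[2 ^+ n]ger0_norm ?exprn_ge0// -normrM mulrBr ler_norml.
by apply/andP; split; move: y1 y2 x1 x2; set u := 2 ^+ n * _; set v := 2 ^+ n * _ => *; lra.
Qed.

(** Half-open, so that the box is exactly a union of cells at every level ([inbP]). *)
Definition inb (r : nat) x := forall i, - r%:R <= (tnth x i : R) < r%:R.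

(* [bk] enumerates the indices of the cells of level n contained in [-r, r)^d. *)
Definition bx (r n : nat) : finType := {ffun 'I_d -> 'I_(2 * (r * 2 ^ n))}.

Definition bk r n (j : bx r n) : {ffun 'I_d -> int} :=
  [ffun i => (j i)%:Z - (r * 2 ^ n)%N%:Z].

Lemma bk_inj r n : injective (@bk r n).
Proof.
move=> j k /ffunP H; apply/ffunP => i; move: (H i); rewrite !ffunE => {}H.
by apply: val_inj => /=; move/addIr: H => -[].
Qed.

Lemma inbP r n x : inb r x <-> exists j : bx r n, cellof n x = bk j.
Proof.
have p0 : 0 < 2 ^+ n :> R by rewrite exprn_gt0.
have E i : (- r%:R <= (tnth x i : R) < r%:R) =
   (- (r * 2 ^ n)%N%:Z <= Num.floor (2 ^+ n * (tnth x i : R)) < (r * 2 ^ n)%N%:Z).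
  rewrite floor_ge_int floor_lt_int mulrNz -!pmulrn natrM natrX mulrC -mulrN.
  by rewrite ler_pM2l// ltr_pM2l.
split=> [H|[j /ffunP jE] i]; last first.
  rewrite E; move: (jE i); rewrite !ffunE => ->; have := ltn_ord (j i); lia.
have H' i : (absz (Num.floor (2 ^+ n * (tnth x i : R)) + (r * 2 ^ n)%N%:Z)%R < 2 * (r * 2 ^ n))%N.
  by have := H i; rewrite E; lia.
exists [ffun i => Ordinal (H' i)]; apply/ffunP => i; rewrite !ffunE/=.
by have := H i; rewrite E; lia.
Qed.

Lemma inb_cell r n x y : cellof n x = cellof n y -> inb r x -> inb r y.
Proof. by move=> H; rewrite !(inbP r n) H. Qed.

Lemma inb_le r s x : (r <= s)%N -> inb r x -> inb s x.
Proof.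
move=> rs H i; have /andP[h1 h2] := H i.
have : (r%:R <= s%:R :> R) by rewrite ler_nat.
by move=> h; apply/andP; split; lra.
Qed.

Lemma inb_ex x : exists r, inb r x.
Proof.
exists (\max_(i < d) (Num.truncn `|tnth x i : R|).+1)%N => i.
have h : `|tnth x i : R| < (\max_(i < d) (Num.truncn `|tnth x i : R|).+1)%N%:R.
  apply: (lt_le_trans (truncnS_gt _)); rewrite ler_nat.
  exact: (leq_bigmax i).
by move: h; rewrite ltr_norml => /andP[/ltW -> ->].
Qed.

Lemma inb_dist x (a : R) : exists s, forall y, euclidean_dist y x <= a -> inb s y.
Proof.
have [r H] := inb_ex x.
exists (r + (Num.truncn a).+1)%N => z zx i; have /andP[h1 h2] := H i.
have h0 := truncnS_gt a.
have := le_trans (edist_coord z x i) zx; rewrite ler_norml => /andP[h3 h4].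
by rewrite natrD; apply/andP; split; lra.
Qed.

End euclid.

(** * Stability of matched pairs under perturbation *)

(** Stands in for compactness: finitely many points, each stable from some level on, share a
    level. *)
Lemma seq_uniform_rank (T : eqType) (p : T -> nat -> Prop) (s : seq T) :
  (forall x m n, (m <= n)%N -> p x m -> p x n) ->
  (forall x, x \in s -> exists n, p x n) ->
  exists n, forall x, x \in s -> p x n.
Proof.
move=> mono; elim: s => [|x s IH] H; first by exists 0%N.
have [n hn] : exists n, forall x, x \in s -> p x n.
  by apply: IH => y ys; apply: H; rewrite inE ys orbT.
have [m hm] := H x (mem_head _ _).
exists (maxn m n) => y; rewrite inE => /orP[/eqP ->|ys].
  by apply: mono hm; rewrite leq_maxl.
by apply: mono (hn _ ys); rewrite leq_maxr.
Qed.

Section config.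
Context {R : realType} {d : nat}.
Notation S := (Rspace R d).
Notation rho := (@euclidean_dist R d).
Implicit Types (xi : S -> nat) (A : set S) (x y : S).

Definition void xi A := forall x, A x -> xi x = 0%N.
Definition single xi A :=
  exists x, [/\ A x, xi x = 1%N & forall y, A y -> y <> x -> xi y = 0%N].

(* The number of points, capped at 2: [None] is 0, [Some true] is 1. *)
Definition occupancy xi A : option bool :=
  if `[< void xi A >] then None else Some `[< single xi A >].

Lemma void_single xi A : void xi A -> single xi A -> False.
Proof. by move=> H [x [/H ->]]. Qed.

Lemma cl_eqP xi xi' A A' : occupancy xi A = occupancy xi' A' <->
  (void xi A <-> void xi' A') /\ (single xi A <-> single xi' A').
Proof.
rewrite /occupancy; split.
  case: (asboolP (void xi A)) => v1; case: (asboolP (void xi' A')) => v2 //.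
    move=> _; split; first tauto.
    by split=> s1; exfalso; [exact: void_single v1 s1|exact: void_single v2 s1].
  by case=> e; split; [tauto|exact: asbool_eq_equiv e].
move=> [h1 h2].
case: (asboolP (void xi A)) => v1; case: (asboolP (void xi' A')) => v2; try tauto.
by rewrite (asbool_equiv_eq h2).
Qed.

(** The index [n] bounds the window and also fixes the resolution, so that letting it grow exhausts
    both. *)
Definition eqv n xi xi' := forall x, inb n x ->
  occupancy xi (cell n (cellof n x)) = occupancy xi' (cell n (cellof n x)).

Lemma eqv_sym n xi xi' : eqv n xi xi' -> eqv n xi' xi.
Proof. by move=> H x /H. Qed.

Lemma eqv_void n xi xi' x : eqv n xi xi' -> inb n x ->
  void xi (cell n (cellof n x)) -> void xi' (cell n (cellof n x)).
Proof. by move=> H /H/cl_eqP; tauto. Qed.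

Lemma eqv_single n xi xi' x : eqv n xi xi' -> inb n x ->
  single xi (cell n (cellof n x)) -> single xi' (cell n (cellof n x)).
Proof. by move=> H /H/cl_eqP; tauto. Qed.

(** Capped counts at a fine level determine those at a coarse one: a cell is single iff one of its
    subcells is single and the others are void. This is why the three values of [occupancy]
    suffice. *)
Lemma eqv_le m n xi xi' : (m <= n)%N -> eqv n xi xi' -> eqv m xi xi'.
Proof.
move=> mn.
have sub (x y : S) : cellof n y = cellof n x -> cellof m y = cellof m x.
  exact: cellof_coarse.
have V xi1 xi2 (x : S) : eqv n xi1 xi2 -> inb m x ->
    void xi1 (cell m (cellof m x)) -> void xi2 (cell m (cellof m x)).
  move=> E mx H y /= yx; apply: (@eqv_void n _ _ y E) => //.
    by apply: inb_le mn _; apply: inb_cell mx; exact/esym/yx.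
  by move=> z /= /sub zy; apply: H; rewrite /cell/= zy.
have W xi1 xi2 (x : S) : eqv n xi1 xi2 -> inb m x ->
    single xi1 (cell m (cellof m x)) -> single xi2 (cell m (cellof m x)).
  move=> E mx [a [/= ax a1 aH]].
  have ma : inb n a by apply: inb_le mn _; apply: inb_cell mx; exact/esym/ax.
  have [|b [/= ba b1 bH]] := eqv_single E ma.
    exists a; split=> // y /= /sub; rewrite ax => ya; exact: aH.
  exists b; split=> //=; first by rewrite /cell/= (sub _ _ ba).
  move=> y /= yx yb.
  have [ya|ya] := pselect (cellof n y = cellof n a); first exact: bH.
  apply: (@eqv_void n _ _ y E) => //.
    by apply: inb_le mn _; apply: inb_cell mx; exact/esym/yx.
  move=> z /= zy; apply: aH => /=; first by rewrite /cell/= (sub _ _ zy).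
  by move=> za; apply: ya; rewrite -zy za.
by move=> E x mx; apply/cl_eqP; split; split; [apply: V|apply: V|apply: W|apply: W] => //;
  exact: eqv_sym.
Qed.

Lemma eqv_point n xi xi' x : eqv n xi xi' -> inb n x -> points xi x ->
  exists2 x', points xi' x' & cellof n x' = cellof n x.
Proof.
move=> E nx px; apply: contrapT => H.
suff : void xi (cell n (cellof n x)).
  by move=> /(_ x erefl) x0; move: px; rewrite /points/= x0.
apply: (eqv_void (eqv_sym E)) => // y /= yx; apply: contrapT => y0.
by apply: H; exists y => //; rewrite /points /=; case: (xi' y) y0.
Qed.

Lemma single_inj n xi x y : single xi (cell n (cellof n x)) ->
  points xi x -> points xi y -> cellof n y = cellof n x -> x = y.
Proof.
move=> [a [/= ax a1 aH]] px py yx.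
have [->|xa] := pselect (x = a); last by move: px; rewrite /points/= aH.
by have [->|ya] := pselect (y = a); last by move: py; rewrite /points/= aH.
Qed.

Definition nice_at r n xi := forall x, inb r x -> points xi x ->
  single xi (cell n (cellof n x)).

Lemma nice_at_le r m n xi : (m <= n)%N -> nice_at r m xi -> nice_at r n xi.
Proof.
move=> mn H x rx px.
exists x; split => //.
  have [a [/= ax a1 aH]] := H x rx px.
  by have [->//|xa] := pselect (x = a); move: px; rewrite /points/= aH.
move=> y /= yx nyx; apply: contrapT => y0; apply: nyx; apply/esym.
apply: (single_inj (H x rx px)) => //; last exact: cellof_coarse yx.
by rewrite /points /=; case: (xi y) y0.
Qed.

(** Local finiteness and absence of multiple points in one condition: in each box some level
    isolates all the points. *)
Definition nice xi := forall r, exists n, nice_at r n xi.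

Lemma nice_finite xi r : nice xi ->
  exists s : seq S, forall x, inb r x -> points xi x -> x \in s.
Proof.
move=> /(_ r)[n H].
exists [seq xget (nseq_tuple d 0 : S) [set x | points xi x /\ cellof n x = bk j] | j <- enum (bx r n)].
move=> x rx px; have [j jx] := (inbP r n x).1 rx.
apply/mapP; exists j; first by rewrite mem_enum.
set B := [set _ | _].
have [px' /esym xj] : B (xget (nseq_tuple d 0) B) by apply: (@xgetI _ _ _ x).
apply: (single_inj (H x rx px)) => //.
by rewrite -xj -jx.
Qed.

(* Events that are detected by the occupancies of the cells of some finite level:
   they are measurable and their probability is a limit of finite sums of products. *)
Definition opn (F : set (S -> nat)) := forall xi, nice xi -> F xi ->
  exists n, forall xi', eqv n xi xi' -> F xi'.

Lemma mesh_lt (e : R) : 0 < e -> exists n0, forall n, (n0 <= n)%N -> d%:R * 2 ^- n < e.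
Proof.
move=> e0; exists (Num.truncn (d%:R / e)).+1 => n hn.
rewrite ltr_pdivrMr ?exprn_gt0// mulrC -ltr_pdivrMr//.
apply: (lt_le_trans (truncnS_gt _)); rewrite -natrX ler_nat (leq_trans hn)//.
exact/ltnW/ltn_expl.
Qed.

Lemma edist_cell n (x x' y y' : S) : cellof n x' = cellof n x ->
  cellof n y' = cellof n y -> rho x' y' <= rho x y + d%:R * 2 ^- n *+ 2.
Proof.
move=> /cellof_dist hx /esym/cellof_dist hy.
apply: (le_trans (edist_triangle _ x _)).
have := edist_triangle x y y' => h; rewrite mulr2n; lra.
Qed.

(** Competitors are defined by weak inequalities, so a point that does not compete satisfies strict
    ones and stays out of the competition after a small move. Competitors may drop out, which harms
    no certificate; those that remain are matched by induction. *)
Lemma matched_opn xi x y : nice xi -> matched rho (points xi) x y ->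
  exists n, forall xi' x' y', eqv n xi xi' -> points xi' x' -> points xi' y' ->
    cellof n x' = cellof n x -> cellof n y' = cellof n y ->
    matched rho (points xi') x' y'.
Proof.
move=> nxi; elim=> {}x {}y f Xx Xy xy fne fm IH.
(* The slack 1 absorbs displacements of four cell diameters, which [n4] keeps below 1, so
   competitors of the perturbed pair stay in the box [r0]. *)
have [s1 hs1] := inb_dist x (rho x y + 1).
have [s2 hs2] := inb_dist y (rho x y + 1).
pose r0 := maxn s1 s2.
have hs (z : S) : rho z x <= rho x y + 1 \/ rho z y <= rho x y + 1 -> inb r0 z.
  by move=> [/hs1|/hs2]; apply: inb_le; rewrite ?leq_maxl ?leq_maxr.
have [l hl] := nice_finite r0 nxi.
have [r hr] : exists r, forall c, c \in l -> inb r (f c).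
  apply: (seq_uniform_rank (p := fun c r => inb r (f c))).
    by move=> c m n mn; apply: inb_le.
  by move=> c _; exact: inb_ex.
pose q := maxn r0 r.
have [n1 hn1] := nxi q.
pose cond c := [/\ points xi c, c <> x, c <> y &
  rho c x <= rho x y \/ rho c y <= rho x y].
have [n2 hn2] : exists n, forall c, c \in l -> cond c ->
    forall xi' x' y', eqv n xi xi' -> points xi' x' -> points xi' y' ->
    cellof n x' = cellof n c -> cellof n y' = cellof n (f c) ->
    matched rho (points xi') x' y'.
  apply: (seq_uniform_rank (p := fun c n => cond c ->
    forall xi' x' y', eqv n xi xi' -> points xi' x' -> points xi' y' ->
    cellof n x' = cellof n c -> cellof n y' = cellof n (f c) ->
    matched rho (points xi') x' y')).
    move=> c m n mn H /H{}H xi' x' y' /(eqv_le mn) E px py cx cy; apply: H => //.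
      exact: cellof_coarse cx.
    exact: cellof_coarse cy.
  move=> c cl_; have [cc|cc] := pselect (cond c); last by exists 0%N.
  have [h1 h2 h3 h4] := cc; have [n hn] := IH _ h1 h2 h3 h4.
  by exists n.
(* Each of the two compared distances moves by at most two cell diameters, hence the margin of
   four. *)
have [n3 hn3] : exists n, forall c, c \in l -> forall m, (n <= m)%N ->
   (rho x y < rho c x -> rho x y + d%:R * 2 ^- m *+ 4 < rho c x) /\
   (rho x y < rho c y -> rho x y + d%:R * 2 ^- m *+ 4 < rho c y).
  apply: (seq_uniform_rank (p := fun c n => forall m, (n <= m)%N ->
   (rho x y < rho c x -> rho x y + d%:R * 2 ^- m *+ 4 < rho c x) /\
   (rho x y < rho c y -> rho x y + d%:R * 2 ^- m *+ 4 < rho c y))).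
    by move=> c m n mn H k nk; apply: H; exact: leq_trans nk.
  move=> c _.
  have K z : exists n, forall m, (n <= m)%N ->
      rho x y < rho c z -> rho x y + d%:R * 2 ^- m *+ 4 < rho c z.
    have [lt|le] := ltP (rho x y) (rho c z); last by exists 0%N.
    have [|n hn] := @mesh_lt ((rho c z - rho x y) / 4).
      by rewrite divr_gt0// subr_gt0.
    exists n => m /hn; set u := d%:R * _ => hu _.
    by rewrite -mulr_natr; move: hu; rewrite ltr_pdivlMr//; lra.
  have [n hn] := K x; have [m hm] := K y.
  exists (maxn n m) => k; rewrite geq_max => /andP[nk mk].
  by split; [exact: hn|exact: hm].
have [n4 hn4] := @mesh_lt (1/4) ltac:(by rewrite divr_gt0).
pose N := maxn (maxn (maxn n1 n2) (maxn n3 n4)) q.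
have N1 : (n1 <= N)%N by rewrite /N; lia.
have N2 : (n2 <= N)%N by rewrite /N; lia.
have N3 : (n3 <= N)%N by rewrite /N; lia.
have N4 : (n4 <= N)%N by rewrite /N; lia.
have Nq : (q <= N)%N by rewrite /N; lia.
exists N => xi' x' y' E px' py' cx' cy'.
have sing (z : S) : inb q z -> points xi z -> single xi (cell N (cellof N z)).
  exact: (nice_at_le N1 hn1).
have sing' (z : S) : inb q z -> points xi z -> single xi' (cell N (cellof N z)).
  by move=> iz pz; apply: (eqv_single E); [exact: inb_le Nq iz|exact: sing].
have q0 (z : S) : inb r0 z -> inb q z by apply: inb_le; rewrite leq_maxl.
have qf c : c \in l -> inb q (f c).
  by move=> /hr; apply: inb_le; rewrite leq_maxr.
have ix : inb r0 x by apply: hs; left; rewrite edist_xx addr_ge0 ?edist_ge0.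
have iy : inb r0 y by apply: hs; right; rewrite edist_xx addr_ge0 ?edist_ge0.
(* A perturbed point is taken back to the original point of its cell, sent to its partner there, and
   returned to the perturbed point in the cell of that partner. *)
pose pull c' := xget c' [set c | points xi c /\ cellof N c = cellof N c'].
pose f' c' := xget c' [set e' | points xi' e' /\ cellof N e' = cellof N (f (pull c'))].
set eps : R := d%:R * 2 ^- N.
have eps0 : 0 <= eps by rewrite mulr_ge0// invr_ge0 exprn_ge0.
have eps4 : eps < 1 / 4 by exact: hn4.
have xy' : rho x' y' <= rho x y + eps *+ 2 by exact: edist_cell.
have key c' : points xi' c' -> c' <> x' -> c' <> y' ->
    rho c' x' <= rho x' y' \/ rho c' y' <= rho x' y' ->
    let c := pull c' in
    [/\ c \in l, cond c, cellof N c = cellof N c',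
        points xi' (f' c') & cellof N (f' c') = cellof N (f c)].
  move=> pc' cx cy clo.
  have ic' : inb r0 c'.
    apply: hs; case: clo => clo; [left|right].
      have := @edist_cell N c' c' x' x erefl (esym cx').
      by rewrite -/eps mulr2n; move: xy'; rewrite mulr2n; lra.
    have := @edist_cell N c' c' y' y erefl (esym cy').
    by rewrite -/eps mulr2n; move: xy'; rewrite mulr2n; lra.
  set c := pull c'.
  have [pc cc] : [set c | points xi c /\ cellof N c = cellof N c'] c.
    have [c0 pc0 cc0] := eqv_point (eqv_sym E) (inb_le Nq (q0 _ ic')) pc'.
    by apply: (@xgetI _ _ _ c0).
  have ic : inb r0 c by apply: inb_cell ic'; exact/esym/cc.
  have lc : c \in l by exact: hl.
  have ncx : c <> x.
    move=> e; apply: cx; apply/esym.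
    have h := sing' _ (q0 _ ix) Xx; rewrite -cx' in h.
    by apply: (single_inj h) => //; rewrite -cc e cx'.
  have ncy : c <> y.
    move=> e; apply: cy; apply/esym.
    have h := sing' _ (q0 _ iy) Xy; rewrite -cy' in h.
    by apply: (single_inj h) => //; rewrite -cc e cy'.
  have cclo : rho c x <= rho x y \/ rho c y <= rho x y.
    have [g1 g2] := hn3 _ lc _ N3.
    case: clo => clo; [left|right].
      have h := @edist_cell N c' c x' x cc (esym cx').
      rewrite leNgt; apply/negP => /g1; rewrite -/eps.
      by move: h xy'; rewrite -/eps !mulr2n !mulrSr mulr0n; lra.
    have h := @edist_cell N c' c y' y cc (esym cy').
    rewrite leNgt; apply/negP => /g2; rewrite -/eps.
    by move: h xy'; rewrite -/eps !mulr2n !mulrSr mulr0n; lra.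
  have [_ pfc _] := matched_in (fm _ pc ncx ncy cclo).
  have [e0 pe0 ee0] := eqv_point E (inb_le Nq (qf _ lc)) pfc.
  have [h1 h2] : [set e' | points xi' e' /\ cellof N e' = cellof N (f (pull c'))] (f' c').
    by apply: (@xgetI _ _ _ e0).
  by split.
apply: (@Matched _ _ _ _ _ _ f') => //.
- move=> e; apply: xy.
  by apply: (single_inj (sing _ (q0 _ ix) Xx)) => //; rewrite -cx' -cy' e.
- move=> c' pc' cx cy clo; have [lc cc ecc pf ef] := key c' pc' cx cy clo.
  have [pc ncx ncy cclo] := cc.
  have [fx fy] := fne _ pc ncx ncy cclo.
  have [_ pfc _] := matched_in (fm _ pc ncx ncy cclo).
  split=> e.
    apply/fx/esym/(single_inj (sing _ (q0 _ ix) Xx)) => //.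
    by rewrite -ef e.
  apply/fy/esym/(single_inj (sing _ (q0 _ iy) Xy)) => //.
  by rewrite -ef e.
- move=> c' pc' cx cy clo; have [lc cc ecc pf ef] := key c' pc' cx cy clo.
  apply: (hn2 _ lc cc) => //.
  + exact: eqv_le E.
  + exact: cellof_coarse (esym ecc).
  + exact: cellof_coarse ef.
Qed.

End config.

(** * Stable events, translations and deletions *)

Section events.
Context {R : realType} {d : nat}.
Notation S := (Rspace R d).
Notation rho := (@euclidean_dist R d).
Notation K := {ffun 'I_d -> int}.
Implicit Types (xi : S -> nat) (A : set S) (x y : S) (u : K).

Definition opn2 (phi : S -> S -> Prop) := forall x y, phi x y ->
  exists n, forall x' y' : S, cellof n x' = cellof n x -> cellof n y' = cellof n y ->
    phi x' y'.

Lemma opn2_and phi psi : opn2 phi -> opn2 psi -> opn2 (fun x y => phi x y /\ psi x y).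
Proof.
move=> h1 h2 x y [/h1[n hn] /h2[m hm]]; exists (maxn n m) => x' y' xx yy.
split; [apply: hn|apply: hm]; apply: (@cellof_coarse _ _ _ (maxn n m)) => //;
  by rewrite ?leq_maxl ?leq_maxr.
Qed.

Lemma opn2_all (phi : 'I_d -> S -> S -> Prop) : (forall i, opn2 (phi i)) ->
  opn2 (fun x y => forall i, phi i x y).
Proof.
move=> h x y hphi.
have [n hn] : exists n, forall i, i \in enum 'I_d -> forall x' y' : S,
    cellof n x' = cellof n x -> cellof n y' = cellof n y -> phi i x' y'.
  apply: (seq_uniform_rank (p := fun i n => forall x' y' : S,
    cellof n x' = cellof n x -> cellof n y' = cellof n y -> phi i x' y')).
    by move=> i m n mn H x' y' xx yy; apply: H; apply: cellof_coarse mn _.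
  by move=> i _; exact: h.
by exists n => x' y' xx yy i; apply: hn => //; rewrite mem_enum.
Qed.

Lemma opn2_ex (phi : 'I_d -> S -> S -> Prop) : (forall i, opn2 (phi i)) ->
  opn2 (fun x y => exists i, phi i x y).
Proof.
by move=> h x y [i /h[n hn]]; exists n => x' y' xx yy; exists i; apply: hn.
Qed.

(** Meant for differences of Lipschitz functions: [C] is a Lipschitz constant measured in cell
    diameters. *)
Lemma opn2_lt (f : S -> S -> R) (C : R) : 0 <= C ->
  (forall n x y x' y', cellof n x' = cellof n x -> cellof n y' = cellof n y ->
    f x y <= f x' y' + C * (d%:R * 2 ^- n)) ->
  opn2 (fun x y => 0 < f x y).
Proof.
move=> C0 H x y f0.
have C1 : 0 < C + 1 by lra.
have [n0 /(_ n0 (leqnn _)) hn] := @mesh_lt R d (f x y / (C + 1)) (divr_gt0 f0 C1).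
exists n0 => x' y' xx yy; have := H _ _ _ _ _ xx yy.
move: hn; rewrite ltr_pdivlMr//.
have : 0 <= d%:R * 2 ^- n0 :> R by rewrite mulr_ge0// invr_ge0 exprn_ge0.
set e := d%:R * _; nra.
Qed.

Lemma dist_lip n x y x' y' : cellof n x' = cellof n x -> cellof n y' = cellof n y ->
  `|rho x y - rho x' y'| <= 2 * (d%:R * 2 ^- n).
Proof.
move=> xx yy; have := edist_cell xx yy; have := edist_cell (esym xx) (esym yy).
by rewrite mulr2n ler_norml => h1 h2; apply/andP; split; lra.
Qed.

Lemma coord_lip n x x' i (c : R) : cellof n x' = cellof n x ->
  `| `|(tnth x i : R) - c| - `|(tnth x' i : R) - c| | <= d%:R * 2 ^- n.
Proof.
move=> xx; apply: (le_trans (ler_dist_dist _ _)).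
rewrite opprB addrA subrK.
by apply: le_trans (edist_coord x x' i) _; apply: cellof_dist.
Qed.

Definition ev_pair (phi : S -> S -> Prop) : set (S -> nat) :=
  [set xi | exists x y, matched rho (points xi) x y /\ phi x y].

Lemma opn_ev_pair phi : opn2 phi -> opn (ev_pair phi).
Proof.
move=> ophi xi nxi [x [y [mxy pxy]]].
have [n hn] := matched_opn nxi mxy.
have [m hm] := ophi _ _ pxy.
have [r1 hr1] := inb_ex x; have [r2 hr2] := inb_ex y.
pose N := maxn (maxn n m) (maxn r1 r2).
have nN : (n <= N)%N by rewrite /N; lia.
have mN : (m <= N)%N by rewrite /N; lia.
have rN1 : (r1 <= N)%N by rewrite /N; lia.
have rN2 : (r2 <= N)%N by rewrite /N; lia.
exists N => xi' E.
have [px py _] := matched_in mxy.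
have [x' px' cx'] := eqv_point E (inb_le rN1 hr1) px.
have [y' py' cy'] := eqv_point E (inb_le rN2 hr2) py.
exists x', y'; split.
  apply: hn => //; [exact: eqv_le E|exact: cellof_coarse cx'|exact: cellof_coarse cy'].
by apply: hm; [exact: cellof_coarse cx'|exact: cellof_coarse cy'].
Qed.

Definition ev_all (D : set S) (phi : S -> S -> Prop) : set (S -> nat) :=
  [set xi | forall x, points xi x -> D x ->
     exists y, matched rho (points xi) x y /\ phi x y].

(** A universal statement is stable here because [D] is bounded, so only finitely many points are
    concerned, and a union of cells, so that no perturbed point enters [D] from outside. *)
Lemma opn_ev_all (D : set S) phi r n0 : opn2 phi -> (forall x, D x -> inb r x) ->
  (forall x y, cellof n0 x = cellof n0 y -> D x -> D y) -> opn (ev_all D phi).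
Proof.
move=> ophi Dr Dc xi nxi H.
have [l hl] := nice_finite r nxi.
have [n1 hn1] : exists n, forall x, x \in l -> points xi x -> D x ->
    forall xi' x', eqv n xi xi' -> points xi' x' -> cellof n x' = cellof n x ->
     exists y', matched rho (points xi') x' y' /\ phi x' y'.
  apply: (seq_uniform_rank (p := fun x n => points xi x -> D x ->
    forall xi' x', eqv n xi xi' -> points xi' x' -> cellof n x' = cellof n x ->
     exists y', matched rho (points xi') x' y' /\ phi x' y')).
    move=> x m n mn h px dx xi' x' E px' cx; apply: h => //.
      exact: eqv_le E.
    exact: cellof_coarse cx.
  move=> x _; have [px|px] := pselect (points xi x /\ D x); last first.
    by exists 0%N => px1 px2; exfalso; exact: px.
  have [y [mxy pxy]] := H _ px.1 px.2.
  have [n hn] := matched_opn nxi mxy.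
  have [m hm] := ophi _ _ pxy.
  have [s hs] := inb_ex y.
  pose N := maxn (maxn n m) s.
  have nN : (n <= N)%N by rewrite /N; lia.
  have mN : (m <= N)%N by rewrite /N; lia.
  have sN : (s <= N)%N by rewrite /N; lia.
  exists N => _ _ xi' x' E px' cx'.
  have [_ py _] := matched_in mxy.
  have [y' py' cy'] := eqv_point E (inb_le sN hs) py.
  exists y'; split.
    apply: hn => //; [exact: eqv_le E|exact: cellof_coarse cx'|exact: cellof_coarse cy'].
  by apply: hm; [exact: cellof_coarse cx'|exact: cellof_coarse cy'].
pose N := maxn (maxn n0 n1) r.
have nN : (n0 <= N)%N by rewrite /N; lia.
have mN : (n1 <= N)%N by rewrite /N; lia.
have sN : (r <= N)%N by rewrite /N; lia.
exists N => xi' E x' px' dx'.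
have [x px cx] := eqv_point (eqv_sym E) (inb_le sN (Dr _ dx')) px'.
have dx : D x by apply: Dc dx'; apply: cellof_coarse (esym cx).
apply: (hn1 x) => //.
- by apply: hl => //; exact: Dr.
- exact: eqv_le E.
- exact: cellof_coarse (esym cx).
Qed.

(** Integer translations permute the cells of every level. *)
Definition shiftp u x : S := [tuple (tnth x i : R) + (u i)%:~R | i < d].

Lemma shiftpK u : cancel (shiftp u) (shiftp (- u)).
Proof.
move=> x; apply: eq_from_tnth => i; rewrite !tnth_mktuple ffunE mulrNz addrK//.
Qed.

Lemma shiftpVK u : cancel (shiftp (- u)) (shiftp u).
Proof. by move=> x; rewrite -{1}[u]opprK shiftpK. Qed.

Lemma edist_shift u x y : rho (shiftp u x) (shiftp u y) = rho x y.
Proof.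
congr Num.sqrt; apply: eq_bigr => i _; rewrite !tnth_mktuple; congr (_ ^+ 2); ring.
Qed.

Lemma cellof_shift n u x :
  cellof n (shiftp u x) = cellof n x + [ffun i => (2 ^ n)%N%:Z * u i].
Proof.
apply/ffunP => i; rewrite !ffunE tnth_mktuple mulrDr -natrX [(2 ^ n)%:R]pmulrn -intrM.
by rewrite floorDrz ?intrKfloor ?intr_int.
Qed.

Lemma cellof_shift_inj n u x y :
  cellof n (shiftp u x) = cellof n (shiftp u y) <-> cellof n x = cellof n y.
Proof. by rewrite !cellof_shift; split=> [/addIr|->]. Qed.

Definition shiftc u xi : S -> nat := fun x => xi (shiftp u x).

Lemma single_preim (g h : S -> S) xi (A : set S) : cancel g h -> cancel h g ->
  single (xi \o g) (g @^-1` A) <-> single xi A.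
Proof.
move=> gK hK; split=> -[a [h1 h2 h3]].
  exists (g a); split=> // y Ay ya; rewrite -(hK y); apply: h3 => /=.
    by rewrite hK.
  by move=> e; apply: ya; rewrite -e hK.
exists (h a); split=> //=; rewrite ?hK// => y Ay ya; apply: h3 => //.
by move=> e; apply: ya; rewrite -e gK.
Qed.

Lemma inb_shift u r : exists s, forall x, inb r x -> inb s (shiftp u x).
Proof.
exists (r + \max_(i < d) `|u i|)%N => x rx i; rewrite tnth_mktuple.
have /andP[h1 h2] := rx i.
have : (`|u i| <= \max_(i < d) `|u i|)%N by exact: (leq_bigmax i).
rewrite -(ler_nat R) natrD natr_absz intr_norm ler_norml => /andP[h3 h4].
by apply/andP; split; lra.
Qed.

Lemma nice_shift u xi : nice xi -> nice (shiftc u xi).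
Proof.
move=> nxi r; have [s hs] := inb_shift u r; have [n hn] := nxi s.
exists n => x rx px.
have := hn (shiftp u x) (hs _ rx) px.
move/(single_preim _ _ (shiftpK u) (shiftpVK u)).2.
rewrite (_ : _ @^-1` _ = cell n (cellof n x))//; apply/seteqP.
by split=> y; rewrite /cell/= => /cellof_shift_inj.
Qed.

Lemma matched_isom (g h : S -> S) (X : set S) : cancel g h -> cancel h g ->
  (forall x y, rho (g x) (g y) = rho x y) ->
  forall x y, matched rho X x y -> matched rho (h @^-1` X) (g x) (g y).
Proof.
move=> gK hK iso x y; elim=> {}x {}y f Xx Xy xy fne fm IH.
have rh c z : rho (h c) z = rho c (g z) by rewrite -iso hK.
apply: (@Matched _ _ _ _ _ _ (g \o f \o h)); rewrite /preimage/= ?gK//.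
- by move=> e; apply: xy; rewrite -(gK x) e gK.
- move=> c Xc cx cy; rewrite iso -!rh => clo.
  have [] := fne _ Xc _ _ clo.
  + by move=> e; apply: cx; rewrite -e hK.
  + by move=> e; apply: cy; rewrite -e hK.
  by move=> fx fy; split=> e; [apply: fx|apply: fy]; rewrite -[f _]gK e gK.
- move=> c Xc cx cy; rewrite iso -!rh => clo.
  rewrite -{1}(hK c); apply: IH => //.
  + by move=> e; apply: cx; rewrite -e hK.
  + by move=> e; apply: cy; rewrite -e hK.
Qed.

Lemma matched_shift u xi x y :
  matched rho (points (shiftc u xi)) x y <->
  matched rho (points xi) (shiftp u x) (shiftp u y).
Proof.
have iso v x' y' : rho (shiftp v x') (shiftp v y') = rho x' y' by exact: edist_shift.
split=> [m|m].
  have := matched_isom (shiftpK u) (shiftpVK u) (iso u) m.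
  congr matched; apply/seteqP; split=> z; rewrite /points/preimage/shiftc/=.
    by rewrite shiftpVK.
  by rewrite shiftpVK.
have := matched_isom (shiftpVK u) (shiftpK u) (iso (- u)) m.
by rewrite !shiftpK.
Qed.

Definition res A xi : S -> nat := fun x => if x \in A then 0%N else xi x.

Lemma points_res A xi : points (res A xi) = points xi `\` A.
Proof.
apply/seteqP; split=> x; rewrite /points/res/=.
  by case: ifPn => //; rewrite notin_setE.
by move=> [h1 h2]; rewrite /points/= /res memNset.
Qed.

Lemma nice_res A xi : nice xi -> nice (res A xi).
Proof.
move=> nxi r; have [n hn] := nxi r; exists n => x rx.
rewrite points_res => -[px nA]; have [a [h1 h2 h3]] := hn _ rx px.
exists a; split=> //; last first.
  by move=> y hy hya; rewrite /res; case: ifP => // _; exact: h3.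
rewrite /res memNset// => Aa; apply: nA.
suff -> : x = a by [].
by apply: contrapT => xa; move: px; rewrite /points/= h3.
Qed.

End events.

(** * Laws of the cell occupancies *)

Section counts.
Context {R : realType} {d : nat}.
Notation S := (Rspace R d).
Implicit Types (xi : S -> nat) (A : set S).

Lemma npoints_split xi A x : A x ->
  npoints xi A = ((xi x)%:R%:E + npoints xi (A `\ x))%E :> \bar R.
Proof.
move=> Ax; rewrite /npoints (esumID [set x])//.
rewrite -setDE (_ : A `&` [set x] = [set x]) ?esum_set1//.
by apply/seteqP; split=> y /= [] // ->.
Qed.

Lemma npoints_ge0 xi A : (0 <= npoints xi A :> \bar R)%E.
Proof. by apply: esum_ge0 => x _; rewrite lee_fin. Qed.

Lemma npoints_void xi A : npoints xi A = 0%E :> \bar R <-> void xi A.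
Proof.
split=> [H x Ax|H]; last by rewrite /npoints esum1// => x /H ->.
move: H; rewrite (npoints_split xi Ax) => H.
have : ((xi x)%:R%:E <= 0 :> \bar R)%E by rewrite -H leeDl// npoints_ge0.
by rewrite lee_fin lern0 => /eqP.
Qed.

Lemma npoints_single xi A : npoints xi A = 1%E :> \bar R <-> single xi A.
Proof.
split=> [H|[x [Ax x1 H]]]; last first.
  rewrite (npoints_split xi Ax) x1 (_ : npoints _ _ = 0%E) ?adde0//.
  by apply/npoints_void => y [Ay yx]; exact: H.
have [x Ax x0] : exists2 x, A x & xi x <> 0%N.
  apply: contrapT => h; move: H; have -> : npoints xi A = 0%E :> \bar R.
    apply/npoints_void => x Ax; apply: contrapT => x0; apply: h; by exists x.
  by move=> /eqP; rewrite eqe eq_sym oner_eq0.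
move: H; rewrite (npoints_split xi Ax) => H.
have r0 := npoints_ge0 xi (A `\ x).
have : ((xi x)%:R%:E <= 1 :> \bar R)%E by rewrite -H leeDl.
rewrite lee_fin lern1 => x1.
have {x1}x1 : xi x = 1%N by lia.
exists x; split=> // y Ay yx.
move: H; rewrite x1.
case E : (npoints _ _) r0 => [r| |]//= r0 [] /eqP.
rewrite -subr_eq0 addrAC subrr add0r => /eqP r00.
by move: E; rewrite r00 => /npoints_void; apply.
Qed.

(** The last case is a complement so that an infinite count is classified as multiple too. *)
Definition cset (o : option bool) : set (\bar R) :=
  match o with None => [set 0%E] | Some true => [set 1%E] |
    Some false => ~` ([set 0%E] `|` [set 1%E]) end.

Lemma clE xi A o : (occupancy xi A = o) = cset o (npoints xi A : \bar R).
Proof.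
apply/propext; rewrite /occupancy; case: asboolP => [v|v].
  have n0 : npoints xi A = 0%E :> \bar R by apply/npoints_void.
  case: o => [[]|]/=; rewrite n0.
  - by split=> // /esym/eqP; rewrite eqe oner_eq0.
  - by split=> //; case; left.
  - by split.
have n0 : npoints xi A <> 0%E :> \bar R by move=> /npoints_void.
case: asboolP => [s|s].
  have n1 : npoints xi A = 1%E :> \bar R by apply/npoints_single.
  case: o => [[]|]/=; rewrite n1.
  - by split.
  - by split=> //; case; right.
  - by split=> // /eqP; rewrite eqe oner_eq0.
have n1 : npoints xi A <> 1%E :> \bar R by move=> /npoints_single.
by case: o => [[]|]/=; split=> // _; case.
Qed.

Lemma measurable_cset o : measurable (cset o).
Proof.
case: o => [[]|] /=; try exact: emeasurable_set1.
by apply: measurableC; apply: measurableU; exact: emeasurable_set1.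
Qed.

End counts.

(** * Volume of boxes *)

Section lebesgue_box.
Context {R : realType}.

Definition boxset d (a b : 'I_d -> R) : set (Rspace R d) :=
  [set x | forall i, a i <= (tnth x i : R) < b i].

Lemma lebesgue_space0 d : @lebesgue_space R d set0 = 0%E.
Proof.
elim: d => [|d IH] /=; first by rewrite diracE in_set0.
rewrite /pushforward preimage_set0 /product_measure1 integral0_eq// => x _ /=.
by rewrite xsection0.
Qed.

Lemma lebesgue_boxset d (a b : 'I_d -> R) : (forall i, a i <= b i) ->
  @lebesgue_space R d (boxset a b) = (\prod_i (b i - a i))%:E.
Proof.
elim: d a b => [|d IH] a b ab /=.
  rewrite big_ord0 diracE mem_set//; case=> //.
rewrite /pushforward /product_measure1.
pose a' i := a (lift ord0 i); pose b' i := b (lift ord0 i).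
(* The section above a point of the first side is the remaining box, and all other sections are
   empty. *)
rewrite (eq_integral (fun x : measurableTypeR R => (\1_(`[a ord0, b ord0[%classic : set (measurableTypeR R)) x)%:E *
     (\prod_i (b' i - a' i))%:E)%E).
  rewrite ge0_integralZr//; last 2 first.
  - by apply/measurable_EFinP; apply: measurable_indic; exact: measurable_itv.
  - by rewrite lee_fin prodr_ge0// => i _; rewrite subr_ge0; exact: ab.
  rewrite [X in (X * _)%E](_ : _ =
      lebesgue_measure (`[a ord0, b ord0[%classic : set (measurableTypeR R))); last first.
    by have := @integral_indic _ _ R (@lebesgue_measure R) setT measurableT `[a ord0, b ord0[%classic (measurable_itv _); rewrite setIT.
  rewrite lebesgue_measure_itv/= lte_fin.
  rewrite big_ord_recl/= EFinM; congr (_ * _)%E.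
  case: ltP => // h; have -> : b ord0 = a ord0 by apply/le_anti; rewrite h ab.
  by rewrite subrr.
move=> x _ /=; rewrite indicE.
have [xi|xi] := boolP (x \in `[a ord0, b ord0[%classic).
  rewrite mul1e -IH//; last by move=> i; exact: ab.
  congr lebesgue_space; apply/seteqP; split=> y; rewrite /xsection/= inE/= => h i.
    by have := h (lift ord0 i); rewrite tnthS.
  have [j ->|->] := unliftP ord0 i; first by rewrite tnthS; exact: h.
  by rewrite tnth0; move: xi; rewrite inE/= in_itv.
rewrite mul0e (_ : xsection _ _ = set0) ?lebesgue_space0//.
apply/seteqP; split=> y //; rewrite /xsection/= inE/= => /(_ ord0).
by rewrite tnth0 => h; move: xi; rewrite notin_setE/= in_itv.
Qed.

End lebesgue_box.

(** * Real-valued probabilities *)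

Section prb.
Context {R : realType} {dT : measure_display} {T : measurableType dT}
  (P : probability T R).

Definition prb (A : set T) : R := fine (P A).

Lemma prbE A : measurable A -> P A = (prb A)%:E.
Proof. by move=> mA; rewrite fineK// fin_num_measure. Qed.

Lemma prb_ge0 A : 0 <= prb A.
Proof. by rewrite fine_ge0. Qed.

Lemma prb_le A B : measurable A -> measurable B -> A `<=` B -> prb A <= prb B.
Proof.
by move=> mA mB AB; rewrite -lee_fin -!prbE// le_measure ?inE.
Qed.

Lemma prbT : prb setT = 1.
Proof. by rewrite /prb probability_setT. Qed.

Lemma prb0 : prb set0 = 0.
Proof. by rewrite /prb measure0. Qed.

Lemma prb_le1 A : measurable A -> prb A <= 1.
Proof. by move=> mA; rewrite -prbT prb_le. Qed.

Lemma prb_setC A : measurable A -> prb (~` A) = 1 - prb A.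
Proof.
by move=> mA; rewrite /prb probability_setC// (prbE mA).
Qed.

Lemma prb_setU A B : measurable A -> measurable B -> A `&` B = set0 ->
  prb (A `|` B) = prb A + prb B.
Proof.
by move=> mA mB AB; rewrite /prb measureU// fineD// fin_num_measure.
Qed.

Lemma prb_setD A B : measurable A -> measurable B -> B `<=` A ->
  prb (A `\` B) = prb A - prb B.
Proof.
move=> mA mB BA; have mD : measurable (A `\` B) by exact: measurableD.
suff : prb A = prb B + prb (A `\` B) by lra.
rewrite -prb_setU//.
  by rewrite setDUK.
by rewrite setDE setIC -setIA setICl setI0.
Qed.

Lemma prb_bigcup_fin (J : choiceType) (D : set J) (F : J -> set T) :
  finite_set D -> (forall j, D j -> measurable (F j)) -> trivIset D F ->
  prb (\bigcup_(j in D) F j) = \sum_(j \in D) prb (F j).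
Proof.
move=> fD mF tF; rewrite /prb measure_fin_bigcup// !(fsbig_finite _ _ fD)/=.
rewrite -[RHS]/(fine (_%:E)) -sumEFin.
congr fine; rewrite big_seq [RHS]big_seq; apply: eq_bigr => j jD.
rewrite fineK// fin_num_measure//.
by apply: mF; move: jD; rewrite in_fset_set// inE.
Qed.

Lemma prb_sub_fin (J : finType) (F : J -> set T) A : measurable A ->
  (forall j, measurable (F j)) -> A `<=` \bigcup_j F j ->
  prb A <= \sum_j prb (F j).
Proof.
move=> mA mF AF; rewrite -lee_fin -prbE// -sumEFin.
under eq_bigr => j _ do rewrite -prbE//.
rewrite big_enum_val/=.
pose G (i : nat) := if insub i is Some j then F (enum_val (j : 'I_#|J|)) else set0.
have mG i : measurable (G i) by rewrite /G; case: insubP.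
apply: (@le_trans _ _ (\sum_(i < #|J|) P (G i))%E); last first.
  by apply: lee_sum => i _; rewrite /G valK.
apply: content_subadditive => // w /AF [j _ Fj].
rewrite -bigcup_mkord.
exists (enum_rank j) => //; first exact: ltn_ord.
by rewrite /G valK enum_rankK.
Qed.

Lemma prb_nondecreasing (F : nat -> set T) : (forall n, measurable (F n)) ->
  (forall m n, (m <= n)%N -> F m `<=` F n) ->
  (fun n => prb (F n)) @ \oo --> prb (\bigcup_n F n).
Proof.
move=> mF hF; have mU : measurable (\bigcup_n F n) by exact: bigcup_measurable.
have hF' : {homo F : n m / (n <= m)%N >-> (n <= m)%O}.
  by move=> m n mn; apply/subsetPset; exact: hF.
suff : (P \o F) x @[x --> \oo] --> (prb (\bigcup_n F n))%:E.
  by move=> /fine_cvgP[].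
by rewrite -prbE//; exact: (nondecreasing_cvg_mu (mu := P) mF mU hF').
Qed.

Lemma prb_nonincreasing (F : nat -> set T) : (forall n, measurable (F n)) ->
  (forall m n, (m <= n)%N -> F n `<=` F m) ->
  (fun n => prb (F n)) @ \oo --> prb (\bigcap_n F n).
Proof.
move=> mF hF; have mU : measurable (\bigcap_n F n) by exact: bigcapT_measurable.
have hF' : {homo F : n m / (n <= m)%N >-> (m <= n)%O}.
  by move=> m n mn; apply/subsetPset; exact: hF.
have F0 : (P (F 0%N) < +oo)%E by rewrite prbE// ltry.
suff : (P \o F) x @[x --> \oo] --> (prb (\bigcap_n F n))%:E.
  by move=> /fine_cvgP[].
by rewrite -prbE//; exact: (nonincreasing_cvg_mu (mu := P) F0 mF mU hF').
Qed.

Lemma prb_null_negligible A : measurable A -> prb A = 0 -> P.-negligible A.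
Proof. by move=> mA A0; exists A; split=> //; rewrite prbE// A0. Qed.

Lemma negligible_prb0 A : measurable A -> P.-negligible A -> prb A = 0.
Proof.
by move=> mA /(negligibleP P mA) => h; rewrite /prb h.
Qed.

Lemma cvg_le_bound (u : nat -> R) (l B : R) : u @ \oo --> l ->
  (forall n, u n <= B) -> l <= B.
Proof.
move=> ul uB; have <- := cvg_lim (@norm_hausdorff _ _) ul.
apply: limr_le; first by apply/cvg_ex; exists l.
exact: nearW.
Qed.

(** Fatou's inequality for an event that occurs at all late levels. *)
Lemma prb_liminf_le (F : nat -> set T) m1 (B : R) : (forall m, measurable (F m)) ->
  (forall m, (m1 <= m)%N -> prb (F m) <= B) ->
  prb (\bigcup_m0 \bigcap_(m in [set m | (m0 <= m)%N]) F m) <= B.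
Proof.
move=> mF FB.
have mI m0 : measurable (\bigcap_(m in [set m | (m0 <= m)%N]) F m).
  exact: bigcap_measurableType.
apply: (cvg_le_bound (prb_nondecreasing mI _)) => [m n mn w h k nk|m0].
  by apply: h; exact: leq_trans nk.
apply: le_trans (FB (maxn m0 m1) (leq_maxr _ _)).
by apply: prb_le => // w; apply; rewrite /= leq_maxl.
Qed.

Lemma le0_of_le_eps (x C : R) : (forall n : nat, x <= C * 2 ^- n) -> x <= 0.
Proof.
move=> H; apply/ler_addgt0Pl => e e0; rewrite addr0.
have [n hn] : exists n : nat, `|C| / e < n%:R.
  by exists (Num.truncn (`|C| / e)).+1; exact: truncnS_gt.
apply: (le_trans (H n)); rewrite ler_pdivrMr ?exprn_gt0//.
apply: (le_trans (ler_norm _)); rewrite mulrC -ler_pdivrMr//.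
apply: (le_trans (ltW hn)); rewrite -natrX ler_nat; exact/ltnW/ltn_expl.
Qed.

End prb.

Section cell_measure.
Context {R : realType} {d : nat}.
Notation S := (Rspace R d).

Lemma measurable_boxset (a b : 'I_d -> R) : measurable (boxset a b).
Proof.
rewrite (_ : boxset a b = \bigcap_(i in [set: 'I_d])
    ((fun x : S => tnth x i) @^-1` (`[a i, b i[%classic : set (measurableTypeR R)))).
  apply: fin_bigcap_measurable; first exact: finite_finset.
  move=> i _; rewrite -[_ @^-1` _]setTI; apply: (@measurable_tnth _ _ _ i) => //.
apply/seteqP; split=> x H i; first by move=> _ /=; rewrite in_itv/=; exact: H.
by have := H i I; rewrite /= in_itv.
Qed.

Lemma cell_boxset n k : cell n k =
  boxset (fun i => (k i)%:~R / 2 ^+ n) (fun i => (k i + 1)%:~R / 2 ^+ n) :> set S.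
Proof.
have p0 : 0 < 2 ^+ n :> R by rewrite exprn_gt0.
have E (x : S) i : ((k i)%:~R / 2 ^+ n <= (tnth x i : R) < (k i + 1)%:~R / 2 ^+ n) =
   ((k i)%:~R <= 2 ^+ n * (tnth x i : R) < (k i + 1)%:~R).
  by rewrite ler_pdivrMr// ltr_pdivlMr// mulrC.
by apply/seteqP; split=> x; [move=> /cellofP H i|move=> H; apply/cellofP => i];
  have := H i; rewrite E.
Qed.

Lemma measurable_cell n k : measurable (cell n k : set S).
Proof. by rewrite cell_boxset; exact: measurable_boxset. Qed.

Lemma lebesgue_cell n k :
  @lebesgue_space R d (cell n k) = ((2 ^- n) ^+ d)%:E.
Proof.
rewrite cell_boxset lebesgue_boxset; last first.
  by move=> i; rewrite ler_pM2r ?invr_gt0 ?exprn_gt0// ler_int lerDl.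
rewrite (eq_bigr (fun=> 2 ^- n)) ?prodr_const ?card_ord// => i _.
by rewrite -mulrBl intrD addrAC subrr add0r mul1r.
Qed.

Lemma cell_disjoint r n : trivIset [set: bx r n] (fun j => cell n (bk j) : set S).
Proof.
apply/trivIsetP => i j _ _ ij; apply/seteqP; split=> x //= [xi xj].
by move: ij; rewrite (bk_inj (etrans (esym xi) xj)) eqxx.
Qed.

End cell_measure.

Section law.
Context {R : realType} {d : nat} {dT : measure_display}
  {T : measurableType dT} (P : probability T R) (Pi : T -> Rspace R d -> nat).
Notation S := (Rspace R d).
Context (hPi : poisson_process P (@lebesgue_space R d) Pi).

Lemma measurable_cl (A : set S) o : measurable A ->
  measurable [set w | occupancy (Pi w) A = o].
Proof.
move=> mA; have [h _ _] := hPi.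
have := h A mA measurableT _ (@measurable_cset R o); rewrite setTI.
by congr measurable; apply/seteqP; split=> w; rewrite /= clE.
Qed.

Lemma measurable_cls (J : finType) (G : J -> set S) (o : J -> option bool) :
  (forall j, measurable (G j)) ->
  measurable [set w | forall j, occupancy (Pi w) (G j) = o j].
Proof.
move=> mG; rewrite (_ : mkset _ = \bigcap_(j in [set: J]) [set w | occupancy (Pi w) (G j) = o j]).
  by apply: fin_bigcap_measurable => // j _; exact: measurable_cl.
by apply/seteqP; split=> w H j; [move=> _; exact: H|exact: H].
Qed.

Lemma measurable_npoints (A : set S) (B : set (\bar R)) : measurable A ->
  measurable B -> measurable [set w | B (npoints (Pi w) A : \bar R)].
Proof.
by move=> mA mB; have [h _ _] := hPi; have := h A mA measurableT _ mB; rewrite setTI.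
Qed.

Lemma prb_npoints (J : finType) (G : J -> set S) (B : J -> set (\bar R)) :
  (forall j, measurable (G j)) -> trivIset setT G -> (forall j, measurable (B j)) ->
  prb P [set w | forall j, B j (npoints (Pi w) (G j))] =
  \prod_j prb P [set w | B j (npoints (Pi w) (G j))].
Proof.
move=> mG tG mB; have [_ _ h] := hPi.
have tG' : trivIset [set: 'I_#|J|] (fun i : 'I_#|J| => G (enum_val i)).
  apply/trivIsetP => i j _ _ ij; move/trivIsetP : tG; apply=> //.
  by apply: contra_neq ij => /enum_val_inj.
have := h #|J| (fun i => G (enum_val i)) (fun i => mG (enum_val i)) tG'
  (fun i => B (enum_val i)) (fun i => mB (enum_val i)).
have -> : \bigcap_(i in [set: 'I_#|J|])
     [set w | B (enum_val i) (npoints (Pi w) (G (enum_val i)) : \bar R)] =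
   [set w | forall j, B j (npoints (Pi w) (G j))].
  apply/seteqP; split=> w H; last by move=> i _; exact: H.
  by move=> j; have := H (enum_rank j) I; rewrite /= enum_rankK.
move=> e; rewrite {1}/prb e.
rewrite (eq_bigr (fun i => (prb P [set w | B (enum_val i) (npoints (Pi w) (G (enum_val i)))])%:E)).
  by rewrite prodEFin/= [RHS]big_enum_val.
by move=> i _; apply: prbE; exact: measurable_npoints.
Qed.

Lemma prb_cls (J : finType) (G : J -> set S) (o : J -> option bool) :
  (forall j, measurable (G j)) -> trivIset setT G ->
  prb P [set w | forall j, occupancy (Pi w) (G j) = o j] =
  \prod_j prb P [set w | occupancy (Pi w) (G j) = o j].
Proof.
move=> mG tG.
have := prb_npoints (B := fun j => cset (o j)) mG tG (fun j => measurable_cset _).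
rewrite (_ : mkset _ = [set w | forall j, occupancy (Pi w) (G j) = o j]); last first.
  by apply/seteqP; split=> w h j; have := h j; rewrite clE.
by move=> ->; apply: eq_bigr => j _; congr prb; apply/seteqP; split=> w; rewrite /= clE.
Qed.

Lemma prb_cl_void (A : set S) (v : R) : measurable A -> lebesgue_space A = v%:E ->
  prb P [set w | occupancy (Pi w) A = None] = expR (- v).
Proof.
move=> mA Av; have [_ h _] := hPi.
have := h A mA _ 0%N; rewrite Av ltry/= => /(_ isT).
rewrite expr0 fact0 invr1 !mul1r => e.
rewrite /prb (_ : mkset _ = [set w | npoints (Pi w) A = (0%:R : R)%:E]) ?e//.
by apply/seteqP; split=> w; rewrite /= clE.
Qed.

Lemma prb_cl_single (A : set S) (v : R) : measurable A -> lebesgue_space A = v%:E ->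
  prb P [set w | occupancy (Pi w) A = Some true] = v * expR (- v).
Proof.
move=> mA Av; have [_ h _] := hPi.
have := h A mA _ 1%N; rewrite Av ltry/= => /(_ isT).
rewrite expr1 (_ : 1`! = 1)%N // invr1 !mulr1 => e.
rewrite /prb (_ : mkset _ = [set w | npoints (Pi w) A = (1%:R : R)%:E]) ?e//.
by apply/seteqP; split=> w; rewrite /= clE.
Qed.

Lemma prb_cl_multi (A : set S) (v : R) : measurable A -> lebesgue_space A = v%:E ->
  prb P [set w | occupancy (Pi w) A = Some false] = 1 - expR (- v) - v * expR (- v).
Proof.
move=> mA Av.
rewrite (_ : mkset _ = ~` ([set w | occupancy (Pi w) A = None] `|` [set w | occupancy (Pi w) A = Some true])).
  have m1 := measurable_cl None mA; have m2 := measurable_cl (Some true) mA.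
  rewrite prb_setC; last exact: measurableU.
  rewrite prb_setU// ?(prb_cl_void mA Av) ?(prb_cl_single mA Av); first lra.
  by apply/seteqP; split=> w //= [->].
apply/seteqP; split=> w /=; first by move=> ->; case.
by case: (occupancy _ _) => [[]|] // H; exfalso; apply: H; [right|left].
Qed.

(** The law of an occupancy depends on the volume only; translation invariance of the whole process
    is drawn from this. *)
Lemma prb_cl_eq (A B : set S) (v : R) o : measurable A -> measurable B ->
  lebesgue_space A = v%:E -> lebesgue_space B = v%:E ->
  prb P [set w | occupancy (Pi w) A = o] = prb P [set w | occupancy (Pi w) B = o].
Proof.
move=> mA mB Av Bv; case: o => [[]|].
- by rewrite (prb_cl_single mA Av) (prb_cl_single mB Bv).
- by rewrite (prb_cl_multi mA Av) (prb_cl_multi mB Bv).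
- by rewrite (prb_cl_void mA Av) (prb_cl_void mB Bv).
Qed.

Lemma prb_occupied (A : set S) (v : R) : measurable A -> lebesgue_space A = v%:E ->
  prb P [set w | occupancy (Pi w) A <> None] <= v.
Proof.
move=> mA Av.
rewrite (_ : mkset _ = ~` [set w | occupancy (Pi w) A = None])//.
rewrite prb_setC; last exact: measurable_cl.
by rewrite (prb_cl_void mA Av); have := expR_ge1Dx (- v); lra.
Qed.

Lemma prb_all_occupied (J : finType) (G : J -> set S) (v : R) :
  (forall j, measurable (G j)) -> trivIset setT G ->
  (forall j, lebesgue_space (G j) = v%:E) ->
  prb P [set w | forall j, occupancy (Pi w) (G j) <> None] <= v ^+ #|J|.
Proof.
move=> mG tG Gv.
have E w j : (occupancy (Pi w) (G j) <> None) = (~` [set 0%E : \bar R]) (npoints (Pi w) (G j)).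
  by rewrite clE.
rewrite (_ : mkset _ = [set w | forall j, (~` [set 0%E : \bar R]) (npoints (Pi w) (G j))]).
  rewrite (prb_npoints (B := fun=> ~` [set 0%E]) mG tG); last first.
    by move=> j; apply: measurableC; exact: emeasurable_set1.
  rewrite -prodr_const; apply: ler_prod => j _; rewrite prb_ge0/=.
  rewrite (_ : mkset _ = [set w | occupancy (Pi w) (G j) <> None]) ?(prb_occupied (mG j) (Gv j))//.
  by apply/seteqP; split=> w /=; rewrite E.
by apply/seteqP; split=> w /= h j; have := h j; rewrite E.
Qed.

Definition good : set T := [set w | forall r, exists n, forall j : bx r n,
  occupancy (Pi w) (cell n (bk j)) <> Some false].

Let bad r n := [set w | exists j : bx r n, occupancy (Pi w) (cell n (bk j)) = Some false].

Let badE r n : bad r n = \bigcup_(j in [set: bx r n])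
  [set w | occupancy (Pi w) (cell n (bk j)) = Some false].
Proof. by apply/seteqP; split=> w [j]; [exists j|exists j]. Qed.

Let measurable_bad r n : measurable (bad r n).
Proof.
rewrite badE; apply: fin_bigcup_measurable => // j _.
by apply: measurable_cl; exact: measurable_cell.
Qed.

Let goodE : good = \bigcap_r \bigcup_n ~` (bad r n).
Proof.
apply/seteqP; split=> w H r.
  by move=> _; have [n hn] := H r; exists n => // -[j]; exact: hn.
by have [n _ hn] := H r I; exists n => j e; apply: hn; exists j.
Qed.

Lemma measurable_good : measurable good.
Proof.
rewrite goodE; apply: bigcapT_measurable => r; apply: bigcup_measurable => n _.
exact: measurableC.
Qed.

(** Union bound over the [(2 r 2^n)^d] cells, each multiple with probability at most [v^2]; one
    factor [v] cancels the number of cells per unit volume. *)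
Let prb_bad r n : prb P (bad r n) <= ((2 * r) ^ d)%N%:R * (2 ^- n) ^+ d.
Proof.
set v : R := (2 ^- n) ^+ d.
have v0 : 0 <= v by rewrite exprn_ge0// invr_ge0 exprn_ge0.
pose F (j : bx r n) := [set w | occupancy (Pi w) (cell n (bk j)) = Some false].
have mF j : measurable (F j) by apply: measurable_cl; exact: measurable_cell.
have h : bad r n `<=` \bigcup_j F j by rewrite badE.
apply: (le_trans (prb_sub_fin P (measurable_bad r n) mF h)).
apply: (@le_trans _ _ (\sum_(j : bx r n) v ^+ 2)).
  apply: ler_sum => j _.
  rewrite (prb_cl_multi (measurable_cell _ _) (lebesgue_cell _ _)) -/v.
  (* By [exp (- v) >= 1 - v], the probability [1 - (1 + v) exp (- v)] is at most
     [1 - (1 + v) (1 - v) = v^2]. *)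
  by have := expR_ge1Dx (- v); nra.
rewrite sumr_const card_ffun !card_ord -[leLHS]mulr_natl expr2 mulrA ler_wpM2r//.
rewrite mulnA expnMn natrM -[leRHS]mulr1 -mulrA ler_wpM2l// /v.
by rewrite natrX natrX -exprMn mulfV ?expf_neq0// expr1n.
Qed.

Lemma good_ae : (0 < d)%N -> prb P good = 1.
Proof.
move=> d0.
have mb r : measurable (\bigcup_n ~` bad r n).
  by apply: bigcup_measurable => n _; exact: measurableC.
suff H r : P (~` (\bigcup_n ~` bad r n)) = 0%E.
  have : P.-negligible (~` good).
    rewrite goodE setC_bigcap; apply: negligible_bigcup => r.
    by exists (~` (\bigcup_n ~` bad r n)); split; [exact: measurableC|exact: H|by []].
  move=> /(negligible_prb0 (measurableC measurable_good)).
  by rewrite prb_setC ?measurable_good//; [lra|exact: measurable_good].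
have mC : measurable (~` (\bigcup_n ~` bad r n)) by exact: measurableC.
rewrite prbE//; congr (_%:E); apply/eqP; rewrite eq_le prb_ge0 andbT.
apply/ler_addgt0Pl => e e0; rewrite addr0.
have C0 : 0 < ((2 * r) ^ d)%N%:R + 1 :> R by rewrite ltr_wpDl.
have [n] := @mesh_lt R 1 (e / (((2 * r) ^ d)%N%:R + 1)) (divr_gt0 e0 C0).
move=> /(_ n (leqnn _)); rewrite mul1r => hn.
apply: (@le_trans _ _ (prb P (bad r n))).
  apply: prb_le => //; rewrite setC_bigcup => w /(_ n I); rewrite setCK//.
apply: (le_trans (prb_bad r n)).
have u0 : 0 < 2 ^- n :> R by rewrite invr_gt0 exprn_gt0.
have u1 : 2 ^- n <= 1 :> R by rewrite invf_le1 ?exprn_gt0// exprn_ege1// ler1n.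
have : (2 ^- n) ^+ d <= 2 ^- n :> R.
  rewrite -[leRHS]expr1; apply: ler_wiXn2l => //; exact: ltW.
move: hn; rewrite ltr_pdivlMr// => hn hd.
have : 0 <= ((2 * r) ^ d)%N%:R :> R by [].
set C := (_ ^ _)%:R in hn C0 *; nra.
Qed.

Lemma good_nice w : good w -> nice (Pi w).
Proof.
move=> gw r; have [n hn] := gw r; exists n => x /(inbP r n) [j jx] px.
have := hn j; rewrite -jx /occupancy; case: asboolP => [v|v].
  by move: px; rewrite /points/= v.
by case: asboolP.
Qed.

End law.

(** * Events determined by finitely many cells *)

Section cl_transport.
Context {R : realType} {d : nat}.
Notation S := (Rspace R d).
Implicit Types (xi : S -> nat) (A B : set S).

Definition cellshift n (u k : {ffun 'I_d -> int}) : {ffun 'I_d -> int} :=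
  k + [ffun i => (2 ^ n)%N%:Z * u i].

Lemma cl_shift u xi n k :
  occupancy (shiftc u xi) (cell n k) = occupancy xi (cell n (cellshift n u k)).
Proof.
have E : cell n k = shiftp u @^-1` (cell n (cellshift n u k)) :> set S.
  apply/seteqP; split=> x; rewrite /cell/= cellof_shift; first by move=> ->.
  by move=> /addIr.
apply/cl_eqP; rewrite E; split.
  split=> H x hx; last by apply: H.
  by rewrite -(shiftpVK u x); apply: H => /=; rewrite shiftpVK.
exact: single_preim (shiftpK u) (shiftpVK u).
Qed.

Lemma cl_res B xi A : occupancy (res B xi) A = occupancy xi (A `\` B).
Proof.
apply/cl_eqP; split.
  split=> [H x [Ax Bx]|H x Ax].
    by have := H x Ax; rewrite /res memNset.
  by rewrite /res; case: ifPn => //; rewrite notin_setE => Bx; exact: H.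
split=> -[a].
  rewrite /res; case: ifPn => [_ []//|]; rewrite notin_setE => Ba [Aa a1 H].
  exists a; split=> // y [Ay By] ya; have := H y Ay ya.
  by rewrite memNset.
move=> [[Aa Ba] a1 H]; exists a; split=> //; first by rewrite /res memNset.
move=> y Ay ya; rewrite /res; case: ifPn => //; rewrite notin_setE => By.
exact: H.
Qed.

Definition locn n (F : set (S -> nat)) : set (S -> nat) :=
  [set xi | forall xi', eqv n xi xi' -> F xi'].

Lemma locn_le m n F : (m <= n)%N -> locn m F `<=` locn n F.
Proof. by move=> mn xi H xi' /(eqv_le mn); exact: H. Qed.

(** Finitely many patterns decide [locn n F], whatever [F] is, so its event is a finite disjoint
    union of pattern events. *)
Definition pats n (F : set (S -> nat)) : set {ffun bx n n -> option bool} :=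
  [set o | exists xi, (forall j, occupancy xi (cell n (bk j)) = o j) /\ locn n F xi].

Arguments pats n F : clear implicits.

Lemma locnP n F xi : locn n F xi <->
  exists2 o, pats n F o & forall j, occupancy xi (cell n (bk j)) = o j.
Proof.
split=> [H|[c [xi' [oE H]] oE']].
  exists [ffun j => occupancy xi (cell n (bk j))]; last by move=> j; rewrite ffunE.
  by exists xi; split=> // j; rewrite ffunE.
move=> xi'' E; apply: H => x /[dup] nx /(inbP n n)[j jx].
by rewrite -E// jx oE -oE'.
Qed.

End cl_transport.
Arguments pats {R d} n F.

Section open_events.
Context {R : realType} {d : nat} {dT : measure_display}
  {T : measurableType dT} (P : probability T R) (Pi : T -> Rspace R d -> nat).
Notation S := (Rspace R d).
Context (hPi : poisson_process P (@lebesgue_space R d) Pi) (d0 : (0 < d)%N).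
Notation good := (good Pi).

(* [G n j] is the part of the space whose occupancy in xi is that of the cell
   [bk j] in the transformed configuration; the cells H are kept independent. *)
Section transform.
Variable tr : (S -> nat) -> (S -> nat).
Variable G : forall n, @bx d n n -> set S.
Arguments G : clear implicits.
Hypothesis clG : forall n xi j, occupancy (tr xi) (cell n (bk j)) = occupancy xi (G n j).
Hypothesis mG : forall n j, measurable (G n j).
Hypothesis tG : forall n, trivIset setT (G n).
Hypothesis trnice : forall xi, nice xi -> nice (tr xi).
Variables (I : finType) (H : I -> set S) (q : I -> option bool).
Hypothesis mH : forall i, measurable (H i).
Hypothesis tH : trivIset setT H.
Hypothesis GH : forall n j i, G n j `&` H i = set0.

Definition atomev n (o : {ffun @bx d n n -> option bool}) :=
  [set w | forall j, occupancy (Pi w) (G n j) = o j].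
Definition sideev := [set w | forall i, occupancy (Pi w) (H i) = q i].

Lemma measurable_atomev n o : measurable (atomev (n := n) o).
Proof. by apply: (measurable_cls hPi). Qed.

Lemma measurable_sideev : measurable sideev.
Proof. by apply: (measurable_cls hPi). Qed.

Lemma locevE n F : [set w | locn n F (tr (Pi w))] =
  \bigcup_(o in pats n F) atomev o.
Proof.
apply/seteqP; split=> w /=.
  by move=> /locnP[c ho oE]; exists c => // j; rewrite -clG.
by move=> [c ho oE]; apply/locnP; exists c => // j; rewrite clG.
Qed.

Lemma measurable_locev n F : measurable [set w | locn n F (tr (Pi w))].
Proof.
rewrite locevE; apply: fin_bigcup_measurable => [|o _]; first exact: finite_finset.
exact: measurable_atomev.
Qed.

Lemma trivIset_atomev n D : trivIset D (@atomev n).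
Proof.
apply/trivIsetP => o o' _ _ oo; apply/seteqP; split=> w // [h1 h2].
by move/eqP: oo; apply; apply/ffunP => j; rewrite -h1 h2.
Qed.

Lemma prb_locev n F : prb P [set w | locn n F (tr (Pi w))] =
  \sum_(o \in pats n F) \prod_j prb P [set w | occupancy (Pi w) (G n j) = o j].
Proof.
rewrite locevE prb_bigcup_fin//; last 3 first.
- exact: finite_finset.
- by move=> o _; exact: measurable_atomev.
- exact: trivIset_atomev.
by apply: eq_fsbigr => o _; exact: prb_cls.
Qed.

(** Both families of sets are merged into one disjoint family indexed by a sum type, whose
    occupancies are jointly independent. *)
Lemma prb_atom_side n (o : {ffun @bx d n n -> option bool}) :
  prb P (atomev o `&` sideev) = prb P (atomev o) * prb P sideev.
Proof.
rewrite (prb_cls hPi (fun j => o j) (@mG n) (@tG n)) (prb_cls hPi q mH tH).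
pose GH' (x : @bx d n n + I) := match x with inl j => G n j | inr i => H i end.
pose oq (x : @bx d n n + I) := match x with inl j => o j | inr i => q i end.
have mGH x : measurable (GH' x) by case: x => [j|i]; [exact: mG|exact: mH].
have tGH : trivIset setT GH'.
  apply/trivIsetP => -[j|i] [j'|i'] _ _ ne /=.
  - by move/trivIsetP : (@tG n); apply=> //; apply: contra_neq ne => ->.
  - exact: GH.
  - by rewrite setIC; exact: GH.
  - by move/trivIsetP : tH; apply=> //; apply: contra_neq ne => ->.
have := prb_cls hPi oq mGH tGH; rewrite big_sumType/= => <-.
congr prb; apply/seteqP; split=> w.
  by move=> [h1 h2] [j|i]; [exact: h1|exact: h2].
by move=> h; split=> [j|i]; [exact: (h (inl j))|exact: (h (inr i))].
Qed.

Lemma prb_locev_side n F : prb P ([set w | locn n F (tr (Pi w))] `&` sideev) =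
  prb P [set w | locn n F (tr (Pi w))] * prb P sideev.
Proof.
rewrite locevE setI_bigcupl.
have fin : finite_set (pats n F) by exact: finite_finset.
rewrite prb_bigcup_fin//; last 2 first.
- by move=> o _; apply: measurableI; [exact: measurable_atomev|exact: measurable_sideev].
- apply/trivIsetP => o o' _ _ oo; rewrite setIACA.
  by move/trivIsetP : (@trivIset_atomev n setT) => ->//; rewrite set0I.
rewrite prb_bigcup_fin//; last 2 first.
- by move=> o _; exact: measurable_atomev.
- exact: trivIset_atomev.
rewrite !(fsbig_finite _ _ fin)/= mulr_suml; apply: eq_bigr => o _.
exact: prb_atom_side.
Qed.

Definition openev F := good `&` [set w | F (tr (Pi w))].

Lemma openevE F : opn F ->
  openev F = good `&` \bigcup_n [set w | locn n F (tr (Pi w))].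
Proof.
move=> oF; apply/seteqP; split=> w [gw].
  move=> /= Fw; split=> //.
  by have [n hn] := oF _ (trnice (good_nice gw)) Fw; exists n.
by move=> [n _ hn]; split=> //=; exact: hn.
Qed.

Lemma measurable_openev F : opn F -> measurable (openev F).
Proof.
move=> oF; rewrite openevE//; apply: measurableI; first exact: (measurable_good hPi).
by apply: bigcup_measurable => n _; exact: measurable_locev.
Qed.

Lemma prb_goodI A : measurable A -> prb P (good `&` A) = prb P A.
Proof.
move=> mA; have mg := measurable_good hPi.
have g1 := good_ae hPi d0.
have : prb P A = prb P (good `&` A) + prb P (A `\` good).
  rewrite -prb_setU//; last 3 first.
  - exact: measurableI.
  - exact: measurableD.
  - by apply/seteqP; split=> w // -[[h1 _] [_ h2]].
  congr prb; apply/seteqP; split=> w; last by case=> -[].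
  by move=> Aw; have [gw|gw] := pselect (good w); [left|right].
have : prb P (A `\` good) <= 0.
  have -> : 0 = prb P (~` good) by rewrite prb_setC// g1 subrr.
  by apply: prb_le; [exact: measurableD|exact: measurableC|move=> w []].
have := prb_ge0 P (A `\` good); lra.
Qed.

Lemma prb_openev_cvg F : opn F ->
  (fun n => prb P [set w | locn n F (tr (Pi w))]) @ \oo --> prb P (openev F).
Proof.
move=> oF; rewrite openevE// prb_goodI; last first.
  by apply: bigcup_measurable => n _; exact: measurable_locev.
apply: prb_nondecreasing => [n|m n mn w]; first exact: measurable_locev.
exact: (locn_le mn).
Qed.

(** The product formula holds at each level and passes to the increasing limit. *)
Lemma prb_openev_side F : opn F ->
  prb P (openev F `&` sideev) = prb P (openev F) * prb P sideev.
Proof.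
move=> oF; have mL n := measurable_locev n F.
have h1 : (fun n => prb P [set w | locn n F (tr (Pi w))] * prb P sideev) @ \oo -->
    prb P (openev F) * prb P sideev.
  by apply: cvgMl; exact: prb_openev_cvg.
have h2 : (fun n => prb P [set w | locn n F (tr (Pi w))] * prb P sideev) @ \oo -->
    prb P (openev F `&` sideev).
  rewrite openevE// -setIA prb_goodI; last first.
    apply: measurableI; last exact: measurable_sideev.
    exact: bigcup_measurable.
  rewrite setI_bigcupl.
  rewrite (_ : (fun n => _) = (fun n => prb P ([set w | locn n F (tr (Pi w))] `&` sideev))).
    apply: prb_nondecreasing => [n|m n mn w [h hs]].
      by apply: measurableI => //; exact: measurable_sideev.
    by split=> //; exact: (locn_le mn).
  by apply/funext => n; rewrite prb_locev_side.
exact: (cvg_unique _ h2 h1).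
Qed.

End transform.

Lemma cell_trivIset n : trivIset [set: @bx d n n] (fun j => cell n (bk j) : set S).
Proof. exact: cell_disjoint. Qed.

(** Cut down to [good] because stability is only asserted for nice configurations. *)
Definition pev (F : set (S -> nat)) : set T := good `&` [set w | F (Pi w)].


Lemma measurable_pev F : opn F -> measurable (pev F).
Proof.
by apply: (@measurable_openev id (fun n j => cell n (bk j))) => // n j;
  exact: measurable_cell.
Qed.

Lemma cellshift_trivIset u n :
  trivIset setT (fun j : @bx d n n => cell n (cellshift n u (bk j)) : set S).
Proof.
apply/trivIsetP => i j _ _ ij; apply/seteqP; split=> x //= [xi xj].
by move: ij; rewrite (bk_inj (addIr _ (etrans (esym xi) xj))) eqxx.
Qed.

Lemma measurable_pev_shift u F : opn F -> measurable (pev [set xi | F (shiftc u xi)]).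
Proof.
apply: (@measurable_openev (shiftc u) (fun n j => cell n (cellshift n u (bk j)))).
- by move=> n xi j; exact: cl_shift.
- by move=> n j; exact: measurable_cell.
- exact: nice_shift.
Qed.

(** At each level both probabilities are the same finite sum of products, a cell and its translate
    having equal volume. *)
Lemma pev_shift u F : opn F -> prb P (pev [set xi | F (shiftc u xi)]) = prb P (pev F).
Proof.
move=> oF.
have h1 : (fun n => prb P [set w | locn n F (Pi w)]) @ \oo --> prb P (pev F).
  apply: (@prb_openev_cvg id (fun n j => cell n (bk j))) => // n j.
  exact: measurable_cell.
have h2 : (fun n => prb P [set w | locn n F (shiftc u (Pi w))]) @ \oo -->
    prb P (pev [set xi | F (shiftc u xi)]).
  apply: (@prb_openev_cvg (shiftc u) (fun n j => cell n (cellshift n u (bk j)))) => //.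
  - by move=> n xi j; exact: cl_shift.
  - by move=> n j; exact: measurable_cell.
  - exact: nice_shift.
suff E : (fun n => prb P [set w | locn n F (shiftc u (Pi w))]) =
   (fun n => prb P [set w | locn n F (Pi w)]).
  by rewrite E in h2; exact: (cvg_unique _ h2 h1).
apply/funext => n.
rewrite (@prb_locev (shiftc u) (fun n j => cell n (cellshift n u (bk j)))); last 3 first.
- by move=> m xi j; exact: cl_shift.
- by move=> m j; exact: measurable_cell.
- exact: cellshift_trivIset.
rewrite (@prb_locev id (fun n j => cell n (bk j))); last 3 first.
- by [].
- by move=> m j; exact: measurable_cell.
- exact: cell_trivIset.
apply: eq_fsbigr => o _; apply: eq_bigr => j _.
by apply: (prb_cl_eq hPi); [exact: measurable_cell|exact: measurable_cell|
  exact: lebesgue_cell|exact: lebesgue_cell].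
Qed.

Section restriction.
Variables (B : set S) (mB : measurable B).

Lemma measurable_pev_res F : opn F -> measurable (pev [set xi | F (res B xi)]).
Proof.
apply: (@measurable_openev (res B) (fun n j => cell n (bk j) `\` B)).
- by move=> n xi j; exact: cl_res.
- by move=> n j; apply: measurableD => //; exact: measurable_cell.
- exact: nice_res.
Qed.

(** After the points of [B] are deleted, the event only sees the complement of [B], hence is
    independent of what happens in cells inside [B]. *)
Lemma pev_res_side (I : finType) (H : I -> set S) (q : I -> option bool) F :
  (forall i, measurable (H i)) -> trivIset setT H -> (forall i, H i `<=` B) ->
  opn F ->
  prb P (pev [set xi | F (res B xi)] `&` [set w | forall i, occupancy (Pi w) (H i) = q i]) =
  prb P (pev [set xi | F (res B xi)]) * prb P [set w | forall i, occupancy (Pi w) (H i) = q i].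
Proof.
move=> mH tH HB.
apply: (@prb_openev_side (res B) (fun n j => cell n (bk j) `\` B)) => //.
- by move=> n xi j; exact: cl_res.
- by move=> n j; apply: measurableD => //; exact: measurable_cell.
- move=> n; apply/trivIsetP => i j _ _ ij.
  rewrite !setDE setIACA setIid.
  by move/trivIsetP : (@cell_trivIset n) => ->//; rewrite set0I.
- exact: nice_res.
- move=> n j i; apply/seteqP; split=> x // [[_ h1] h2]; apply: h1; exact: HB h2.
Qed.

End restriction.

End open_events.

(** * Almost sure genericity *)

Section paths.
Context {R : realType} {d : nat} {dT : measure_display}
  {T : measurableType dT} (P : probability T R) (Pi : T -> Rspace R d -> nat).
Notation S := (Rspace R d).
Notation K := {ffun 'I_d -> int}.
Context (hPi : poisson_process P (@lebesgue_space R d) Pi).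

Definition walk n M (k0 : K) (a : {ffun 'I_n.+1 -> off M}) (i : nat) : K :=
  k0 + \sum_(l < n.+1 | (l < i)%N) oint (a l).

(** Injectivity makes the visited cells disjoint, so that the probabilities of their being occupied
    multiply. *)
Definition walk_occ b M n m (j : bx b m) (a : {ffun 'I_n.+1 -> off M}) : set T :=
  [set w | injective (fun i : 'I_n.+2 => walk (bk j) a i) /\
    forall i : 'I_n.+2, occupancy (Pi w) (cell m (walk (bk j) a i)) <> None].

Definition path_ev b M n m H : set T :=
  [set w | exists (j : bx b m) (a : {ffun 'I_n.+1 -> off M}),
    flat H a /\ walk_occ j a w].

Let measurable_walk_occ b M n m (j : bx b m) (a : {ffun 'I_n.+1 -> off M}) :
  measurable (walk_occ j a).
Proof.
have [inj|inj] := pselect (injective (fun i : 'I_n.+2 => walk (bk j) a i)); last first.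
  by rewrite (_ : walk_occ j a = set0)//; apply/seteqP; split=> w // -[].
rewrite (_ : walk_occ j a = \bigcap_(i in [set: 'I_n.+2])
    ~` [set w | occupancy (Pi w) (cell m (walk (bk j) a i)) = None]).
  apply: fin_bigcap_measurable => // i _; apply/measurableC/(measurable_cl hPi).
  exact: measurable_cell.
apply/seteqP; split=> w; first by move=> [_ h] i _; exact: h.
by move=> h; split=> // i; exact: h.
Qed.

Let prb_walk_occ b M n m (j : bx b m) (a : {ffun 'I_n.+1 -> off M}) :
  prb P (walk_occ j a) <= ((2 ^- m) ^+ d) ^+ n.+2.
Proof.
have [inj|inj] := pselect (injective (fun i : 'I_n.+2 => walk (bk j) a i)); last first.
  rewrite (_ : walk_occ j a = set0).
    by rewrite prb0 !exprn_ge0// invr_ge0 exprn_ge0.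
  by apply/seteqP; split=> w // -[].
rewrite -[X in _ ^+ X](card_ord n.+2).
have tG : trivIset setT (fun i : 'I_n.+2 => cell m (walk (bk j) a i) : set S).
  apply/trivIsetP => i i' _ _ ii; apply/seteqP; split=> x // [/= xi xi'].
  by move/eqP: ii; apply; apply: inj; rewrite -xi -xi'.
rewrite (_ : walk_occ j a =
    [set w | forall i : 'I_n.+2, occupancy (Pi w) (cell m (walk (bk j) a i)) <> None]).
  apply: (prb_all_occupied hPi _ tG) => i; first exact: measurable_cell.
  exact: lebesgue_cell.
by apply/seteqP; split=> w //= -[].
Qed.

Let path_evE b M n m H : path_ev b M n m H =
  \bigcup_(p in [set: bx b m * {ffun 'I_n.+1 -> off M}])
     (if flat H p.2 then walk_occ p.1 p.2 else set0).
Proof.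
apply/seteqP; split=> w; first by move=> [j [a [ha hw]]]; exists (j, a) => //=; rewrite ha.
by move=> [[j a] _ /=]; case: ifP => // ha hw; exists j, a.
Qed.

Lemma measurable_path_ev b M n m H : measurable (path_ev b M n m H).
Proof.
rewrite path_evE; apply: fin_bigcup_measurable => // -[j a] _ /=.
by case: ifP => // _; exact: measurable_walk_occ.
Qed.

Lemma prb_path_ev (i0 : 'I_d) b M n m H L : (2 * H < L ^ 2)%N ->
  prb P (path_ev b M n m H) <=
  ((2 * (b * 2 ^ m)) ^ d * ((2 * M).+1 ^ d * ((2 * M).+1 ^ d.-1 * (2 * L)) ^ n))%N%:R *
  ((2 ^- m) ^+ d) ^+ n.+2.
Proof.
move=> HL; set v := (2 ^- m) ^+ d.
have v0 : 0 <= v by rewrite exprn_ge0// invr_ge0 exprn_ge0.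
pose F (p : bx b m * {ffun 'I_n.+1 -> off M}) : set T :=
  if flat H p.2 then walk_occ p.1 p.2 else set0.
have mF p : measurable (F p) by rewrite /F; case: ifP => // _; exact: measurable_walk_occ.
have sub : path_ev b M n m H `<=` \bigcup_p F p by rewrite path_evE.
apply: (le_trans (prb_sub_fin P (measurable_path_ev _ _ _ _ _) mF sub)).
apply: (@le_trans _ _ (\sum_(p : bx b m * {ffun 'I_n.+1 -> off M}) (flat H p.2)%:R * v ^+ n.+2)).
  apply: ler_sum => -[j a] _; rewrite /F/=; case: ifP => _.
    by rewrite mul1r; exact: prb_walk_occ.
  by rewrite mul0r prb0.
rewrite -mulr_suml ler_wpM2r ?exprn_ge0// -natr_sum ler_nat.
rewrite -(pair_bigA _ (fun (j : bx b m) (a : {ffun 'I_n.+1 -> off M}) => nat_of_bool (flat H a)))/=.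
rewrite sum_nat_const card_ffun !card_ord leq_mul2l; apply/orP; right.
apply: leq_trans (card_flat i0 n M HL).
rewrite -sum1_card [leqRHS]big_mkcond/=; apply: leq_sum => a _.
by rewrite -[flat H a]/(a \in flat H); case: (a \in flat H).
Qed.

(* With [M = c 2^m] and [H = 2 * 4^(m - h)] the number of admissible offsets is at
   most [(2M + 1)^(d-1) * 6 * 2^(m - h)], which is of order [2^-h] relative to the
   [2^(md)] cells of a unit cube. *)
Lemma prb_path_ev_le (i0 : 'I_d) b c n m h : (h <= m)%N ->
  prb P (path_ev b (c * 2 ^ m) n m (2 * 4 ^ (m - h))) <=
  ((2 * b) ^ d * (2 * c).+1 ^ d)%N%:R * (((2 * c).+1 ^ d.-1 * 6)%N%:R * 2 ^- h) ^+ n.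
Proof.
move=> hm; set u := (2 ^ (m - h))%N; set N := (2 ^ m)%N.
(* The annulus lemma is used with [L = 3 u], since [4 u^2 < 9 u^2]; this is the 6 of the bound. *)
have HL : (2 * (2 * 4 ^ (m - h)) < (3 * u) ^ 2)%N.
  have -> : (4 ^ (m - h) = u ^ 2)%N by rewrite /u -expnM mulnC expnM.
  have u0 : (0 < u)%N by rewrite expn_gt0.
  by rewrite expnMn; nia.
apply: (le_trans (prb_path_ev i0 b _ n m HL)).
have N0 : (0 < N)%N by rewrite expn_gt0.
have Nu : (N = u * 2 ^ h)%N by rewrite /N /u -expnD subnK.
have dd : d = d.-1.+1 by case: (d) i0 => // -[].
have cN : ((2 * (c * N)).+1 <= (2 * c).+1 * N)%N by nia.
have e1 : 2 ^- m = (N%:R)^-1 :> R by rewrite natrX.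
have e2 : 2 ^- h = ((2 ^ h)%N%:R)^-1 :> R by rewrite natrX.
rewrite e1 e2 !exprVn -exprM -natrX.
rewrite ler_pdivrMr; last by rewrite ltr0n expn_gt0 N0.
rewrite exprMn -natrX exprVn -natrX mulrA -natrM mulrAC ler_pdivlMr; last first.
  by rewrite ltr0n !expn_gt0.
rewrite -!natrM ler_nat.
(* One factor [N^d] pays for the starting cell, one for the first offset, and one for each of the
   [n] constrained offsets. *)
have E : (N ^ (d * n.+2) = N ^ d * N ^ d * (N ^ d.-1 * (u * 2 ^ h)) ^ n)%N.
  rewrite -Nu -expnSr -dd -expnM -!expnD; congr (_ ^ _)%N; lia.
rewrite E.
have A1 : ((2 * (b * N)) ^ d = (2 * b) ^ d * N ^ d)%N by rewrite mulnA expnMn.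
have A2 : ((2 * (c * N)).+1 ^ d <= (2 * c).+1 ^ d * N ^ d)%N.
  by rewrite -expnMn leq_exp2r// dd.
have A3 : ((2 * (c * N)).+1 ^ d.-1 * (2 * (3 * u)) * 2 ^ h <=
   (2 * c).+1 ^ d.-1 * 6 * (N ^ d.-1 * (u * 2 ^ h)))%N.
  have : ((2 * (c * N)).+1 ^ d.-1 <= (2 * c).+1 ^ d.-1 * N ^ d.-1)%N.
    by rewrite -expnMn; case: (d.-1) => // k; rewrite leq_exp2r.
  move=> h1; apply: (@leq_trans ((2 * c).+1 ^ d.-1 * N ^ d.-1 * (2 * (3 * u)) * 2 ^ h)).
    by rewrite !leq_mul2r h1 !orbT.
  by apply/eq_leq; ring.
rewrite A1.
set Q := ((2 * (c * N)).+1 ^ d)%N in A2 *.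
set Z := ((2 * (c * N)).+1 ^ d.-1 * _)%N in A3 *.
set Y := (_ * 6)%N in A3 *.
set W := (N ^ d.-1 * _)%N in A3 *.
have A4 : (Z ^ n * (2 ^ h) ^ n <= Y ^ n * W ^ n)%N.
  by rewrite -!expnMn; case: n {E} => // k; rewrite leq_exp2r.
set B := ((2 * b) ^ d)%N; set D := (N ^ d)%N in A2 *; set C := ((2 * c).+1 ^ d)%N in A2 *.
have := leq_mul A2 A4.
move: (Z ^ n)%N (Y ^ n)%N (W ^ n)%N ((2 ^ h) ^ n)%N => z y w t le.
apply: (@leq_trans (B * D * (Q * (z * t)))); first by apply/eq_leq; ring.
apply: (@leq_trans (B * D * (C * D * (y * w)))); first by rewrite leq_mul2l le orbT.
by apply/eq_leq; ring.
Qed.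

End paths.

(** * From chains of points to chains of cells *)

Section discretize.
Context {R : realType} {d : nat}.
Notation S := (Rspace R d).
Notation K := {ffun 'I_d -> int}.
Notation rho := (@euclidean_dist R d).

Lemma cell_diff m (x y : S) l :
  `|(cellof m y l - cellof m x l)%:~R - 2 ^+ m * ((tnth y l : R) - tnth x l)| <= 1.
Proof.
have /cellofP/(_ l)/andP[x1 x2] := erefl (cellof m x).
have /cellofP/(_ l)/andP[y1 y2] := erefl (cellof m y).
rewrite !intrD rmorphN/= in x2 y2 *.
by rewrite mulrBr ler_norml; apply/andP; split; lra.
Qed.

Lemma cell_diff_bound m c (x y : S) l : rho x y + 1 <= c%:R ->
  (`|cellof m y l - cellof m x l| <= (c * 2 ^ m)%N%:Z)%R.
Proof.
move=> xy; have h := cell_diff m x y l.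
rewrite -(ler_int R) intr_norm -pmulrn natrM natrX.
have := edist_coord y x l; rewrite edistC => hc.
have p1 : 1 <= 2 ^+ m :> R by rewrite exprn_ege1// ler1n.
set D := (cellof m y l - _)%:~R in h *; set t := tnth y l - tnth x l in h hc.
have -> : D = (D - 2 ^+ m * t) + 2 ^+ m * t by rewrite subrK.
apply: (le_trans (ler_normD _ _)); rewrite normrM (@ger0_norm _ (2 ^+ m)) ?(le_trans _ p1)//.
have : 2 ^+ m * `|t| <= 2 ^+ m * rho x y by rewrite ler_wpM2l// (le_trans _ p1).
have : 1 <= 2 ^+ m * (c%:R - rho x y) by rewrite -[leLHS]mulr1 ler_pM//; lra.
by rewrite mulrBr; lra.
Qed.

(** Rounding to cells costs at most 1 per coordinate of size [2^m], so the squared length, of order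
    [4^m], is off by order [2^m] only. Squares are compared because they are integers on the
    lattice. *)
Lemma sqn_dist m c (x y : S) : rho x y + 1 <= c%:R ->
  `|(sqn (cellof m y - cellof m x))%:~R - 4 ^+ m * rho x y ^+ 2| <=
  2 * c%:R * d%:R * 2 ^+ m :> R.
Proof.
move=> xy.
rewrite edistC edist_sqr /sqn rmorph_sum/= mulr_sumr -sumrB.
apply: (le_trans (ler_norm_sum _ _ _)).
apply: (@le_trans _ _ (\sum_(i < d) 2 * c%:R * 2 ^+ m)); last first.
  by rewrite sumr_const card_ord -[leLHS]mulr_natr mulrAC.
apply: ler_sum => l _; rewrite rmorphXn/= !ffunE.
have h := cell_diff m x y l; rewrite !ffunE in h.
have := edist_coord y x l; rewrite edistC => hc.
have p1 : 1 <= 2 ^+ m :> R by rewrite exprn_ege1// ler1n.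
have -> : 4 ^+ m = (2 ^+ m) ^+ 2 :> R by rewrite -exprM mulnC exprM; congr (_ ^+ _); rewrite -natrX.
move: h; set D := (_ - _)%:~R; set t := tnth y l - tnth x l in hc *.
set p := 2 ^+ m in p1 *; move=> h.
have -> : D ^+ 2 - p ^+ 2 * t ^+ 2 = (D - p * t) * ((D - p * t) + 2 * (p * t)) by ring.
have e0 := normr_ge0 (D - p * t).
have c0 := edist_ge0 x y.
rewrite normrM; apply: (@le_trans _ _ (1 * (1 + 2 * (p * rho x y)))).
  apply: ler_pM => //; apply: (le_trans (ler_normD _ _)); rewrite lerD//.
  rewrite !normrM (@ger0_norm _ p) ?(le_trans _ p1)// (@ger0_norm _ 2)//.
  by rewrite ler_pM2l// ler_wpM2l// (le_trans _ p1).
by nra.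
Qed.

Lemma walk_cells n M (k : nat -> K) (a : {ffun 'I_n.+1 -> off M}) :
  (forall i : 'I_n.+1, oint (a i) = k i.+1 - k i) ->
  forall i, (i <= n.+1)%N -> walk (k 0%N) a i = k i.
Proof.
move=> H; elim=> [|i IH] hi; first by rewrite /walk big_pred0 ?addr0.
have {}IH := IH (ltnW hi).
rewrite /walk (bigD1 (Ordinal hi))//= H/= addrCA.
rewrite (eq_bigl (fun l : 'I_n.+1 => (l < i)%N)); last first.
  by move=> l; rewrite -val_eqE/= ltnS leq_eqVlt; case: ltngtP.
by rewrite -/(walk (k 0%N) a i) IH addrC addrCA subrr addr0.
Qed.

Lemma absz_shift (z : int) (M : nat) : (`|z| <= M%:Z)%R ->
  (absz (z + M%:Z)%R < (2 * M).+1)%N /\ (absz (z + M%:Z)%R)%:Z - M%:Z = z.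
Proof. by rewrite ler_norml; lia. Qed.

(** Squared steps within [4^-h] of the first become within [4^(m - h)] in lattice units; the two
    rounding errors add at most another [4^(m - h)] once [m] is large. This explains the window
    [2 * 4^(m - h)]. *)
Lemma path_ev_eventually (dT : measure_display) (T : measurableType dT) (Pi : T -> S -> nat) w b c n h (x : nat -> S) :
  nice (Pi w) -> inb b (x 0%N) ->
  (forall i, (i <= n.+1)%N -> points (Pi w) (x i)) ->
  (forall i j, (i <= n.+1)%N -> (j <= n.+1)%N -> x i = x j -> i = j) ->
  (forall i, (i <= n)%N -> rho (x i) (x i.+1) + 1 <= c%:R) ->
  (forall i, (i <= n)%N ->
     `|rho (x i) (x i.+1) ^+ 2 - rho (x 0%N) (x 1%N) ^+ 2| <= 4 ^- h) ->
  exists m0, forall m, (m0 <= m)%N ->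
    path_ev Pi b (c * 2 ^ m) n m (2 * 4 ^ (m - h)) w.
Proof.
move=> nxi x0b Xx xinj xc xh.
have [r hr] : exists r, forall i, i \in iota 0 n.+2 -> inb r (x i).
  apply: (seq_uniform_rank (p := fun i r => inb r (x i))).
    by move=> i p q; exact: inb_le.
  by move=> i _; exact: inb_ex.
have [n1 hn1] := nxi r.
(* From [n1] on distinct points lie in distinct cells; the last term makes the rounding error
   [4 c d 2^m] at most [4^(m - h)], through [m < 2^m]. *)
exists (n1 + h + 4 * c * d * 4 ^ h)%N => m hm.
have m1 : (n1 <= m)%N by lia.
have mh : (h <= m)%N by lia.
have m2 : (4 * c * d * 4 ^ h <= 2 ^ m)%N.
  by apply: (leq_trans _ (ltnW (ltn_expl m (ltnSn 1)))); lia.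
set M := (c * 2 ^ m)%N; set k := fun i => cellof m (x i).
have [j0 jE] := (inbP b m (x 0%N)).1 x0b.
have bnd i l : (i <= n)%N -> (`|k i.+1 l - k i l| <= M%:Z)%R.
  by move=> hi; apply: cell_diff_bound; exact: xc.
pose a : {ffun 'I_n.+1 -> off M} :=
  [ffun i : 'I_n.+1 => [ffun l => inord (absz (k i.+1 l - k i l + M%:Z))]].
have aE (i : 'I_n.+1) : oint (a i) = k i.+1 - k i.
  apply/ffunP => l; rewrite !ffunE.
  by have := absz_shift (bnd i l (ltn_ord i)); rewrite !ffunE => -[lt eq]; rewrite inordK.
have wE i : (i <= n.+1)%N -> walk (bk j0) a i = k i.
  by move=> hi; rewrite -jE; exact: (walk_cells (k := k) aE).
exists j0, a; split; last split.
- apply/forallP => i; rewrite !aE -(ler_int R) intr_norm.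
  have hi := ltn_ord i; rewrite ltnS in hi.
  have s1 := sqn_dist m (xc _ hi); have s2 := sqn_dist m (xc 0%N (leq0n _)).
  have := xh i hi; rewrite intrD rmorphN/= -pmulrn natrM natrX => ht.
  have m2' : 4 * c%:R * d%:R * 4 ^+ h <= 2 ^+ m :> R.
    by have := m2; rewrite -(ler_nat R) !natrM !natrX.
  have e4 : 4 ^+ m = 4 ^+ (m - h) * 4 ^+ h :> R by rewrite -exprD subnK.
  have e2 : 4 ^+ m = 2 ^+ m * 2 ^+ m :> R.
    by rewrite -expr2 -exprM mulnC exprM; congr (_ ^+ _); rewrite -natrX.
  have p4 : 0 < 4 ^+ h :> R by rewrite exprn_gt0.
  have p2 : 0 < 2 ^+ m :> R by rewrite exprn_gt0.
  have q1 : 4 * c%:R * d%:R * 2 ^+ m <= 4 ^+ (m - h) :> R.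
    rewrite -(ler_pM2r p4) -e4 e2 mulrAC ler_pM2r//.
  have q2 : 4 ^+ m * 4 ^- h = 4 ^+ (m - h) :> R by rewrite e4 mulfK// gt_eqF.
  have {}ht : `|4 ^+ m * rho (x i) (x i.+1) ^+ 2 - 4 ^+ m * rho (x 0%N) (x 1%N) ^+ 2|
      <= 4 ^+ (m - h).
    rewrite -mulrBr normrM ger0_norm ?exprn_ge0// -q2 ler_wpM2l// exprn_ge0//.
  move: s1 s2 ht; rewrite -/(k _) -/(k 0%N) -/(k 1%N) -/(k i.+1).
  set A := (sqn _)%:~R; set B := (sqn _)%:~R.
  rewrite !ler_norml => /andP[? ?] /andP[? ?] /andP[? ?]; apply/andP; split; lra.
- move=> i i' /=; rewrite !wE -1?ltnS ?ltn_ord// => e.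
  have hi := ltn_ord i; have hi' := ltn_ord i'.
  apply/val_inj/xinj; rewrite -1?ltnS//.
  have si := nice_at_le m1 hn1 (hr i _) (Xx i _).
  apply: (single_inj (si _ _)); rewrite ?mem_iota -1?ltnS//.
  + by apply: Xx; rewrite -ltnS.
  + by apply: Xx; rewrite -ltnS.
- move=> i; have hi := ltn_ord i; rewrite wE -1?ltnS//.
  rewrite /occupancy; case: asboolP => // v _.
  have := Xx i; rewrite -ltnS => /(_ hi); rewrite /points/= (v (x i))//.
Qed.

End discretize.

(** * Absence of isosceles triangles and of descending chains *)

Section generic.
Context {R : realType} {d : nat}.
Notation S := (Rspace R d).
Notation rho := (@euclidean_dist R d).

Definition tie_free (X : set S) := forall x y z, X x -> X y -> X z ->
  x <> y -> x <> z -> y <> z -> rho x y <> rho x z.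

Definition chain_free (X : set S) := ~ exists x : nat -> S,
  [/\ forall i, X (x i), injective x &
      forall i, rho (x i.+1) (x i.+2) < rho (x i) (x i.+1)].

End generic.

Section ae_generic.
Context {R : realType} {d : nat} {dT : measure_display}
  {T : measurableType dT} (P : probability T R) (Pi : T -> Rspace R d -> nat).
Notation S := (Rspace R d).
Notation rho := (@euclidean_dist R d).
Context (hPi : poisson_process P (@lebesgue_space R d) Pi) (d0 : (0 < d)%N).
Notation good := (good Pi).

Definition wlim b c n h : set T :=
  \bigcup_m0 \bigcap_(m in [set m | (m0 <= m)%N])
    path_ev Pi b (c * 2 ^ m) n m (2 * 4 ^ (m - h)).

Definition start_const b c : R := ((2 * b) ^ d * (2 * c).+1 ^ d)%N%:R.
Definition step_const c : nat := ((2 * c).+1 ^ d.-1 * 6)%N.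

Lemma measurable_wlim b c n h : measurable (wlim b c n h).
Proof.
apply: bigcup_measurable => m0 _; apply: bigcap_measurableType => m _.
exact: (measurable_path_ev hPi).
Qed.

Lemma prb_wlim b c n h : prb P (wlim b c n h) <= start_const b c * ((step_const c)%:R * 2 ^- h) ^+ n.
Proof.
apply: (prb_liminf_le (m1 := h)) => [m|m hm]; first exact: (measurable_path_ev hPi).
exact: (prb_path_ev_le hPi (Ordinal d0)).
Qed.

(* Chosen so that [step_const c * 2 ^- window_level c <= 1 / 2]: each further step halves the bound. *)
Definition window_level c := (step_const c).+1.

(** [tie_ev] keeps two steps and narrows the annulus; [chain_ev] keeps the annulus and lengthens the
    chain. The estimate [prb_wlim] decays in both regimes. *)
Definition tie_ev b c := \bigcap_h wlim b c 1 h.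
Definition chain_ev b c := \bigcap_n wlim b c n (window_level c).

Lemma prb_tie_ev b c : prb P (tie_ev b c) = 0.
Proof.
apply/eqP; rewrite eq_le prb_ge0 andbT.
apply: (@le0_of_le_eps _ _ (start_const b c * (step_const c)%:R)) => h.
rewrite -mulrA -[_ * 2 ^- h]expr1.
apply: le_trans (prb_wlim b c 1 h).
apply: prb_le; [|exact: measurable_wlim|by move=> w; apply].
by apply: bigcapT_measurable => k; exact: measurable_wlim.
Qed.

Lemma prb_chain_ev b c : prb P (chain_ev b c) = 0.
Proof.
apply/eqP; rewrite eq_le prb_ge0 andbT.
apply: (@le0_of_le_eps _ _ (start_const b c)) => n.
apply: (@le_trans _ _ (start_const b c * ((step_const c)%:R * 2 ^- (window_level c)) ^+ n)).
  apply: le_trans (prb_wlim b c n (window_level c)).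
  apply: prb_le; [|exact: measurable_wlim|by move=> w; apply].
  by apply: bigcapT_measurable => k; exact: measurable_wlim.
rewrite ler_wpM2l// -[2 ^- n]exprVn.
have [->|n0] := posnP n; first by rewrite !expr0.
rewrite ler_pXn2r// ?nnegrE ?mulr_ge0 ?invr_ge0 ?exprn_ge0//.
rewrite ler_pdivrMr ?exprn_gt0// /window_level exprS mulKf//.
by rewrite -natrX ler_nat; exact/ltnW/ltn_expl.
Qed.

Definition generic_ev : set T :=
  good `\` (\bigcup_b \bigcup_c (tie_ev b c `|` chain_ev b c)).

Let measurable_bad b c : measurable (tie_ev b c `|` chain_ev b c).
Proof.
by apply: measurableU; apply: bigcapT_measurable => k; exact: measurable_wlim.
Qed.

Lemma measurable_generic_ev : measurable generic_ev.
Proof.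
apply: measurableD; first exact: (measurable_good hPi).
by do 2 (apply: bigcup_measurable => ? _).
Qed.

Lemma prb_generic_ev : prb P generic_ev = 1.
Proof.
have mg := measurable_good hPi.
suff : prb P (~` generic_ev) = 0.
  rewrite prb_setC; last exact: measurable_generic_ev.
  by move=> h; lra.
apply: negligible_prb0; first exact/measurableC/measurable_generic_ev.
rewrite /generic_ev setDE setCI setCK; apply: negligibleU.
  apply: prb_null_negligible; first exact: measurableC.
  by rewrite prb_setC// good_ae// subrr.
apply: negligible_bigcup => b; apply: negligible_bigcup => c.
have mt : measurable (tie_ev b c) by apply: bigcapT_measurable => k; exact: measurable_wlim.
have mc : measurable (chain_ev b c) by apply: bigcapT_measurable => k; exact: measurable_wlim.
apply: negligibleU; apply: prb_null_negligible => //.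
- exact: prb_tie_ev.
- exact: prb_chain_ev.
Qed.

Lemma generic_nice w : generic_ev w -> nice (Pi w).
Proof. by move=> -[/good_nice]. Qed.

Lemma generic_tie_free w : generic_ev w -> tie_free (points (Pi w)).
Proof.
move=> [/good_nice nw nbad] x y z Xx Xy Xz xy xz yz e; apply: nbad.
have [b hb] := inb_ex y.
set c := (Num.truncn (rho x y + 1)).+1; exists b => //; exists c => //; left => h _.
(* The apex [x] comes in the middle, so that the two equal sides are consecutive steps. *)
pose s i := if i == 0%N then y else if i == 1%N then x else z.
have xc : rho x y + 1 <= c%:R by apply/ltW/truncnS_gt.
have [] := @path_ev_eventually R d dT T Pi w b c 1 h s nw hb _ _ _ _.
- by move=> [|[|[|i]]].
- move=> [|[|[|i]]] [|[|[|j]]] //= _ _ h1; exfalso; have := esym h1; move: xy xz yz h1; rewrite /s/=; tauto.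
- by move=> [|[|i]]//= _; rewrite ?(edistC y x)// -e.
- move=> [|[|i]]//= _; first by rewrite subrr normr0 invr_ge0 exprn_ge0.
  by rewrite (edistC y x) e subrr normr0 invr_ge0 exprn_ge0.
by move=> m0 hm0; exists m0.
Qed.

Lemma generic_chain_free w : generic_ev w -> chain_free (points (Pi w)).
Proof.
move=> [/good_nice nw nbad] [x [Xx xinj xdec]]; apply: nbad.
pose r i := rho (x i) (x i.+1).
have rle i j : (i <= j)%N -> r j <= r i.
  elim: j => [|j IH]; first by rewrite leqn0 => /eqP ->.
  rewrite leq_eqVlt => /orP[/eqP->//|]; rewrite ltnS => /IH h.
  exact: le_trans (ltW (xdec j)) h.
set c := (Num.truncn (r 0%N + 1)).+1.
have xc i : r i + 1 <= c%:R.
  by apply: (@le_trans _ _ (r 0%N + 1)); [rewrite lerD2r rle|apply/ltW/truncnS_gt].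
set e : R := 4 ^- window_level c; have e0 : 0 < e by rewrite invr_gt0 exprn_gt0.
(* The steps decrease, so their squares approach an infimum; from some [i0] on they all lie in one
   window of width [e]. *)
pose A : set R := [set r i ^+ 2 | i in [set: nat]].
have hA : has_inf A.
  split; first by exists (r 0%N ^+ 2); exists 0%N.
  by exists 0 => _ [i _ <-]; rewrite sqr_ge0.
have [_ [i0 _ <-] hi0] := inf_adherent e0 hA.
have hi i : (i0 <= i)%N -> r i0 ^+ 2 - r i ^+ 2 <= e /\ r i ^+ 2 <= r i0 ^+ 2.
  move=> ii; have : inf A <= r i ^+ 2 by apply: ge_inf; [exact: hA.2|exists i].
  split; first lra.
  by rewrite ler_pXn2r ?nnegrE ?edist_ge0// rle.
have [b hb] := inb_ex (x i0).
exists b => //; exists c => //; right => n _.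
have [] := @path_ev_eventually R d dT T Pi w b c n (window_level c) (fun i => x (i0 + i)%N) nw _ _ _ _ _.
- by rewrite addn0.
- by move=> i _; exact: Xx.
- by move=> i j _ _ /xinj/addnI.
- by move=> i _; rewrite addnS; exact: xc.
- move=> i _; rewrite addn0 addn1 addnS.
  have [h1 h2] := hi _ (leq_addr i i0).
  by rewrite distrC ger0_norm ?subr_ge0.
by move=> m0 hm0; exists m0.
Qed.

End ae_generic.

(** * All points are matched *)

Lemma seq_argmin (R : realDomainType) (T : eqType) (s : seq T) (A : T -> Prop) (f : T -> R) x :
  x \in s -> A x ->
  exists y, [/\ y \in s, A y & forall z, z \in s -> A z -> f y <= f z].
Proof.
elim: s x => // a s IH x; rewrite inE => xs Ax.
have [[y ys Ay]|no] := pselect (exists2 y, y \in s & A y); last first.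
  have xa : x = a by case/orP: xs => [/eqP//|xs]; exfalso; apply: no; exists x.
  subst a; exists x; rewrite inE eqxx; split=> // z; rewrite inE => /orP[/eqP->//|zs] Az.
  by exfalso; apply: no; exists z.
have [m [ms Am mmin]] := IH y ys Ay.
have [[Aa am]|no] := pselect (A a /\ f a <= f m).
  exists a; rewrite mem_head; split=> // z; rewrite inE => /orP[/eqP->//|zs] Az.
  by apply: le_trans am _; exact: mmin.
exists m; rewrite inE ms orbT; split=> // z; rewrite inE => /orP[/eqP->|zs] Az; last exact: mmin.
by have [//|/ltW am] := leP (f m) (f a); exfalso; apply: no.
Qed.

Section unmatched.
Context {R : realType} {d : nat}.
Notation S := (Rspace R d).
Notation rho := (@euclidean_dist R d).

(* With two unmatched points, jumping to the nearest unmatched point never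
   returns (mutually nearest unmatched points would be matched), so it yields an
   infinite chain of strictly decreasing steps. *)
Lemma unmatched_unique (xi : S -> nat) (x y : S) :
  nice xi -> tie_free (points xi) -> chain_free (points xi) ->
  points xi x -> points xi y -> x <> y ->
  (exists z, matched rho (points xi) x z) \/ (exists z, matched rho (points xi) y z).
Proof.
move=> nxi tf cf Xx Xy xy; apply: contrapT => no.
set X := points xi in tf cf Xx Xy no *.
pose U u := X u /\ ~ exists z, matched rho X u z.
have Ux : U x by split=> // h; apply: no; left.
have Uy : U y by split=> // h; apply: no; right.
have msym := @matched_sym _ _ rho (@edistC R d).
pose near u := [set v | [/\ U v, v <> u & forall c, U c -> c <> u -> rho u v <= rho u c]].
have nearex u : U u -> exists v, near u v.
  move=> Uu; have [v [Uv vu]] : exists v, U v /\ v <> u.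
    by have [e|xu] := pselect (x = u); [exists y; split=> // e'; apply: xy; rewrite e|exists x].
  have [s hs] := inb_dist u (rho u v).
  have [l hl] := nice_finite s nxi.
  have lv : v \in l by apply: hl; [apply: hs; rewrite edistC|exact: Uv.1].
  have [m [ml [Um mu] mmin]] := seq_argmin (A := fun v => U v /\ v <> u) (rho u) lv (conj Uv vu).
  exists m; split=> // c Uc cu.
  have [le|/ltW le] := leP (rho u c) (rho u v); last by exact: le_trans (mmin _ lv _) le.
  by apply: mmin => //; apply: hl; [apply: hs; rewrite edistC|exact: Uc.1].
pose nx u := xget u (near u).
have nxP u : U u -> near u (nx u).
  by move=> /nearex[v hv]; exact: (xgetI _ hv).
have Uit i : U (iter i nx x) by elim: i => //= i /nxP[].
have step u : U u -> rho (nx u) (nx (nx u)) < rho u (nx u).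
  move=> Uu; have [Uv vu vmin] := nxP u Uu.
  have [Uw wv wmin] := nxP _ Uv.
  set v := nx u in Uv vu vmin Uw wv wmin *; set w := nx v in Uw wv wmin *.
  have uv : u <> v by apply/nesym.
  have le : rho v w <= rho u v by rewrite [leRHS]edistC; exact: wmin.
  rewrite lt_neqAle le andbT; apply/eqP => e.
  (* With equal steps, either [u] and [w] are two points at the same distance from [v], a tie, or
     [w = u] and [u], [v] are mutually nearest. *)
  have [wu|wu] := pselect (w = u); last first.
    apply: (tf v u w Uv.1 Uu.1 Uw.1 vu _ _ _); [exact/nesym|exact/nesym|].
    by rewrite edistC e.
  apply: Uu.2; exists v.
  (* An unmatched competitor of [u], [v] would be exactly as near as the nearest unmatched point,
     again a tie. So every competitor is matched and the pair gets a certificate. *)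
  pose f c := xget c [set z | matched rho X c z].
  have fP c : X c -> c <> u -> c <> v -> rho c u <= rho u v \/ rho c v <= rho u v ->
      matched rho X c (f c).
    move=> Xc cu cv clo.
    have [[z cz]|nc] := pselect (exists z, matched rho X c z).
      exact: (@xgetI _ c [set z | matched rho X c z] z).
    exfalso; have Uc : U c by [].
    have uc : u <> c by apply/nesym.
    have vc : v <> c by apply/nesym.
    case: clo => clo.
      apply: (tf u v c Uu.1 Uv.1 Xc uv uc vc).
      by apply/le_anti; rewrite vmin// edistC.
    apply: (tf v u c Uv.1 Uu.1 Xc vu vc uc).
    by apply/le_anti; rewrite -{1}wu wmin//= edistC [leRHS]edistC.
  apply: (@Matched _ _ _ _ _ _ f) => //; [exact: Uu.1|exact: Uv.1|].
  move=> c Xc cu cv clo; have m := fP _ Xc cu cv clo.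
  split=> e'; rewrite e' in m.
    by apply: Uu.2; exists c; exact: msym.
  by apply: Uv.2; exists c; exact: msym.
apply: cf; exists (fun i => iter i nx x); split.
- by move=> i; exact: (Uit i).1.
- pose r i := rho (iter i nx x) (nx (iter i nx x)).
  have rlt i j : (i < j)%N -> r j < r i.
    elim: j => // j IH; rewrite ltnS leq_eqVlt => /orP[/eqP->|/IH h].
      exact: (step _ (Uit j)).
    exact: lt_trans (step _ (Uit j)) h.
  move=> i j e; have [lt|lt|//] := ltngtP i j.
  + by have := rlt _ _ lt; rewrite /r e ltxx.
  + by have := rlt _ _ lt; rewrite /r e ltxx.
- by move=> i; exact: (step _ (Uit i)).
Qed.

End unmatched.

Section all_matched.
Context {R : realType} {d : nat} {dT : measure_display}
  {T : measurableType dT} (P : probability T R) (Pi : T -> Rspace R d -> nat).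
Notation S := (Rspace R d).
Notation rho := (@euclidean_dist R d).
Context (hPi : poisson_process P (@lebesgue_space R d) Pi) (d0 : (0 < d)%N).
Notation good := (good Pi).

Definition allm (u : {ffun 'I_d -> int}) : set (S -> nat) :=
  ev_all (cell 0 u) (fun _ _ => True).

Lemma opn_allm u : opn (allm u).
Proof.
apply: (@opn_ev_all _ _ _ _ (\max_(i < d) (absz (u i)).+1) 0).
- by move=> x y _; exists 0%N.
- move=> x /cellofP ux i; have /andP[] := ux i; rewrite expr0 mul1r => h1 h2.
  have := leq_bigmax (F := fun i => (absz (u i)).+1) i; rewrite -(ler_nat R) -natr1 natr_absz.
  set M := (\max_(_ < _) _)%:R => hM.
  have := ler_norm (u i); have := ler_norm (- u i); rewrite normrN.
  rewrite -!(ler_int R) rmorphN/= => n1 n2.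
  by rewrite intrD in h2; apply/andP; split; lra.
- by move=> x y e; rewrite /cell/= e.
Qed.

Lemma allm_shift u : allm u = [set xi | allm 0 (shiftc u xi)].
Proof.
apply/seteqP; split=> xi H x px xu.
  have [] := H (shiftp u x) px.
    by rewrite /cell/= cellof_shift xu; apply/ffunP => i; rewrite !ffunE add0r mul1r.
  move=> y [m _]; exists (shiftp (- u) y); split=> //.
  by apply/matched_shift; rewrite shiftpVK.
have [] := H (shiftp (- u) x).
- by rewrite /points/= /shiftc shiftpVK.
- by rewrite /cell/= cellof_shift xu; apply/ffunP => i; rewrite !ffunE mul1r subrr.
move=> y [m _]; exists (shiftp u y); split=> //.
by move/matched_shift: m; rewrite shiftpVK.
Qed.

Lemma prb_allm u : prb P (pev Pi (allm u)) = prb P (pev Pi (allm 0)).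
Proof. by rewrite allm_shift (pev_shift hPi d0)//; exact: opn_allm. Qed.

(** By [unmatched_unique], the events that the diagonal cell [e n] contains an unmatched point are
    disjoint on [generic_ev]. Each has probability at least [1 - p], so [n (1 - p) <= 1] for all
    [n]. *)
Lemma prb_allm1 u : prb P (pev Pi (allm u)) = 1.
Proof.
rewrite prb_allm; set p := prb P (pev Pi (allm 0)).
have mA v : measurable (pev Pi (allm v)) by apply: (measurable_pev hPi); exact: opn_allm.
have mg := measurable_generic_ev hPi.
have p1 : p <= 1 by exact: prb_le1.
suff : 1 - p <= 0 by move=> h; apply/le_anti; rewrite p1; lra.
pose e (n : nat) : {ffun 'I_d -> int} := [ffun=> n%:Z].
pose B n := generic_ev Pi `\` pev Pi (allm (e n)).
have mB n : measurable (B n) by exact: measurableD.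
have pB n : prb P (B n) >= 1 - p.
  have : prb P (~` pev Pi (allm (e n))) <= prb P (B n) + prb P (~` generic_ev Pi).
    have : prb P (B n `|` ~` generic_ev Pi) = prb P (B n) + prb P (~` generic_ev Pi).
      apply: prb_setU => //; first exact: measurableC.
      by apply/seteqP; split=> w // [[]].
    move=> <-; apply: prb_le; [exact: measurableC|apply: measurableU => //; exact: measurableC|].
    by move=> w nw; have [gw|gw] := pselect (generic_ev Pi w); [left|right].
  rewrite !prb_setC// prb_allm (prb_generic_ev hPi d0) -/p; lra.
have tB : trivIset setT B.
  apply/trivIsetP => i j _ _ ij; apply/seteqP; split=> w // [[gw ni] [_ nj]].
  have gg : good w by case: gw.
  have ex n : ~ pev Pi (allm (e n)) w -> exists x, [/\ points (Pi w) x, cell 0 (e n) x &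
      ~ exists y, matched rho (points (Pi w)) x y].
    move=> h; apply: contrapT => h'; apply: h; split=> // x px xc.
    apply: contrapT => nm; apply: h'; exists x; split=> // -[y my].
    by apply: nm; exists y.
  have [x [px xc nx]] := ex _ ni; have [y [py yc ny]] := ex _ nj.
  have xy : x <> y.
    move=> xy; move/eqP: ij; apply; move: xc yc; rewrite xy /cell/= => -> /ffunP.
    by move=> /(_ (Ordinal d0)); rewrite !ffunE => -[].
  by case: (unmatched_unique (generic_nice gw) (generic_tie_free gw) (generic_chain_free gw) px py xy).
have H (n : nat) : n%:R * (1 - p) <= 1.
  have fin : finite_set `I_n by exact: finite_II.
  apply: (@le_trans _ _ (prb P (\bigcup_(i in `I_n) B i))); last first.
    by apply: prb_le1; exact: fin_bigcup_measurable.
  rewrite prb_bigcup_fin//; last exact: sub_trivIset tB.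
  rewrite -fsbig_ord/= -[n in n%:R]card_ord mulr_natl -sumr_const.
  by apply: ler_sum => i _; exact: pB.
rewrite leNgt; apply/negP => p0.
have := H (Num.truncn (1 - p)^-1).+1; rewrite -ler_pdivlMr// mul1r.
by rewrite leNgt truncnS_gt.
Qed.

End all_matched.

(** * Inserting a point near the origin *)

Section surgery.
Context {R : realType} {S : Type} (rho : S -> S -> R).
Hypothesis rhoC : forall x y, rho x y = rho y x.

(** Outside [B] a certificate only loses competitors, and those left keep their partners because no
    pair crosses the border. *)
Lemma matched_setD (X B : set S) :
  (forall x y, matched rho X x y -> ~ B x -> ~ B y) ->
  forall x y, matched rho X x y -> ~ B x -> matched rho (X `\` B) x y.
Proof.
move=> H x y m; elim: m => {}x {}y f Xx Xy xy fne fm IH Bx.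
have mxy : matched rho X x y by apply: (@Matched _ _ _ _ _ _ f).
apply: (@Matched _ _ _ _ _ _ f) => //; first by split=> //; exact: H mxy Bx.
- by move=> c [Xc _]; exact: fne.
- by move=> c [Xc Bc] cx cy clo; exact: IH.
Qed.

(** The added point is farther from every matched point than its partner, so it never becomes a
    competitor. *)
Lemma matched_add (X Y : set S) z : Y `<=` X -> (forall x, X x -> x <> z -> Y x) ->
  (forall x y, matched rho Y x y -> rho x y < rho z x) ->
  forall x y, matched rho Y x y -> matched rho X x y.
Proof.
move=> YX XY far x y m; elim: m => {}x {}y f Yx Yy xy fne fm IH.
have mxy : matched rho Y x y by apply: (@Matched _ _ _ _ _ _ f).
have Yc c : X c -> rho c x <= rho x y \/ rho c y <= rho x y -> Y c.
  move=> Xc clo; apply: XY => // cz; subst c; case: clo.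
    by rewrite leNgt (far _ _ mxy).
  by rewrite leNgt (rhoC x) (far _ _ (matched_sym rhoC mxy)).
apply: (@Matched _ _ _ _ _ _ f) => //; [exact: YX|exact: YX| |].
- by move=> c Xc cx cy clo; apply: fne => //; exact: Yc clo.
- by move=> c Xc cx cy clo; apply: IH => //; exact: Yc clo.
Qed.

End surgery.

Section insertion.
Context {R : realType} {d : nat} {dT : measure_display}
  {T : measurableType dT} (P : probability T R) (Pi : T -> Rspace R d -> nat).
Notation S := (Rspace R d).
Notation rho := (@euclidean_dist R d).
Notation K := {ffun 'I_d -> int}.
Context (hPi : poisson_process P (@lebesgue_space R d) Pi) (d0 : (0 < d)%N).
Notation good := (good Pi).

Lemma negligible_bigcup_count (I : countType) (F : I -> set T) :
  (forall i, P.-negligible (F i)) -> P.-negligible (\bigcup_i F i).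
Proof.
move=> nF.
pose G n := if @unpickle I n is Some i then F i else set0.
have sub : \bigcup_i F i `<=` \bigcup_n G n.
  by move=> w [i _ Fi]; exists (pickle i) => //; rewrite /G pickleK.
apply: (negligibleS sub).
by apply: negligible_bigcup => n; rewrite /G; case: unpickle => //; exact: negligible_set0.
Qed.

Definition complete_at w := generic_ev Pi w /\
  forall x, points (Pi w) x -> exists y, matched rho (points (Pi w)) x y.

Lemma complete_ae : P.-negligible (~` complete_at).
Proof.
have sub : ~` complete_at `<=` ~` generic_ev Pi `|` \bigcup_u ~` pev Pi (allm u).
  move=> w nc; apply: contrapT => h; apply: nc; split.
    by apply: contrapT => ng; apply: h; left.
  move=> x px.
  have [[_ /(_ x px erefl)[y [m _]]]|np] := pselect (pev Pi (allm (cellof 0 x)) w).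
    by exists y.
  by exfalso; apply: h; right; exists (cellof 0 x).
apply: (negligibleS sub); apply: negligibleU.
  apply: prb_null_negligible; first exact/measurableC/(measurable_generic_ev hPi).
  by rewrite prb_setC ?prb_generic_ev ?subrr//; exact: (measurable_generic_ev hPi).
apply: negligible_bigcup_count => u.
have mA : measurable (pev Pi (allm u)) by apply: (measurable_pev hPi); exact: opn_allm.
apply: prb_null_negligible; first exact: measurableC.
by rewrite prb_setC// prb_allm1// subrr.
Qed.

(** Proximity to the lattice point [u] is measured by a cube, which can be counted coordinate by
    coordinate. *)
Definition visit (L k c : R) (u : K) (x y : S) :=
  L < rho x y /\ forall i, `|(tnth x i : R) - (u i)%:~R| < k * rho x y + c.

Lemma opn2_visit L k c u : 0 <= k -> opn2 (visit L k c u).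
Proof.
move=> k0; apply: opn2_and.
  have h : opn2 (fun x y : S => 0 < rho x y - L).
    apply: (@opn2_lt _ _ _ 2) => // n x y x' y' xx yy.
    by have := dist_lip xx yy; rewrite ler_norml => /andP[h1 h2]; lra.
  by move=> x y Lr; have [|n hn] := h x y; [rewrite subr_gt0|
    exists n => x' y' xx yy; rewrite -subr_gt0; exact: hn].
apply: (@opn2_all _ _ (fun i x y => `|(tnth x i : R) - (u i)%:~R| < k * rho x y + c)) => i.
have h : opn2 (fun x y : S => 0 < k * rho x y + c - `|(tnth x i : R) - (u i)%:~R|).
  apply: (@opn2_lt _ _ _ (2 * k + 1)) => [|n x y x' y' xx yy]; first lra.
  have := dist_lip xx yy; rewrite ler_norml => /andP[h1 h2].
  have := coord_lip i (u i)%:~R xx; rewrite ler_norml => /andP[h3 h4].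
  by have := ler_wpM2l k0 h2; lra.
by move=> x y Lr; have [|n hn] := h x y; [rewrite subr_gt0|
  exists n => x' y' xx yy; rewrite -subr_gt0; exact: hn].
Qed.

(** Such an [x] prefers its partner to any point whose coordinates are at most 1 in absolute value.
    The box makes the event stable; [outer_ev] lets it grow. *)
Definition outer (r : nat) : set (S -> nat) :=
  ev_all (inb r) (fun x y => exists i, rho x y + 1 < `|tnth x i : R|).

Lemma opn_outer r : opn (outer r).
Proof.
apply: (@opn_ev_all _ _ _ _ r 0) => //; last by move=> x y; exact: inb_cell.
apply: (@opn2_ex _ _ (fun i x y => rho x y + 1 < `|tnth x i : R|)) => i.
have h : opn2 (fun x y : S => 0 < `|tnth x i : R| - (rho x y + 1)).
  apply: (@opn2_lt _ _ _ 3) => // n x y x' y' xx yy.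
  have := dist_lip xx yy; rewrite ler_norml => /andP[h1 h2].
  have := coord_lip i 0 xx; rewrite !subr0 ler_norml => /andP[h3 h4].
  by lra.
by move=> x y Lr; have [|n hn] := h x y; [rewrite subr_gt0|
  exists n => x' y' xx yy; rewrite -subr_gt0; exact: hn].
Qed.

Definition cells m (s : seq K) : set S := [set x | cellof m x \in s].

Lemma measurable_cells m s : measurable (cells m s).
Proof.
rewrite (_ : cells m s = \bigcup_(k in [set` s]) cell m k).
  by apply: fin_bigcup_measurable => // k _; exact: measurable_cell.
apply/seteqP; split=> x; first by move=> h; exists (cellof m x).
by move=> [k ks xk]; rewrite /cells/= xk.
Qed.

Definition outer_ev m s := \bigcap_r pev Pi [set xi | outer r (res (cells m s) xi)].

Lemma measurable_outer_ev m s : measurable (outer_ev m s).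
Proof.
apply: bigcapT_measurable => r; apply: (measurable_pev_res hPi); last exact: opn_outer.
exact: measurable_cells.
Qed.

Definition one_point m (s : seq K) : set T :=
  [set w | forall k : seq_sub s, occupancy (Pi w) (cell m (val k)) =
     if val k == 0 then Some true else None].

Lemma one_point_gt0 m s : 0 < prb P (one_point m s).
Proof.
rewrite /one_point.
rewrite (prb_cls hPi (G := fun k : seq_sub s => cell m (val k))
  (fun k : seq_sub s => if val k == 0 then Some true else None)).
- apply: prodr_gt0 => k _.
  have v0 : 0 < (2 ^- m) ^+ d :> R by rewrite exprn_gt0// invr_gt0 exprn_gt0.
  case: ifP => _.
    by rewrite (prb_cl_single hPi (measurable_cell _ _) (lebesgue_cell _ _)) mulr_gt0// expR_gt0.
  by rewrite (prb_cl_void hPi (measurable_cell _ _) (lebesgue_cell _ _)) expR_gt0.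
- by move=> k; exact: measurable_cell.
- apply/trivIsetP => i j _ _ ij; apply/seteqP; split=> x // [xi xj].
  by move/eqP: ij; apply; apply: val_inj; rewrite -xi -xj.
Qed.

Lemma measurable_one_point m s : measurable (one_point m s).
Proof. by apply: (measurable_cls hPi) => k; exact: measurable_cell. Qed.

(** For each box the outer event ignores the cells of [s], hence is independent of their
    occupancies; let the box grow. *)
Lemma prb_outer_one m s :
  prb P (outer_ev m s `&` one_point m s) = prb P (outer_ev m s) * prb P (one_point m s).
Proof.
pose F r := pev Pi [set xi | outer r (res (cells m s) xi)].
have mF r : measurable (F r).
  by apply: (measurable_pev_res hPi); [exact: measurable_cells|exact: opn_outer].
have dF i j : (i <= j)%N -> F j `<=` F i.
  move=> ij w [gw h]; split=> // x px rx; apply: h => //; exact: inb_le ij rx.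
have m1 := measurable_one_point m s.
have h1 : (fun r => prb P (F r) * prb P (one_point m s)) @ \oo -->
    prb P (outer_ev m s) * prb P (one_point m s).
  by apply: cvgMl; apply: prb_nonincreasing.
have h2 : (fun r => prb P (F r) * prb P (one_point m s)) @ \oo -->
    prb P (outer_ev m s `&` one_point m s).
  rewrite (_ : outer_ev m s `&` one_point m s = \bigcap_r (F r `&` one_point m s)).
    rewrite (_ : (fun r => _) = (fun r => prb P (F r `&` one_point m s))).
      apply: prb_nonincreasing => [r|i j ij w [hw ?]]; first exact: measurableI.
      by split=> //; exact: dF ij _ hw.
    apply/funext => r; apply/esym.
    apply: (pev_res_side hPi d0) => //.
    + exact: measurable_cells.
    + by move=> k; exact: measurable_cell.
    + apply/trivIsetP => i j _ _ ij; apply/seteqP; split=> x // [xi xj].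
      by move/eqP: ij; apply; apply: val_inj; rewrite -xi -xj.
    + by move=> k x /= xk; rewrite /cells/= xk (valP k).
    + exact: opn_outer.
  apply/seteqP; split=> w; first by move=> [h ?] r _; split=> //; exact: h.
  by move=> h; split; [move=> r _; exact: (h r I).1|exact: (h 0%N I).2].
exact: (cvg_unique _ h2 h1).
Qed.

(** By [matched_add] the outer points stay matched among themselves when the single inner point [z]
    is put in, so the partner of [z] would have a second partner. *)
Lemma outer_one_complete m s w : 0 \in s -> outer_ev m s w -> one_point m s w ->
  ~ complete_at w.
Proof.
move=> s0 hout hone [gw hall].
have Bx x : points (Pi w) x -> cells m s x -> cell m 0 x.
  move=> px sx; apply: contrapT => x0.
  have := hone (SeqSub sx); rewrite /=; case: eqP => [e|_]; first by exfalso; apply: x0.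
  by rewrite /occupancy; case: asboolP => // v _; move: px; rewrite /points/= v.
have [z [z0 z1 zH]] : single (Pi w) (cell m 0).
  have := hone (SeqSub s0); rewrite /= eqxx /occupancy; case: asboolP => // _.
  by case: asboolP.
set X := points (Pi w) in hall Bx *.
pose Y := points (res (cells m s) (Pi w)).
have YE : Y = X `\` cells m s by rewrite /Y points_res.
have Xz : X z by rewrite /X/points/= z1.
have zB : cells m s z by rewrite /cells/= z0.
have far x y : matched rho Y x y -> rho x y < rho z x.
  move=> m1; have [Yx _ _] := matched_in m1.
  have [r rx] := inb_ex x.
  have [_ /(_ x Yx rx)[y' [m2 [i hi]]]] := hout r I.
  have e := matched_uniq (@edistC R d) m1 m2; subst y'.
  have hz : `|tnth z i : R| <= 1.
    have /cellofP/(_ i) := z0; rewrite ffunE mulr0z add0r => /andP[h1 h2].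
    have p1 : 1 <= 2 ^+ m :> R by rewrite exprn_ege1// ler1n.
    have t0 : 0 <= (tnth z i : R) by move: h1; rewrite pmulr_rge0// (lt_le_trans _ p1).
    by rewrite ger0_norm//; nra.
  have := edist_coord z x i; have := ler_normB (tnth z i : R) ((tnth z i : R) - tnth x i).
  by rewrite subKr; move: hi hz; lra.
have YX : Y `<=` X by rewrite YE => x [].
have XY x : X x -> x <> z -> Y x.
  move=> Xx xz; rewrite YE; split=> // /(Bx x Xx) x0.
  by move: Xx; rewrite /X/points/= zH.
have mX := matched_add (@edistC R d) YX XY far.
have [y mzy] := hall z Xz.
have [_ Xy zy] := matched_in mzy.
have Yy : Y y.
  rewrite YE; split=> // /(Bx y Xy) y0.
  by move: Xy; rewrite /X/points/= zH//; exact/nesym.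
have [r ry] := inb_ex y.
have [_ /(_ y Yy ry)[y' [m2 _]]] := hout r I.
have m2X := mX _ _ m2.
have e := matched_uniq (@edistC R d) m2X (matched_sym (@edistC R d) mzy); subst y'.
by have [_ + _] := matched_in m2; rewrite points_res => -[_]; apply.
Qed.

Lemma outer_ev_null m s : 0 \in s -> P.-negligible (outer_ev m s).
Proof.
move=> s0; apply: prb_null_negligible; first exact: measurable_outer_ev.
have h0 : prb P (outer_ev m s `&` one_point m s) = 0.
  apply: negligible_prb0.
    apply: measurableI; [exact: measurable_outer_ev|exact: measurable_one_point].
  have sub : outer_ev m s `&` one_point m s `<=` ~` complete_at.
    by move=> w [h1 h2]; exact: outer_one_complete s0 h1 h2.
  exact: (negligibleS sub complete_ae).
move/eqP: h0; rewrite prb_outer_one mulf_eq0 => /orP[/eqP//|/eqP e].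
by have := one_point_gt0 m s; rewrite e ltxx.
Qed.

(* If all pairs of length more than [L] stay away from the origin, then the pairs
   reaching a neighbourhood of the origin can be surrounded by finitely many cells
   which no matched pair crosses. *)
Lemma outer_ev_ex (L : R) w : 0 <= L -> complete_at w ->
  ~ ev_pair (visit L 1 2 0) (Pi w) ->
  exists m s, 0 \in s /\ outer_ev m s w.
Proof.
move=> L0 [gw hall] nv.
have nw := generic_nice gw; have gg : good w by case: gw.
set X := points (Pi w) in hall *.
have [f fP] : exists f : S -> S, forall x, X x -> matched rho X x (f x).
  exists (fun x => xget x [set y | matched rho X x y]) => x /hall[y xy].
  exact: (@xgetI _ x [set y | matched rho X x y] y).
have msym := @matched_sym _ _ rho (@edistC R d).
have muniq := @matched_uniq _ _ rho (@edistC R d).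
(* A point outside this box whose pair has length at most [L] then satisfies the inequality of
   [outer]. *)
pose r0 := (Num.truncn (L + 2)).+1.
have r0L : L + 2 < r0%:R by exact: truncnS_gt.
have [l hl] := nice_finite r0 nw.
have [r1 hr1] : exists r, forall x, x \in l -> inb r (f x).
  apply: (seq_uniform_rank (p := fun x r => inb r (f x))).
    by move=> x p q; exact: inb_le.
  by move=> x _; exact: inb_ex.
(* At this level a cell of [s1] contains nothing but the partner that it was chosen for, so it
   brings in no new pair. *)
have [m hm] := nw r1.
pose s0 : seq K := [seq bk j | j : bx r0 m].
pose s1 : seq K := [seq cellof m (f x) | x <- l & `[< X x /\ inb r0 x >]].
exists m, (s0 ++ s1).
have in0 x : inb r0 x -> cellof m x \in s0.
  by move=> /(inbP r0 m)[j ->]; apply: map_f; rewrite mem_enum.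
split.
  rewrite mem_cat; apply/orP; left.
  pose z : S := [tuple (0 : R) | i < d].
  have <- : cellof m z = 0.
    by apply/ffunP => i; rewrite !ffunE tnth_mktuple mulr0 floor0.
  by apply: in0 => i; rewrite tnth_mktuple ltr0n oppr_le0 ler0n.
have cross a b : matched rho X a b -> ~ cells m (s0 ++ s1) a -> ~ cells m (s0 ++ s1) b.
  move=> mab na; have [Xa Xb _] := matched_in mab.
  have a0 : ~ inb r0 a by move=> /in0 h; apply: na; rewrite /cells/= mem_cat h.
  rewrite /cells/= mem_cat => /orP[/mapP[j _ bj]|/mapP[x]].
    have b0 : inb r0 b by apply/(inbP r0 m); exists j.
    have fb := muniq _ _ _ _ (fP b Xb) (msym _ _ _ mab).
    apply: na; rewrite /cells/= mem_cat; apply/orP; right; apply/mapP; exists b => //.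
      by rewrite mem_filter hl// andbT; apply/asboolP.
    by rewrite fb.
  rewrite mem_filter => /andP[/asboolP[Xx x0] xl] bx.
  have [_ Xfx _] := matched_in (fP x Xx).
  have e : f x = b by apply: (single_inj (hm _ (hr1 x xl) Xfx)).
  have mxb := fP x Xx; rewrite e in mxb.
  by apply: a0; rewrite (muniq _ _ _ _ (msym _ _ _ mab) (msym _ _ _ mxb)).
move=> r _; split=> // a; rewrite points_res => -[Xa na] _.
exists (f a); split.
  by apply: (matched_setD cross) => //; exact: fP.
have a0 : ~ inb r0 a by move=> /in0 h; apply: na; rewrite /cells/= mem_cat h.
have [lt|le] := ltP L (rho a (f a)).
  apply: contrapT => h; apply: nv; exists a, (f a); split; first exact: fP.
  split=> // i; rewrite ffunE subr0 mul1r ltNge; apply/negP => hi.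
  by apply: h; exists i; lra.
apply: contrapT => h; apply: a0 => i.
have : `|tnth a i : R| < r0%:R.
  rewrite ltNge; apply/negP => hi; apply: h; exists i.
  by apply: lt_le_trans hi; lra.
by rewrite ltr_norml => /andP[/ltW -> ->].
Qed.

Lemma prb_visit (L : R) : 0 <= L -> prb P (pev Pi (ev_pair (visit L 1 2 0))) = 1.
Proof.
move=> L0; set V := pev Pi _.
have mV : measurable V by apply: (measurable_pev hPi); apply/opn_ev_pair/opn2_visit.
suff : prb P (~` V) = 0 by rewrite prb_setC//; lra.
apply: negligible_prb0; first exact: measurableC.
(* The level and the list of cells depend on [w], but range over a countable set, so the union of
   null events is null. *)
pose F (ms : nat * seq K) := if 0 \in ms.2 then outer_ev ms.1 ms.2 else set0.
have sub : ~` V `<=` ~` complete_at `|` \bigcup_ms F ms.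
  move=> w nV; have [cw|cw] := pselect (complete_at w); last by left.
  right; have [|m [s [s0 hms]]] := outer_ev_ex L0 cw.
    by move=> h; apply: nV; split=> //; case: cw => -[].
  by exists (m, s) => //; rewrite /F/= s0.
apply: (negligibleS sub); apply: negligibleU; first exact: complete_ae.
apply: negligible_bigcup_count => -[m s]; rewrite /F/=.
by case: ifP => [/outer_ev_null//|_]; exact: negligible_set0.
Qed.

End insertion.

(** * Vitali covering *)

(** Greedy selection: keep an element of largest radius, discard all that meet it, and repeat on the
    rest. *)
Lemma vitali_seq (R : realDomainType) (T : eqType) (s : seq T) (rad : T -> R) (meet : rel T) :
  (forall x, meet x x) ->
  exists s', [/\ {subset s' <= s}, pairwise (fun x y => ~~ meet x y) s' &
    forall x, x \in s -> exists2 z, z \in s' & meet z x /\ rad x <= rad z].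
Proof.
move=> mxx; have [n] := ubnP (size s); elim: n s => // n IH s; rewrite ltnS => sn.
case: s sn => [|a s] sn; first by exists [::].
have [z [zs _ zmax]] := seq_argmin (A := fun=> True) (fun x => - rad x) (mem_head a s) I.
have [|s' [sub pw cov]] := IH [seq x <- a :: s | ~~ meet z x].
  rewrite (leq_trans _ sn)// size_filter -(count_predC (meet z) (a :: s)) -addn1 addnC.
  by rewrite leq_add// -has_count; apply/hasP; exists z.
exists (z :: s'); split.
- by move=> x; rewrite inE => /orP[/eqP->//|/sub]; rewrite mem_filter => /andP[].
- rewrite /= pw andbT; apply/allP => x /sub; rewrite mem_filter => /andP[].
  by [].
- move=> x xs; have [zx|zx] := boolP (meet z x).
    exists z; first exact: mem_head.
    by split=> //; rewrite -lerN2; exact: zmax.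
  have [|y ys' h] := cov x; first by rewrite mem_filter zx.
  by exists y => //; rewrite inE ys' orbT.
Qed.

(** * Counting lattice points in intervals and cubes *)

Section counting.
Context {R : realType}.

Lemma card_ball_le N (t r : R) (c : nat) : 0 < r -> 2 * r <= c%:R ->
  (#|[pred j : 'I_N | (`|t - j%:R| < r)%R]| <= c)%N.
Proof.
move=> r0 rc; rewrite -cardsE; apply: card_diam => x y; rewrite !inE => hx hy xy.
rewrite -(ltr_nat R) natrB//; apply: lt_le_trans rc.
by move: hx hy; rewrite !ltr_norml => /andP[? ?] /andP[? ?]; lra.
Qed.

(** The integers from [floor t] to [floor t + c - 1] are at distance less than [s] from [t], since
    [1 <= s] and [c - 1 < s]. *)
Lemma card_ball_ge N Q (t s : R) (c : nat) : 1 <= s -> c%:R < s + 1 ->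
  - Q%:R + 1 <= t - s -> t + s <= N%:R - Q%:R ->
  (c <= #|[pred j : 'I_N | (`|t - (j%:R - Q%:R)| < s)%R]|)%N.
Proof.
move=> s1 cs tQ tN.
have /andP[f1 f2] := floor_itv t; rewrite intrD in f2.
have Hi (i : 'I_c) : (absz (Num.floor t + i%:Z + Q%:Z)%R < N)%N /\
    (absz (Num.floor t + i%:Z + Q%:Z)%R)%:R = (Num.floor t)%:~R + i%:R + Q%:R :> R.
  have ic : (i%:R + 1 <= c%:R :> R) by rewrite natr1 ler_nat.
  have i0 : 0 <= i%:R :> R by [].
  have p0 : (0 <= Num.floor t + i%:Z + Q%:Z)%R.
    by rewrite -(ler_int R) !intrD -!pmulrn; lra.
  have E : (absz (Num.floor t + i%:Z + Q%:Z)%R)%:R = (Num.floor t)%:~R + i%:R + Q%:R :> R.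
    by rewrite natr_absz (ger0_norm p0) !intrD -!pmulrn.
  by split=> //; rewrite -(ltr_nat R) E; lra.
pose g (i : 'I_c) := Ordinal (Hi i).1.
have ginj : injective g.
  move=> i j /(congr1 val)/= /(congr1 (fun n : nat => n%:R : R)).
  by rewrite (Hi i).2 (Hi j).2 => /addIr/addrI/eqP; rewrite eqr_nat => /eqP/val_inj.
rewrite -[X in (X <= _)%N](card_ord c) -(card_codom ginj).
apply: subset_leq_card; apply/fintype.subsetP => _ /codomP[i ->]; rewrite inE/= (Hi i).2.
have ic : (i%:R + 1 <= c%:R :> R) by rewrite natr1 ler_nat.
have i0 : 0 <= i%:R :> R by [].
by rewrite addrK ltr_norml; apply/andP; split; lra.
Qed.

Context {d : nat}.

Lemma card_cube N (B : 'I_d -> pred 'I_N) :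
  #|[pred f : {ffun 'I_d -> 'I_N} | [forall i, B i (f i)]]| = (\prod_i #|B i|)%N.
Proof.
rewrite (_ : #|_| = #|family B|); last first.
  by apply: eq_card => f; apply/idP/familyP => [/forallP|H]; last apply/forallP.
by rewrite card_family foldrE big_map big_enum.
Qed.

End counting.

Lemma card_cover_seq (I : finType) (T : eqType) (A : pred I) (U : T -> pred I) (s : seq T) :
  (forall j, A j -> exists2 z, z \in s & U z j) -> (#|A| <= \sum_(z <- s) #|U z|)%N.
Proof.
elim: s A => [|a s IH] A H.
  rewrite big_nil leqn0; apply/eqP/eq_card0 => j; apply/negP => /H[z].
  by rewrite in_nil.
rewrite big_cons -(cardID (U a) A) leq_add//.
  by apply: subset_leq_card; apply/fintype.subsetP => j; rewrite !inE => /andP[].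
apply: IH => j; rewrite !inE => /andP[nU /H[z]]; rewrite inE => /orP[/eqP->|zs] Uz.
  by move: nU; rewrite unfold_in Uz.
by exists z.
Qed.

Lemma card_disjoint_seq (I : finType) (T : eqType) (B : pred I) (V : T -> pred I)
    (m : rel T) (s : seq T) :
  (forall z, z \in s -> forall j, V z j -> B j) -> pairwise m s ->
  (forall x y j, m x y -> V x j -> V y j -> False) -> (\sum_(z <- s) #|V z| <= #|B|)%N.
Proof.
move=> + + dis; elim: s B => [|a s IH] B sub /=; first by rewrite big_nil.
move=> /andP[/allP am pw]; rewrite big_cons -(cardID (V a) B) leq_add//.
  apply: subset_leq_card; apply/fintype.subsetP => j aj; rewrite inE; apply/andP; split=> //.
  by apply: (sub a (mem_head _ _)).
apply: IH => // z zs j zj; rewrite inE/=; apply/andP; split.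
  by apply/negP => aj; exact: dis (am z zs) aj zj.
by apply: (sub z _ _ zj); rewrite inE zs orbT.
Qed.

Section visits.
Context {R : realType} {d : nat}.
Notation S := (Rspace R d).
Notation rho := (@euclidean_dist R d).
Notation K := {ffun 'I_d -> int}.

Definition pt N Q (j : {ffun 'I_d -> 'I_N}) : K := [ffun i => (j i)%:Z - Q%:Z].

(** The cap [M] keeps all pairs that reach a box within a bounded distance of it. *)
Definition visitM (L M : R) (u : K) : set (S -> nat) :=
  ev_pair (fun x y => visit L 2 0 u x y /\ rho x y < M).

(* Vitali covering by the cubes of side of order the length of the pairs. *)
Lemma count_visits (k L M : R) (c N Q : nat) (xi : S -> nat) :
  0 < k -> 1 <= L -> 2 / k <= L -> (20 + 8 * k) / k <= c%:R ->
  (2 + k) * M + 2 <= Q%:R -> nice xi ->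
  (#|[pred j : {ffun 'I_d -> 'I_N} | `[< visitM L M (pt 0 j) xi >] ]| <=
   c ^ d * #|[pred j : {ffun 'I_d -> 'I_(N + 2 * Q)} |
               `[< ev_pair (visit L (k / 2) 0 (pt Q j)) xi >] ]|)%N.
Proof.
move=> k0 L1 Lk ck QM nxi.
set X := points xi.
pose f x := xget x [set y | matched rho X x y].
have fP x y : matched rho X x y -> f x = y.
  move=> m; apply: (@matched_uniq _ _ rho (@edistC R d) X x) => //.
  exact: (@xgetI _ x [set y | matched rho X x y] y).
pose rad x := rho x (f x).
pose rel x := [/\ matched rho X x (f x), L < rad x, rad x < M &
  exists j : {ffun 'I_d -> 'I_N}, forall i, `|(tnth x i : R) - (j i)%:R| < 2 * rad x].
pose r := (Num.truncn (N%:R + 2 * M)).+1.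
have [l hl] := nice_finite r nxi.
pose s := [seq x <- l | `[< rel x >]].
have sP x : rel x -> x \in s.
  move=> rx; rewrite mem_filter; apply/andP; split; first exact/asboolP.
  have [m _ rM [j hj]] := rx; apply: hl; last by case: (matched_in m).
  move=> i; have := hj i; rewrite ltr_norml => /andP[h1 h2].
  have : N%:R + 2 * M < r%:R by exact: truncnS_gt.
  have : (j i)%:R + 1 <= N%:R :> R by rewrite natr1 ler_nat.
  have : 0 <= (j i)%:R :> R by [].
  by move=> *; apply/andP; split; lra.
have sR x : x \in s -> rel x by rewrite mem_filter => /andP[/asboolP].
(* The cubes of half-side [k / 2 * rad] around non-meeting points are disjoint. *)
pose meet (z x : S) := [forall i, `|(tnth z i : R) - tnth x i| <= k / 2 * (rad z + rad x)].
have meetxx x : meet x x.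
  apply/forallP => i; rewrite subrr normr0 mulr_ge0 ?divr_ge0 ?addr_ge0 ?edist_ge0//.
  exact: ltW.
have [s' [ss' pw cov]] := @vitali_seq _ _ s rad meet meetxx.
(* If [x] meets [z] and [rad x <= rad z], a lattice point within [2 * rad x] of [x] is within [2 *
   rad x + k / 2 * (rad z + rad x) <= (2 + k) * rad z] of [z]. *)
pose U (z : S) := [pred j : {ffun 'I_d -> 'I_N} |
  [forall i, (`|(tnth z i : R) - (j i)%:R| < (2 + k) * rad z)%R]].
pose V (z : S) := [pred j : {ffun 'I_d -> 'I_(N + 2 * Q)} |
  [forall i, (`|(tnth z i : R) - ((j i)%:R - Q%:R)| < k / 2 * rad z)%R]].
have ptE n q (j : {ffun 'I_d -> 'I_n}) i : ((pt q j i)%:~R : R) = (j i)%:R - q%:R.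
  by rewrite ffunE intrD rmorphN/= -!pmulrn.
apply: (@leq_trans (\sum_(z <- s') #|U z|)).
  apply: card_cover_seq => j /asboolP[x [y [m [[Lr near] rM]]]].
  have e := fP _ _ m.
  have rx : rel x.
    split; rewrite /rad ?e//; exists j => i.
    by have := near i; rewrite ptE mulr0n subr0 addr0.
  have [z zs' [/forallP mt rz]] := cov x (sP x rx).
  exists z => //; apply/forallP => i.
  have := near i; have := mt i; rewrite ptE mulr0n subr0 addr0 -e -/(rad x).
  have := ler_distD (tnth x i : R) (tnth z i) (j i)%:R.
  have : k / 2 * (rad z + rad x) <= k * rad z.
    have : 0 <= k * (rad z - rad x) by rewrite mulr_ge0 ?subr_ge0// ltW.
    lra.
  lra.
apply: (@leq_trans (\sum_(z <- s') (c ^ d * #|V z|))).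
  rewrite big_seq [leqRHS]big_seq; apply: leq_sum => z /ss'/sR[m Lr rM [j hj]].
  have -> : #|U z| = (\prod_i #|[pred j : 'I_N | (`|(tnth z i : R) - j%:R| < (2 + k) * rad z)%R]|)%N.
    exact: (card_cube (fun i => [pred j : 'I_N | (`|(tnth z i : R) - j%:R| < (2 + k) * rad z)%R])).
  have -> : #|V z| = (\prod_i #|[pred j : 'I_(N + 2 * Q) |
      (`|(tnth z i : R) - (j%:R - Q%:R)| < k / 2 * rad z)%R]|)%N.
    exact: (card_cube (fun i => [pred j : 'I_(N + 2 * Q) |
      (`|(tnth z i : R) - (j%:R - Q%:R)| < k / 2 * rad z)%R])).
  rewrite -[X in (c ^ X * _)%N]card_ord -prod_nat_const -big_split/=.
  apply: leq_prod => i _.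
  have r1 : 1 <= rad z by lra.
  set t := tnth z i : R; set sz := k / 2 * rad z.
  have s1 : 1 <= sz.
    rewrite /sz; have : 2 / k <= rad z by lra.
    by rewrite ler_pdivrMr// => h; lra.
  (* Per coordinate, at most [C1 <= (5 + 2 k) rad z] integers are covered and at least [c1 >= 1] are
     kept, where [k / 2 * rad z <= 2 c1]. Hence [C1 <= 4 (5 + 2 k) / k * c1], which is the origin of
     the bound on [c]. *)
  pose c1 := Num.truncn sz; pose C1 := (Num.truncn (2 * ((2 + k) * rad z))).+1.
  have sz0 : 0 <= sz by lra.
  have /andP[c1s sc1] := truncn_itv sz0.
  have rr0 : 0 <= 2 * ((2 + k) * rad z) by apply: mulr_ge0 => //; apply: mulr_ge0; lra.
  have /andP[C1s sC1] := truncn_itv rr0.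
  have := hj i; rewrite -/t ltr_norml => /andP[h1 h2].
  have jN : (j i)%:R + 1 <= N%:R :> R by rewrite natr1 ler_nat.
  have j0 : 0 <= (j i)%:R :> R by [].
  have kM : k * rad z <= k * M by rewrite ler_pM2l// ltW.
  have kr : 0 <= k * rad z by rewrite mulr_ge0 ?edist_ge0// ltW.
  have hV : (c1 <= #|[pred j : 'I_(N + 2 * Q) | (`|t - (j%:R - Q%:R)| < sz)%R]|)%N.
    apply: card_ball_ge => //.
    - by apply: le_lt_trans c1s _; lra.
    - by rewrite /sz; lra.
    - by rewrite natrD natrM /sz; lra.
  have hU : (#|[pred j : 'I_N | (`|t - j%:R| < (2 + k) * rad z)%R]| <= C1)%N.
    apply: card_ball_le; first by apply: mulr_gt0; lra.
    exact: ltW.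
  apply: (leq_trans hU); apply: (@leq_trans (c * c1)); last by rewrite leq_mul2l hV orbT.
  rewrite -(ler_nat R) natrM /C1 -natr1.
  have c11 : 1 <= c1%:R :> R.
    rewrite ler1n lt0n; apply/eqP => c10.
    by move: sc1; rewrite -/c1 c10; lra.
  have q1 : 20 + 8 * k <= c%:R * k by move: ck; rewrite ler_pdivrMr.
  have q2 : k / 2 * rad z <= 2 * c1%:R by move: sc1; rewrite -/c1 /sz -natr1; lra.
  have q3 : 2 * ((2 + k) * rad z) + 1 <= (5 + 2 * k) * rad z by lra.
  have q4 : (5 + 2 * k) * rad z * k <= (5 + 2 * k) * (4 * c1%:R).
    by rewrite -mulrA ler_pM2l; lra.
  have q5 : (5 + 2 * k) * (4 * c1%:R) <= c%:R * c1%:R * k.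
    by rewrite (_ : _ * (4 * _) = (20 + 8 * k) * c1%:R); [rewrite mulrAC ler_wpM2r|ring].
  have q6 : (5 + 2 * k) * rad z <= c%:R * c1%:R.
    by rewrite -(ler_pM2r k0); apply: le_trans q4 q5.
  by move: C1s; lra.
rewrite -big_distrr/= leq_mul2l; apply/orP; right.
apply: (card_disjoint_seq _ pw).
- move=> z /ss'/sR[m Lr rM _] j /forallP h; apply/asboolP.
  exists z, (f z); split=> //; split=> // i; rewrite ptE addr0; exact: h.
- move=> x y j nm /forallP hx /forallP hy; move/negP: nm; apply.
  apply/forallP => i; have := hx i; have := hy i.
  have := ler_distD ((j i)%:R - Q%:R) (tnth x i : R) (tnth y i).
  by rewrite (distrC ((j i)%:R - Q%:R)) mulrDr; lra.
Qed.

End visits.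

(** * Transience has probability zero *)

Section prb_counting.
Context {R : realType} {dT : measure_display} {T : measurableType dT}
  (P : probability T R).

Lemma integral_count (I : finType) (A : I -> set T) : (forall i, measurable (A i)) ->
  (\int[P]_w (#|[pred i | `[< A i w >] ]|%:R)%:E = (\sum_i prb P (A i))%:E)%E.
Proof.
move=> mA.
rewrite (eq_integral (fun w => \sum_i (\1_(A i) w)%:E)%E); last first.
  move=> w _; rewrite sumEFin -sum1_card natr_sum big_mkcond/=; congr (_%:E).
  apply: eq_bigr => i _; rewrite indicE inE/=.
  case: asboolP => h; first by rewrite mem_set.
  by rewrite memNset.
rewrite ge0_integral_sum//; last first.
  by move=> i; apply/measurable_EFinP; apply: measurable_indic.
rewrite -sumEFin; apply: eq_bigr => i _.
by rewrite integral_indic// setIT; exact: prbE.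
Qed.

(** The expectation of a number of events is the sum of their probabilities, so a pointwise
    comparison of counts can be integrated. *)
Lemma prb_counting (I J : finType) (A : I -> set T) (B : J -> set T) (c : nat) :
  (forall i, measurable (A i)) -> (forall j, measurable (B j)) ->
  (forall w, (#|[pred i | `[< A i w >] ]| <= c * #|[pred j | `[< B j w >] ]|)%N) ->
  \sum_i prb P (A i) <= c%:R * \sum_j prb P (B j).
Proof.
move=> mA mB H.
have mc (I' : finType) (A' : I' -> set T) : (forall i, measurable (A' i)) ->
   measurable_fun setT (fun w => (#|[pred i | `[< A' i w >] ]|%:R)%:E : \bar R).
  move=> mA'; rewrite (_ : (fun w => _) = fun w => (\sum_i (\1_(A' i) w)%:E)%E).
    by apply: emeasurable_sum => i; apply/measurable_EFinP; apply: measurable_indic.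
  apply/funext => w; rewrite sumEFin -sum1_card natr_sum big_mkcond/=; congr (_%:E).
  apply: eq_bigr => i _; rewrite indicE inE/=.
  case: asboolP => h; first by rewrite mem_set.
  by rewrite memNset.
rewrite -lee_fin EFinM -!integral_count//.
rewrite -ge0_integralZl//; last exact: mc.
apply: ge0_le_integral => //; [exact: mc| | ].
  by apply: measurable_funeM; exact: mc.
by move=> w _; rewrite -EFinM lee_fin -natrM ler_nat.
Qed.

End prb_counting.

Section transience.
Context {R : realType} {d : nat} {dT : measure_display}
  {T : measurableType dT} (P : probability T R) (Pi : T -> Rspace R d -> nat).
Notation S := (Rspace R d).
Notation rho := (@euclidean_dist R d).
Notation K := {ffun 'I_d -> int}.
Context (hPi : poisson_process P (@lebesgue_space R d) Pi) (d0 : (0 < d)%N).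
Notation good := (good Pi).

Lemma ev_pair_shift u (phi psi : S -> S -> Prop) :
  (forall x y, psi x y <-> phi (shiftp u x) (shiftp u y)) ->
  ev_pair phi = [set xi | ev_pair psi (shiftc u xi)].
Proof.
move=> E; apply/seteqP; split=> xi [x [y [m h]]].
  exists (shiftp (- u) x), (shiftp (- u) y); split.
    by apply/matched_shift; rewrite !shiftpVK.
  by apply/E; rewrite !shiftpVK.
by exists (shiftp u x), (shiftp u y); split; [exact/matched_shift|exact/E].
Qed.

Lemma visit_shift L k c u (x y : S) :
  visit L k c 0 x y <-> visit L k c u (shiftp u x) (shiftp u y).
Proof.
rewrite /visit edist_shift; split=> -[h1 h2]; split=> // i; have := h2 i;
  by rewrite tnth_mktuple ffunE mulr0z subr0 addrK.
Qed.

Variables (k : R) (k0 : 0 < k).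

(** The length bound [-1] imposes nothing, distances being nonnegative. *)
Definition reach (C : nat) (u : K) : set (S -> nat) :=
  ev_pair (visit (-1) k (- C%:R) u).

Lemma reachE u C : reach C u = [set xi | reach C 0 (shiftc u xi)].
Proof. by apply: ev_pair_shift => x y; exact: visit_shift. Qed.

Lemma opn_reach C u : opn (reach C u).
Proof. by apply/opn_ev_pair/opn2_visit/ltW. Qed.

Definition transient : set T := \bigcup_C (good `\` pev Pi (reach C 0)).

Lemma reach_le C C' u : (C <= C')%N -> reach C' u `<=` reach C u.
Proof.
move=> CC xi [x [y [m [h1 h2]]]]; exists x, y; split=> //; split=> // i.
by apply: lt_le_trans (h2 i) _; rewrite lerD2l lerN2 ler_nat.
Qed.

(** Moving the origin to [u] changes [C] by at most the largest coordinate of [u]; this is the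
    translation invariance of [transient]. *)
Lemma transientE u : transient = \bigcup_C (good `\` pev Pi (reach C u)).
Proof.
pose n := (\max_(i < d) absz (u i))%N.
have un i : `|(u i)%:~R| <= n%:R :> R.
  by rewrite -intr_norm -natr_absz ler_nat; exact: leq_bigmax.
apply/seteqP; split=> w [C _ [gw h]]; exists (C + n)%N => //; split=> // -[_ [x [y [m [h1 h2]]]]];
  apply: h; split=> //; exists x, y; split=> //; split=> // i; have := h2 i; have := un i.
- rewrite natrD ffunE subr0 => ui xi.
  have := ler_distD (u i)%:~R (tnth x i : R) 0; rewrite !subr0; lra.
- rewrite natrD ffunE subr0 => ui xi.
  have := ler_distD 0 (tnth x i : R) (u i)%:~R; rewrite !subr0 sub0r normrN; lra.
Qed.

Lemma measurable_transient : measurable transient.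
Proof.
apply: bigcup_measurable => C _; apply: measurableD; first exact: (measurable_good hPi).
by apply: (measurable_pev hPi); exact: opn_reach.
Qed.

Lemma opnI (F G : set (S -> nat)) : opn F -> opn G -> opn (F `&` G).
Proof.
move=> oF oG xi nxi [/(oF _ nxi)[n hn] /(oG _ nxi)[m hm]].
exists (maxn n m) => xi' E; split; [apply: hn|apply: hm]; apply: eqv_le E.
  exact: leq_maxl.
exact: leq_maxr.
Qed.

(** [transient] is an increasing union of complements of stable events, so its trace on [F] is a
    limit of differences of probabilities of stable events. *)
Lemma transient_cvg u (F : set (S -> nat)) : measurable (pev Pi F) ->
  (forall C, measurable (pev Pi (F `&` reach C u))) ->
  (fun C => prb P (pev Pi F) - prb P (pev Pi (F `&` reach C u))) @ \oo -->
  prb P (transient `&` pev Pi F).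
Proof.
move=> mF mG.
rewrite (transientE u) setI_bigcupl.
rewrite (_ : (fun C => _) = (fun C => prb P ((good `\` pev Pi (reach C u)) `&` pev Pi F))).
  have mr C : measurable (pev Pi (reach C u)).
    by apply: (measurable_pev hPi); exact: opn_reach.
  apply: prb_nondecreasing => [C|C C' CC w [[gw h] hF]].
    apply: measurableI => //; apply: measurableD => //; exact: (measurable_good hPi).
  by split=> //; split=> // -[_ h']; apply: h; split=> //; exact: reach_le CC _ h'.
apply/funext => C; rewrite -prb_setD//; last by move=> w [gw [hF _]].
congr prb; apply/seteqP; split=> w.
  move=> [[gw hF] h]; split=> //; split=> // -[_ hr]; apply: h; split=> //.
by move=> [[gw h] hF]; split=> // -[_ [_ hr]]; apply: h.
Qed.

(** Both sides are limits of the same differences: [F0] and [reach] are shifted together, and each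
    term is invariant by [pev_shift]. *)
Lemma transient_shift u (F0 : set (S -> nat)) : opn F0 ->
  measurable (transient `&` pev Pi [set xi | F0 (shiftc u xi)]) /\
  prb P (transient `&` pev Pi [set xi | F0 (shiftc u xi)]) =
  prb P (transient `&` pev Pi F0).
Proof.
move=> oF; have mF := measurable_pev_shift hPi u oF.
have oG C := opnI oF (@opn_reach C 0).
have GE C : [set xi | F0 (shiftc u xi)] `&` reach C u =
    [set xi | (F0 `&` reach C 0) (shiftc u xi)] by rewrite (reachE u).
split; first by apply: measurableI => //; exact: measurable_transient.
have c1 : (fun C => prb P (pev Pi F0) - prb P (pev Pi (F0 `&` reach C 0))) @ \oo -->
    prb P (transient `&` pev Pi F0).
  apply: transient_cvg; first exact: (measurable_pev hPi).
  by move=> C; exact: (measurable_pev hPi).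
have c2 : (fun C => prb P (pev Pi F0) - prb P (pev Pi (F0 `&` reach C 0))) @ \oo -->
    prb P (transient `&` pev Pi [set xi | F0 (shiftc u xi)]).
  rewrite (_ : (fun C => _) = (fun C => prb P (pev Pi [set xi | F0 (shiftc u xi)]) -
      prb P (pev Pi ([set xi | F0 (shiftc u xi)] `&` reach C u)))).
    apply: transient_cvg => // C; rewrite GE; exact: (measurable_pev_shift hPi).
  by apply/funext => C; rewrite GE !(pev_shift hPi d0).
exact: (cvg_unique _ c2 c1).
Qed.

Lemma opn_visitM L M u : opn (visitM L M u : set (S -> nat)).
Proof.
apply/opn_ev_pair/opn2_and; first exact: opn2_visit.
have h : opn2 (fun x y : S => 0 < M - rho x y).
  apply: (@opn2_lt _ _ _ 2) => // n x y x' y' xx yy.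
  by have := dist_lip xx yy; rewrite ler_norml => /andP[h1 h2]; lra.
by move=> x y Lr; have [|n hn] := h x y; [rewrite subr_gt0|
  exists n => x' y' xx yy; rewrite -subr_gt0; exact: hn].
Qed.

Lemma visitM_shift L M u :
  visitM L M u = [set xi : S -> nat | visitM L M 0 (shiftc u xi)].
Proof. by apply: ev_pair_shift => x y; rewrite edist_shift -visit_shift. Qed.

Let near_visit (L : R) u : set (S -> nat) := ev_pair (visit L (k / 2) 0 u).

Let near_visit_shift L u : near_visit L u = [set xi | near_visit L 0 (shiftc u xi)].
Proof. by apply: ev_pair_shift => x y; exact: visit_shift. Qed.

Let opn_near_visit L u : opn (near_visit L u).
Proof. by apply/opn_ev_pair/opn2_visit; rewrite divr_ge0// ltW. Qed.

Lemma prb_visitM_le (L M : R) (c : nat) : 1 <= L -> 2 / k <= L ->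
  (20 + 8 * k) / k <= c%:R ->
  prb P (transient `&` pev Pi (visitM L M 0)) <=
  ((3 * c) ^ d)%N%:R * prb P (transient `&` pev Pi (near_visit L 0)).
Proof.
move=> L1 Lk ck.
(* [Q] is both the side of the box and the margin around it, so the larger box has side [3 Q] and
   the ratio of the two is [3^d], whatever [M] is. *)
pose Q := (Num.truncn ((2 + k) * M + 2)).+1.
have QM : (2 + k) * M + 2 <= Q%:R by exact/ltW/truncnS_gt.
pose A (j : {ffun 'I_d -> 'I_Q}) := transient `&` pev Pi (visitM L M (pt 0 j)).
pose B (j : {ffun 'I_d -> 'I_(Q + 2 * Q)}) := transient `&` pev Pi (near_visit L (pt Q j)).
have mA j : measurable (A j).
  by rewrite /A visitM_shift; exact: (transient_shift _ (@opn_visitM L M 0)).1.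
have mB j : measurable (B j).
  by rewrite /B near_visit_shift; exact: (transient_shift _ (@opn_near_visit L 0)).1.
have H w : (#|[pred j | `[< A j w >] ]| <= c ^ d * #|[pred j | `[< B j w >] ]|)%N.
  have [tw|tw] := pselect (transient w); last first.
    by rewrite eq_card0// => j; apply/asboolP => -[].
  have gw : good w by case: tw => C _ [].
  have e1 : #|[pred j | `[< A j w >] ]| =
      #|[pred j : {ffun 'I_d -> 'I_Q} | `[< visitM L M (pt 0 j) (Pi w) >] ]|.
    by apply: eq_card => j; rewrite !inE/=; apply/asboolP/asboolP => [[_ []]|].
  have e2 : #|[pred j | `[< B j w >] ]| =
      #|[pred j : {ffun 'I_d -> 'I_(Q + 2 * Q)} | `[< near_visit L (pt Q j) (Pi w) >] ]|.
    by apply: eq_card => j; rewrite !inE/=; apply/asboolP/asboolP => [[_ []]|].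
  rewrite e1 e2; exact: (count_visits Q k0 L1 Lk ck QM (good_nice gw)).
have := prb_counting P mA mB H.
rewrite (eq_bigr (fun=> prb P (transient `&` pev Pi (visitM L M 0)))); last first.
  by move=> j _; rewrite /A (visitM_shift L M (pt 0 j)); exact: (transient_shift _ (@opn_visitM L M 0)).2.
rewrite [X in _ <= _ * X](eq_bigr (fun=> prb P (transient `&` pev Pi (near_visit L 0)))); last first.
  by move=> j _; rewrite /B (near_visit_shift L (pt Q j)); exact: (transient_shift _ (@opn_near_visit L 0)).2.
rewrite !sumr_const !card_ffun !card_ord -!(mulr_natl (prb P _)) => h.
have Q0 : 0 < (Q ^ d)%N%:R :> R by rewrite ltr0n expn_gt0.
rewrite -(ler_pM2l Q0); apply: (le_trans h).
rewrite !mulrA -!natrM -!expnMn (_ : (c * (Q + 2 * Q) = Q * (3 * c))%N)//; lia.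
Qed.

Lemma prb_transient : prb P transient = 0.
Proof.
pose c := (Num.truncn ((20 + 8 * k) / k)).+1.
have ck : (20 + 8 * k) / k <= c%:R by exact/ltW/truncnS_gt.
(* [L >= 2] turns the bound [rho x y + 2] of [prb_visit] into [2 * rho x y]; [L >= 2 / k] is asked
   for by the covering argument. *)
pose L0 := (Num.truncn (2 + 2 / k)).+1.
have L0k : 2 + 2 / k <= L0%:R by exact/ltW/truncnS_gt.
have k2 : 0 <= 2 / k by rewrite divr_ge0// ltW.
pose b n := prb P (transient `&` pev Pi (near_visit (L0 + n)%N%:R 0)).
have mB n : measurable (transient `&` pev Pi (near_visit (L0 + n)%N%:R 0)).
  apply: measurableI; first exact: measurable_transient.
  by apply: (measurable_pev hPi); exact: opn_near_visit.
have mt := measurable_transient.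
have H n : prb P transient <= ((3 * c) ^ d)%N%:R * b n.
  set L : R := (L0 + n)%N%:R.
  have hL : 2 + 2 / k <= L by apply: (le_trans L0k); rewrite ler_nat leq_addr.
  have L1 : 1 <= L by lra.
  have Lk : 2 / k <= L by lra.
  have mM (M : nat) : measurable (transient `&` pev Pi (visitM L M%:R 0)).
    apply: measurableI => //; apply: (measurable_pev hPi); exact: opn_visitM.
  have mV : measurable (pev Pi (ev_pair (visit L 1 2 0))).
    by apply: (measurable_pev hPi); apply/opn_ev_pair/opn2_visit.
  have sub : pev Pi (ev_pair (visit L 1 2 0)) `<=` \bigcup_M pev Pi (visitM L M%:R 0).
    move=> w [gw [x [y [m [h1 h2]]]]].
    exists (Num.truncn (rho x y)).+1 => //; split=> //; exists x, y; split=> //.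
    split; last exact: truncnS_gt.
    by split=> // i; apply: lt_le_trans (h2 i) _; lra.
  have mU : measurable (\bigcup_M (transient `&` pev Pi (visitM L M%:R 0))).
    by apply: bigcup_measurable => M _.
  apply: (@le_trans _ _ (prb P (\bigcup_M (transient `&` pev Pi (visitM L M%:R 0))))).
    have : prb P transient <= prb P (transient `&` pev Pi (ev_pair (visit L 1 2 0))) +
        prb P (~` pev Pi (ev_pair (visit L 1 2 0))).
      rewrite -prb_setU//.
      - apply: prb_le => //.
          by apply: measurableU; [exact: measurableI|exact: measurableC].
        move=> w tw; have [h|h] := pselect (pev Pi (ev_pair (visit L 1 2 0)) w).
          by left.
        by right.
      - exact: measurableI.
      - exact: measurableC.
      - by apply/seteqP; split=> w // -[[_ ?]].
    rewrite prb_setC// (prb_visit hPi d0); last by lra.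
    rewrite subrr addr0 => /le_trans; apply; apply: prb_le => //.
      exact: measurableI.
    by move=> w [tw /sub[M _ hM]]; exists M.
  apply: (cvg_le_bound (prb_nondecreasing mM _)) => [M M' MM w [tw [gw]]|M].
    move=> [x [y [m [h1 h2]]]]; split=> //; split=> //; exists x, y; split=> //.
    by split=> //; apply: lt_le_trans h2 _; rewrite ler_nat.
  exact: prb_visitM_le.
(* On the part of [transient] with constant [C], a near visit longer than [2 C / k] would give
   [k / 2 * rho x y < k * rho x y - C], hence a forbidden pair. *)
have bc : b @ \oo --> (0 : R).
  rewrite -(prb0 P) (_ : set0 = \bigcap_n (transient `&` pev Pi (near_visit (L0 + n)%N%:R 0))).
    apply: prb_nonincreasing => // m n mn w [tw [gw [x [y [mxy [h1 h2]]]]]].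
    split=> //; split=> //; exists x, y; split=> //; split=> //.
    by apply: le_lt_trans h1; rewrite ler_nat leq_add2l.
  apply/seteqP; split=> w // h.
  have [[C _ [gw nr]] _] := h 0%N I.
  have [_ [_ [x [y [mxy [h1 h2]]]]]] := h (Num.truncn (2 * C%:R / k)).+1 I.
  apply: nr; split=> //; exists x, y; split=> //; split.
    by apply: (lt_le_trans _ (edist_ge0 x y)); lra.
  move=> i; apply: lt_le_trans (h2 i) _.
  have : 2 * C%:R / k < rho x y.
    apply: le_lt_trans h1; apply: (le_trans (ltW (truncnS_gt _))).
    by rewrite ler_nat leq_addl.
  by rewrite ltr_pdivrMr// => hh; lra.
apply/le_anti; rewrite prb_ge0 andbT.
have cc : (fun n => ((3 * c) ^ d)%N%:R * b n - prb P transient) @ \oo -->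
    ((3 * c) ^ d)%N%:R * 0 - prb P transient.
  by apply: cvgB; [apply: cvgMr|exact: cvg_cst].
have := cvg_le_bound (u := fun n => - (((3 * c) ^ d)%N%:R * b n - prb P transient))
  (cvgN cc) (B := 0) _.
rewrite mulr0 sub0r opprK; apply => n.
by rewrite oppr_le0 subr_ge0.
Qed.

End transience.

(** * From matched pairs to active balloons *)

Section conclusion.
Context {R : realType} {d : nat}.
Notation S := (Rspace R d).
Notation rho := (@euclidean_dist R d).

Definition recurrent (X : set S) := forall n C : nat, exists x y,
  matched rho X x y /\ forall i, `|tnth x i : R| < rho x y / n.+1%:R - C%:R.

(** A matched point is active until half the length of its pair; the time used is a third of that
    length. *)
Lemma recurrent_active (X : set S) (tau : S -> \bar R) (o : S) (e M : R) :
  (0 < d)%N -> popping_times rho X tau -> recurrent X -> 0 < e ->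
  exists t x, [/\ M < t, 0 < t, active X tau t x & rho o x <= e * t].
Proof.
move=> d0 ptau rec e0.
pose z : S := [tuple (0 : R) | i < d].
(* [n] makes [d * rho x y / (n + 1)] at most [e * t]. [C] absorbs the distance from [o] to 0 and,
   being below [rho x y], forces [t > M]. *)
pose n := Num.truncn (3 * d%:R / e).
pose C := (Num.truncn (rho o z + 3 * `|M|)).+1.
have nE : 3 * d%:R / e < n.+1%:R by exact: truncnS_gt.
have CE : rho o z + 3 * `|M| < C%:R by exact: truncnS_gt.
have [x [y [m hx]]] := rec n C.
have r0 := edist_ge0 x y; have oz := edist_ge0 o z; have M0 := normr_ge0 M.
have MM := ler_norm M.
have n0 : 0 < n.+1%:R :> R by [].
have d1 : 1 <= d%:R :> R by rewrite ler1n.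
set q := rho x y / n.+1%:R in hx.
have qC : C%:R < q by rewrite -subr_gt0; exact: le_lt_trans (normr_ge0 _) (hx (Ordinal d0)).
have qr : q <= rho x y by rewrite ler_pdivrMr// ler_peMr// ler1n.
exists (rho x y / 3), x; split; [lra|lra| |].
  split; first by case: (matched_in m).
  rewrite (matched_popping (@edistC R d) (@edist_ge0 R d) ptau m) lte_fin; lra.
have zx : rho z x <= d%:R * (q - C%:R).
  apply: edist_le => [|i]; first by lra.
  by rewrite tnth_mktuple sub0r normrN ltW.
have := edist_triangle o z x.
have dq : d%:R * q <= e * (rho x y / 3).
  rewrite /q mulrA ler_pdivrMr//.
  rewrite -subr_ge0; have -> : e * (rho x y / 3) * n.+1%:R - d%:R * rho x y =
    rho x y / 3 * (e * n.+1%:R - 3 * d%:R) by field.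
  by rewrite mulr_ge0 ?divr_ge0// subr_ge0 [leRHS]mulrC -ler_pdivrMr// ltW.
have : C%:R <= d%:R * C%:R :> R by rewrite ler_peMl.
by move: zx; rewrite mulrBr; lra.
Qed.

End conclusion.

Local Open Scope ereal_scope.

Theorem theorem1 (R : realType) (d : nat) (hd : (1 <= d)%N)
    (dT : measure_display) (T : measurableType dT) (P : probability T R)
    (Pi : T -> Rspace R d -> nat) (Tau : T -> Rspace R d -> \bar R)
    (hPi : poisson_process P (@lebesgue_space R d) Pi)
    (hTau : balloon_process P (@euclidean_dist R d) Pi Tau) :
  {ae P, forall w, forall x : Rspace R d,
    ~ has_ubound [set t : R | (0 <= t)%R /\
        covered (@euclidean_dist R d) (points (Pi w)) (Tau w) t x]} /\
  (forall o : Rspace R d,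
    {ae P, forall w,
      limf_einf (fun t : R =>
          set_dist (@euclidean_dist R d) o
            (active (points (Pi w)) (Tau w) t) * (t^-1)%:E)
        (pinfty_nbhs R) = 0}).
Proof.
pose rho := @euclidean_dist R d.
(* One null set serves all points [x] and [o]; the factors [1 / (n + 1)] cover all positive [k]. *)
pose N : set T := (~` good Pi `|` \bigcup_n transient Pi (n.+1%:R^-1)) `|`
  ~` [set w | popping_times rho (points (Pi w)) (Tau w)].
have negN : P.-negligible N.
  apply: negligibleU; last exact: hTau.
  have mg := measurable_good hPi.
  apply: negligibleU.
    apply: prb_null_negligible; first exact: measurableC.
    by rewrite prb_setC// good_ae// subrr.
  apply: negligible_bigcup => n.
  have n0 : (0 < n.+1%:R^-1 :> R)%R by rewrite invr_gt0.
  apply: prb_null_negligible; first exact: (measurable_transient hPi n0).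
  exact: (prb_transient hPi hd n0).
have recN w : ~ N w -> recurrent (points (Pi w)).
  move=> nN n C; apply: contrapT => no; apply: nN; left.
  have [gw|gw] := pselect (good Pi w); last by left.
  right; exists n => //; exists C => //; split=> // -[_ [x [y [m [_ h]]]]].
  apply: no; exists x, y; split=> // i; have := h i.
  by rewrite ffunE subr0 [(_^-1 * _)%R]mulrC.
have popN w : ~ N w -> popping_times rho (points (Pi w)) (Tau w).
  by move=> nN; apply: contrapT => h; apply: nN; right.
split.
  apply: (negligibleS _ negN) => w /= h; apply: contrapT => nN; apply: h => x -[M hM].
  (* With [e = 1] the centre [y] is within [t] of [x], so [x] is covered. *)
  have [t [y [Mt t0 ay xy]]] := recurrent_active x M hd (popN w nN) (recN w nN) ltr01.
  rewrite mul1r in xy.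
  have : (t <= M)%R.
    apply: hM; split; first exact: ltW.
    by apply: (@le_trans _ _ (rho x y)%:E); [apply: ereal_inf_lbound; exists y|rewrite lee_fin].
  by rewrite leNgt Mt.
move=> o; apply: (negligibleS _ negN) => w /= h; apply: contrapT => nN; apply: h.
rewrite limf_einfE; apply/le_anti/andP; split.
  apply: ge_ereal_sup => _ [V [M [_ MV]] <-].
  apply/lee_addgt0Pr => e e0; rewrite add0e.
  have [t [y [Mt t0 ay oy]]] := recurrent_active o M hd (popN w nN) (recN w nN) e0.
  apply: (@le_trans _ _ (set_dist rho o (active (points (Pi w)) (Tau w) t) * (t^-1)%:E)).
    by apply: ereal_inf_lbound; exists t => //; exact: MV.
  apply: (@le_trans _ _ ((rho o y)%:E * (t^-1)%:E)).
    apply: lee_wpmul2r; first by rewrite lee_fin invr_ge0 ltW.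
    by apply: ereal_inf_lbound; exists y.
  by rewrite -EFinM lee_fin ler_pdivrMr.
set F := (X in ereal_sup [set ereal_inf (X @` _) | _ in _]).
(* For the lower bound the neighbourhood of positive times is enough: there the quotient is
   nonnegative, also when no balloon is active and the distance is infinite. *)
apply: (@le_trans _ _ (ereal_inf (F @` [set t | (0 < t)%R]))).
  apply: le_ereal_inf_tmp => _ [t /= t0 <-].
  apply: mule_ge0; last by rewrite lee_fin invr_ge0 ltW.
  by apply: le_ereal_inf_tmp => _ [y _ <-]; rewrite lee_fin edist_ge0.
apply: ereal_sup_ubound; exists [set t | (0 < t)%R] => //.
by exists 0%R; split; first exact: real0.
Qed.
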